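(* Let $\mu\in\mathbb{R}$ with $\mu<\frac12$, and let $\{a_n\}_{n\ge 1}$ be a sequence of complex numbers such that, for some $\delta\in\left[0,\frac{\pi}{2}\right)$, $$\sum_{m=1}^\infty \frac{|a_m|\,e^{-2\delta m}}{\left|\Gamma\left(\frac12+im-\mu\right)\right|^2}<\infty .$$ Let $f$ be the discrete index Whittaker transform of $\{a_n\}$, $$f(x)=e^{-x/2}\sum_{n=1}^\infty a_n\,W_{\mu,in}(x),\qquad x>0 .$$ Then this transformation can be inverted: for every $n\in\mathbb{N}$, $n\geq 1$, $$a_n=\frac{2^{1/2+\mu}}{\pi^2}\,\Gamma(1-2\mu)\,n\sinh(2\pi n)\int_0^\infty \Phi^\mu_n(t)\,f(t)\,t^{-3/2}\,dt,$$ where $$\Phi^\mu_n(x)=\int_0^\pi e^{x\cosh^2(u)/2}\,D_{2\mu-1}\left(\sqrt{2x}\,\cosh(u)\right)\cos(2nu)\,du,\qquad x>0,$$ and the integral over $(0,\infty)$ in the formula for $a_n$ converges absolutely.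
   Context: Here $i$ is the imaginary unit and $\Gamma$ is the Euler gamma function. $W_{\mu,\nu}(x)$, $x>0$, denotes the Whittaker function, i.e. the standard solution of Whittaker's equation $w''+\left(-\frac14+\frac{\mu}{x}+\frac{1/4-\nu^2}{x^2}\right)w=0$ with $W_{\mu,\nu}(x)\sim e^{-x/2}x^{\mu}$ as $x\to+\infty$. $D_\nu(z)$ denotes the parabolic cylinder function; for ${\rm Re}\,\alpha>0$, ${\rm Re}\,p>0$, $q\in\mathbb{C}$ it satisfies (and, for indices of negative real part, is defined by) $$\int_0^\infty x^{\alpha-1}e^{-px^2-qx}\,dx=\frac{\Gamma(\alpha)}{(2p)^{\alpha/2}}\,e^{q^2/(8p)}\,D_{-\alpha}\left(\frac{q}{\sqrt{2p}}\right).$$ *)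

(* Defs.v *)
(* [R[i]] carries no topology or measure in the libraries used, so derivatives,
   limits, sums and integrals of [R[i]]-valued functions are taken
   componentwise. *)
From HB Require Import structures.
From mathcomp Require Import all_boot all_order all_algebra.
From mathcomp Require Import complex.
From mathcomp Require Import all_classical all_reals all_analysis.

Set Implicit Arguments.
Unset Strict Implicit.
Unset Printing Implicit Defensive.

Import Order.TTheory GRing.Theory Num.Theory.
Import numFieldNormedType.Exports.

Local Open Scope classical_set_scope.
Local Open Scope ring_scope.
Local Open Scope complex_scope.

Section ComplexValued.
Context {R : realType}.

Definition cosh (x : R) : R := (expR x + expR (- x)) / 2.
Definition sinh (x : R) : R := (expR x - expR (- x)) / 2.

Definition cexp (z : R[i]) : R[i] :=
  expR (complex.Re z) *
    cos (complex.Im z) +i* (expR (complex.Re z) * sin (complex.Im z)).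

(* x ^ z with the principal logarithm; only meaningful for x > 0. *)
Definition cpow (x : R) (z : R[i]) : R[i] := cexp (z * (ln x)%:C).

Definition cderivable (w : R -> R[i]) (x : R) : Prop :=
  derivable (fun t => complex.Re (w t)) x 1 /\
  derivable (fun t => complex.Im (w t)) x 1.

Definition cderive (w : R -> R[i]) (x : R) : R[i] :=
  derive1 (fun t => complex.Re (w t)) x +i*
  derive1 (fun t => complex.Im (w t)) x.

Definition csum1 (u : nat -> R[i]) : R[i] :=
  limn (fun N => \sum_(1 <= m < N.+1) complex.Re (u m)) +i*
  limn (fun N => \sum_(1 <= m < N.+1) complex.Im (u m)).

Definition cintegrable (D : set R) (g : R -> R[i]) : Prop :=
  lebesgue_measure.-integrable D (fun x => (complex.Re (g x))%:E) /\
  lebesgue_measure.-integrable D (fun x => (complex.Im (g x))%:E).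

Definition cintegral (D : set R) (g : R -> R[i]) : R[i] :=
  (\int[lebesgue_measure]_(x in D) complex.Re (g x)) +i*
  (\int[lebesgue_measure]_(x in D) complex.Im (g x)).

End ComplexValued.

Section SpecialFunctions.
Context {R : realType}.

(* Euler's integral: this is the Gamma function on the half-plane Re z > 0. *)
Definition Gamma (z : R[i]) : R[i] :=
  cintegral `]0, +oo[ (fun t => cpow t (z - 1) * (expR (- t))%:C).

(* D_nu(z) for Re nu < 0: the formula
     int_0^oo x^(alpha-1) exp(-p x^2 - q x) dx =
       Gamma(alpha) / (2p)^(alpha/2) * exp(q^2/(8p)) * D_(-alpha)(q / sqrt(2p))
   at p = 1/2, alpha = - nu, q = z, solved for D. *)
Definition parabolic_cylinder (nu z : R[i]) : R[i] :=
  cexp (- (z ^+ 2 / 4%:R)) / Gamma (- nu) *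
  cintegral `]0, +oo[
    (fun x => cpow x (- nu - 1) * cexp (- (x ^+ 2 / 2)%:C - z * x%:C)).

(* The equation and the asymptotics determine [w] on ]0, +oo[: solutions not
   proportional to the recessive one grow like exp(x/2) x^(-mu). *)
Definition is_whittakerW (mu nu : R[i]) (w : R -> R[i]) : Prop :=
  (forall x : R, 0 < x ->
     [/\ cderivable w x, cderivable (cderive w) x
       & cderive (cderive w) x +
         (- 4%:R^-1 + mu / x%:C + (4%:R^-1 - nu ^+ 2) / (x ^+ 2)%:C) * w x = 0]) /\
  (let q := fun x : R => w x / ((expR (- (x / 2)))%:C * cpow x mu) in
   complex.Re (q x) @[x --> +oo] --> (1 : R) /\
   complex.Im (q x) @[x --> +oo] --> (0 : R)).

(* Only the values at x > 0 are meaningful. *)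
Definition whittakerW (mu nu : R[i]) : R -> R[i] :=
  xget (fun=> 0) [set w | is_whittakerW mu nu w].

Definition index_whittaker (mu : R) (a : nat -> R[i]) (x : R) : R[i] :=
  (expR (- (x / 2)))%:C *
  csum1 (fun n => a n * whittakerW mu%:C (0 +i* n%:R) x).

Definition Phi (mu : R) (n : nat) (x : R) : R[i] :=
  cintegral `[0, pi] (fun u =>
    (expR (x * cosh u ^+ 2 / 2))%:C *
    parabolic_cylinder (2 * mu - 1)%:C (Num.sqrt (2 * x) * cosh u)%:C *
    (cos (2 * n%:R * u))%:C).

End SpecialFunctions.

(* Main.v *)
(* Put a = 1/2 - mu. All substitutions are made on the logarithmic axis, where
   they are translations. Up to elementary factors, W_(mu, i m) (x) equals
     |Gamma (a + i m)|^-2 int int exp (a (s + y) - e^s - e^y - e^(s + y) / x)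
        cos (m (s - y)) ds dy,
   because this integral solves Whittaker's equation and has the right
   asymptotics, and the solution with these asymptotics is unique. A contour
   shift bounds the integral by C e^(- 2 delta m) times a power of x close to
   x^a, so the series may be integrated termwise. Integration by parts turns
   Phi_n (t) into an integral over [0, pi] of sin (2 n u) sinh u against
     L (sqrt (2 t) cosh u),  L (z) = int q^(2 a) exp (- q^2 / 2 - z q) dq / Gamma (2 a).
   By Tonelli's theorem the integral of W_(mu, i m) (t) e^(- t / 2) t^-1 against
   this L is a multiple of
     int cos (2 m r) / (cosh r + cosh u) dr = 2 pi sin (2 m u) / (sinh u sinh (2 pi m)),
   and the orthogonality of the functions sin (2 m u) on [0, pi] isolates a_n. *)
Require Import Defs.
From HB Require Import structures.
From mathcomp Require Import all_boot all_order all_algebra.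
From mathcomp Require Import complex.
From mathcomp Require Import all_classical all_reals all_analysis.
From mathcomp Require Import measurable_realfun.
From mathcomp Require Import ring lra.

Set Implicit Arguments.
Unset Strict Implicit.
Unset Printing Implicit Defensive.

Import Order.TTheory GRing.Theory Num.Theory.
Import numFieldNormedType.Exports.

Local Open Scope classical_set_scope.
Local Open Scope ring_scope.

(** * Integration on the line *)

(** The cosine in the double integral changes sign, so Tonelli's theorem is applied with 1 + cos (m
    p) in its place; the case m = 0 of the resulting identity gives integrability for every m and is
    then subtracted. Division by |Gamma (a + i m)| ^ 2 requires that Gamma has no zero on the
    vertical line; this comes from the functional equation and from the concentration of the Gamma
    density at large real part. Contours never appear as such: a contour shift says that a line
    integral, as a function of the height of the line, has derivative zero, because the derivative
    of its integrand is, by the Cauchy-Riemann equations, also a derivative along the line. The same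
    device, fed with Green's identity for the Poisson kernel of a strip, replaces the residue
    computation of the Fourier integral, whose constant is recovered in the limit at the edge of the
    strip. All kernels are real, so the real and imaginary parts of the coefficients go separately
    through one real statement. *)

Section ChangeOfVariable.
Context {R : realType}.
Local Notation lam := (@lebesgue_measure R).
Local Open Scope ereal_scope.

Lemma lebesgue_measure_shift (c : R) (A : set R) : measurable A ->
  pushforward lam (shift c : _ -> measurableTypeR R) A = lam A.
Proof.
move=> mA; apply/esym.
have mT : measurable_fun setT (shift c : R -> R) by apply: measurable_funD.
apply: lebesgue_measure_unique => //= _ [[a b]] _ <-.
rewrite /pushforward (_ : _ @^-1` _ = `](a - c)%R, (b - c)%R]%classic); last first.
  by apply/seteqP; split => x /=; rewrite !in_itv/= /shift; lra.
rewrite !lebesgue_measure_itv/= !lte_fin.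
by rewrite ltrD2r; congr (if _ then _ else _); congr EFin; rewrite opprB; lra.
Qed.

Lemma ge0_integral_shift (c : R) (f : R -> \bar R) :
  measurable_fun setT f -> (forall x, 0 <= f x) ->
  \int[lam]_x f (x + c)%R = \int[lam]_x f x.
Proof.
move=> mf f0.
have mT : measurable_fun setT (shift c : R -> R) by apply: measurable_funD.
transitivity (\int[pushforward lam (shift c : _ -> measurableTypeR R)]_x f x).
  by rewrite ge0_integral_pushforward.
by apply: eq_measure_integral => //= A mA AS; exact: lebesgue_measure_shift.
Qed.

Lemma ge0_integral_oppr (f : R -> \bar R) :
  measurable_fun setT f -> (forall x, 0 <= f x) ->
  \int[lam]_x f (- x)%R = \int[lam]_x f x.
Proof.
move=> mf f0.
transitivity (\int[pushforward lam (-%R : _ -> measurableTypeR R)]_x f x).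
  by rewrite ge0_integral_pushforward.
by apply: eq_measure_integral => //= A mA AS; exact: lebesgue_measureN.
Qed.

Lemma integral_shift (c : R) (f : R -> \bar R) :
  measurable_fun setT f -> \int[lam]_x f (x + c)%R = \int[lam]_x f x.
Proof.
move=> mf; rewrite integralE [RHS]integralE; congr (_ - _).
  rewrite -[RHS](ge0_integral_shift c (measurable_funepos mf)) => [|x]; last exact: funepos_ge0.
  by apply: eq_integral => x _; rewrite !(funeposE,funenegE).
rewrite -[RHS](ge0_integral_shift c (measurable_funeneg mf)) => [|x]; last exact: funeneg_ge0.
  by apply: eq_integral => x _; rewrite !(funeposE,funenegE).
Qed.

Lemma integral_expR_itv (g : R -> R) (a b : R) : (a <= b)%R ->
  (forall x : R, 0 < x -> {for x, continuous g})%R ->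
  \int[lam]_(t in `[expR a, expR b]) (g t)%:E =
    \int[lam]_(x in `[a, b]) (g (expR x) * expR x)%:E.
Proof.
move=> ab cg.
have dE : (@expR R)^`()%classic = expR by apply/funext => z; rewrite derive1E derive_val.
rewrite integration_by_substitution_increasing//.
- by apply: eq_integral => x _ /=; rewrite dE.
- by move=> x y _ _; rewrite ltr_expR.
- by rewrite dE => x _; exact: continuous_expR.
- rewrite dE; apply/cvg_ex; exists (expR a); apply: cvg_at_right_filter; exact: continuous_expR.
- rewrite dE; apply/cvg_ex; exists (expR b); apply: cvg_at_left_filter; exact: continuous_expR.
- split => //; [apply: cvg_at_right_filter|apply: cvg_at_left_filter]; exact: continuous_expR.
- apply: continuous_in_subspaceT => x /[!inE]/= /[!in_itv]/= /andP[xa _].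
  by apply: cg; apply: lt_le_trans xa; exact: expR_gt0.
Qed.

(** The substitution is made on the compact intervals from e^(-n) to e^n, which exhaust the
    half-line, and both sides pass to the limit by monotone convergence. *)
Lemma ge0_integral_expR (g : R -> R) :
  (forall x : R, 0 < x -> {for x, continuous g})%R -> (forall x : R, 0 < x -> 0 <= g x)%R ->
  \int[lam]_(t in `](0:R)%R, +oo[) (g t)%:E = \int[lam]_x (g (expR x) * expR x)%:E.
Proof.
move=> cg g0.
have nn (n : nat) : (- n%:R <= n%:R :> R)%R by rewrite ge0_cp// ler0n.
have ce (n : nat) := integral_expR_itv (nn n) cg.
have mg : measurable_fun `](0:R)%R, +oo[ g.
  apply: open_continuous_measurable_fun; first exact: interval_open.
  by move=> x /[!inE]/= /[!in_itv]/= /andP[x0 _]; exact: cg.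
have mge : measurable_fun setT (fun x => g (expR x) * expR x)%R.
  apply: continuous_measurable_fun => x; apply: cvgM; last exact: continuous_expR.
  by apply: continuous_comp; [exact: continuous_expR|apply: cg; exact: expR_gt0].
rewrite [in LHS](_ : `](0:R)%R, +oo[%classic = \bigcup_n `[expR (- n%:R), expR n%:R]%classic); last first.
  apply/seteqP; split => x /=; rewrite !in_itv/=.
    rewrite andbT => x0; exists (Num.bound `|ln x|%R) => //=; rewrite in_itv/=.
    have := archi_boundP (normr_ge0 (ln x)); rewrite ltr_norml => /andP[h1 h2].
    by rewrite -[x in (_ <= x <= _)%R]lnK ?posrE// !ler_expR !ltW.
  by move=> [n _] /= /[!in_itv]/= /andP[xa _]; rewrite andbT; apply: lt_le_trans xa; exact: expR_gt0.
rewrite [in RHS](_ : setT = \bigcup_n `[(- n%:R)%R, n%:R]%classic); last first.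
  apply/seteqP; split => x //= _; exists (Num.bound `|x|%R) => //=; rewrite in_itv/=.
  by have := archi_boundP (normr_ge0 x); rewrite ltr_norml => /andP[h1 h2]; rewrite !ltW.
have sub (n : nat) : `[expR (- n%:R), expR n%:R]%classic `<=` `](0:R)%R, +oo[%classic.
  move=> x /= /[!in_itv]/= /andP[xa _]; rewrite andbT; apply: lt_le_trans xa; exact: expR_gt0.
have cvg1 : \int[lam]_(t in `[expR (- n%:R), expR n%:R]) (g t)%:E @[n --> \oo] -->
    \int[lam]_(x in \bigcup_n `[expR (- n%:R), expR n%:R]%classic) (g x)%:E.
  apply: ge0_nondecreasing_set_cvg_integral => //.
  + apply/nondecreasing_seqP => n; apply/subsetPset => x /=; rewrite !in_itv/= => /andP[h1 h2].
    by rewrite (le_trans _ h1) ?(le_trans h2)// ler_expR ?lerN2 ler_nat.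
  + by move=> n; apply/measurable_EFinP; apply: measurable_funS mg.
  + move=> n x /sub; rewrite /= in_itv/= andbT => x0; rewrite lee_fin; exact: g0.
have cvg2 : \int[lam]_(t in `[expR (- n%:R), expR n%:R]) (g t)%:E @[n --> \oo] -->
    \int[lam]_(x in \bigcup_n `[(- n%:R)%R, n%:R]%classic) (g (expR x) * expR x)%:E.
  under eq_fun do rewrite ce.
  apply: ge0_nondecreasing_set_cvg_integral => //.
  + apply/nondecreasing_seqP => n; apply/subsetPset => x /=; rewrite !in_itv/= => /andP[h1 h2].
    by rewrite (le_trans _ h1) ?(le_trans h2)// ?lerN2 ler_nat.
  + by move=> n; apply/measurable_EFinP; apply: measurable_funTS mge.
  + by move=> n x _; rewrite lee_fin mulr_ge0 ?expR_ge0// g0 ?expR_gt0.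
by rewrite -(cvg_lim _ cvg1)// -(cvg_lim _ cvg2).
Qed.

(** The factor e^x is positive, so it commutes with taking positive and negative parts, and the two
    parts are transported separately. *)
Lemma integral_expR (g : R -> R) :
  (forall x : R, 0 < x -> {for x, continuous g})%R ->
  \int[lam]_(t in `](0:R)%R, +oo[) (g t)%:E = \int[lam]_x (g (expR x) * expR x)%:E.
Proof.
move=> cg; rewrite integralE [RHS]integralE.
congr (_ - _).
- transitivity (\int[lam]_(t in `](0:R)%R, +oo[) (Num.max (g t) 0)%:E); first by apply: eq_integral => x _; rewrite !(funeposE,funenegE) EFin_max.
  rewrite ge0_integral_expR.
  + apply: eq_integral => x _; rewrite !(funeposE,funenegE).
    have e0 := expR_ge0 x; rewrite maxr_pMl; [|exact: e0]; rewrite mul0r ?mulNr EFin_max; reflexivity.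
  + move=> x x0; apply: continuous_max; [exact: cg|exact: cvg_cst].
  + by move=> x _; rewrite le_max lexx orbT.
- transitivity (\int[lam]_(t in `](0:R)%R, +oo[) (Num.max (- g t) 0)%:E); first by apply: eq_integral => x _; rewrite !(funeposE,funenegE) EFin_max.
  rewrite ge0_integral_expR.
  + apply: eq_integral => x _; rewrite !(funeposE,funenegE).
    have e0 := expR_ge0 x; rewrite maxr_pMl; [|exact: e0]; rewrite mul0r mulNr EFin_max EFinN; reflexivity.
  + move=> x x0; apply: continuous_max; [apply: cvgN; exact: cg|exact: cvg_cst].
  + by move=> x _; rewrite le_max lexx orbT.
Qed.

End ChangeOfVariable.

(** * Derivatives of real functions *)

Section RealDerivative.
Context {R : realType}.
Implicit Types (f g : R -> R) (x a b : R).

Lemma is_derive_addf f g x a b : is_derive x 1 f a -> is_derive x 1 g b ->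
  is_derive x 1 (fun y => f y + g y) (a + b).
Proof. exact: is_deriveD. Qed.

Lemma is_derive_oppf f x a : is_derive x 1 f a ->
  is_derive x 1 (fun y => - f y) (- a).
Proof. exact: is_deriveN. Qed.

Lemma is_derive_mulf f g x a b : is_derive x 1 f a -> is_derive x 1 g b ->
  is_derive x 1 (fun y => f y * g y) (a * g x + f x * b).
Proof.
move=> df dg; apply: (is_derive_eq (is_deriveM df dg)).
by rewrite addrC /GRing.scale/= mulrC.
Qed.

Lemma is_derive_invf f x a : f x != 0 -> is_derive x 1 f a ->
  is_derive x 1 (fun y => (f y)^-1) (- a / f x ^+ 2).
Proof.
move=> f0 df; apply: (is_derive_eq (is_deriveV f0 df)).
by rewrite /GRing.scale/= mulNr mulrC -mulNr.
Qed.

Lemma is_derive_expf f x a : is_derive x 1 f a ->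
  is_derive x 1 (fun y => expR (f y)) (a * expR (f x)).
Proof. by move=> df; rewrite mulrC; apply: is_derive1_comp. Qed.

Lemma is_derive_cosf f x a : is_derive x 1 f a ->
  is_derive x 1 (fun y => cos (f y)) (- (a * sin (f x))).
Proof. by move=> df; rewrite -mulrN mulrC; apply: is_derive1_comp. Qed.

Lemma is_derive_sinf f x a : is_derive x 1 f a ->
  is_derive x 1 (fun y => sin (f y)) (a * cos (f x)).
Proof. by move=> df; rewrite mulrC; apply: is_derive1_comp. Qed.

Lemma is_derive_compf f g x a b : is_derive (f x) 1 g b -> is_derive x 1 f a ->
  is_derive x 1 (fun y => g (f y)) (a * b).
Proof. by move=> dg df; rewrite mulrC; apply: is_derive1_comp. Qed.

Lemma is_derive_lnf f x a : 0 < f x -> is_derive x 1 f a ->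
  is_derive x 1 (fun y => ln (f y)) (a / f x).
Proof. by move=> f0 df; apply: is_derive_compf => //; exact: is_derive1_ln. Qed.

(* A copy of [is_derive] hidden from instance resolution. *)
Definition hasd f x a : Prop := is_derive x 1 f a.

Lemma hasd_eq f x a b : hasd f x a -> a = b -> is_derive x 1 f b.
Proof. by move=> fa <-. Qed.

Lemma hasd_cst (c : R) x : hasd (fun=> c) x 0.
Proof. exact: is_derive_cst. Qed.

Lemma hasd_id x : hasd (fun y => y) x 1.
Proof. exact: is_derive_id. Qed.

Lemma hasd_add f g x a b : hasd f x a -> hasd g x b -> hasd (fun y => f y + g y) x (a + b).
Proof. exact: is_derive_addf. Qed.

Lemma hasd_opp f x a : hasd f x a -> hasd (fun y => - f y) x (- a).
Proof. exact: is_derive_oppf. Qed.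

Lemma hasd_mul f g x a b : hasd f x a -> hasd g x b ->
  hasd (fun y => f y * g y) x (a * g x + f x * b).
Proof. exact: is_derive_mulf. Qed.

Lemma hasd_inv f x a : f x != 0 -> hasd f x a -> hasd (fun y => (f y)^-1) x (- a / f x ^+ 2).
Proof. exact: is_derive_invf. Qed.

Lemma hasd_exp f x a : hasd f x a -> hasd (fun y => expR (f y)) x (a * expR (f x)).
Proof. exact: is_derive_expf. Qed.

Lemma hasd_cos f x a : hasd f x a -> hasd (fun y => cos (f y)) x (- (a * sin (f x))).
Proof. exact: is_derive_cosf. Qed.

Lemma hasd_sin f x a : hasd f x a -> hasd (fun y => sin (f y)) x (a * cos (f x)).
Proof. exact: is_derive_sinf. Qed.

Lemma hasd_ln f x a : 0 < f x -> hasd f x a -> hasd (fun y => ln (f y)) x (a / f x).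
Proof. exact: is_derive_lnf. Qed.

Lemma hasd_sqr f x a : hasd f x a -> hasd (fun y => f y ^+ 2) x (2 * a * f x).
Proof.
move=> df; have := hasd_mul df df; congr (is_derive _ _ _ _); ring.
Qed.

Lemma hasd_continuous f x a : hasd f x a -> {for x, continuous f}.
Proof. by move=> [df _]; apply/differentiable_continuous/derivable1_diffP. Qed.

Lemma is_derive_continuous f x a : is_derive x 1 f a -> {for x, continuous f}.
Proof. by move=> [df _]; apply/differentiable_continuous/derivable1_diffP. Qed.

Lemma is_derive_derive1 f x a : is_derive x 1 f a -> f^`()%classic x = a.
Proof. by move=> df; rewrite derive1E derive_val. Qed.

Lemma is_derive_derivable f x a : is_derive x 1 f a -> derivable f x 1.
Proof. by case. Qed.

Lemma le_is_derive f (df : R -> R) a b : a <= b ->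
  (forall x, a <= x <= b -> is_derive x 1 f (df x)) ->
  (forall x, a <= x <= b -> 0 <= df x) -> f a <= f b.
Proof.
move=> ab fdf df0.
have [|x xab|c cab e] := @MVT_segment R f df a b ab.
- by move=> x /[!in_itv]/= /andP[/ltW h1 /ltW h2]; apply: fdf; rewrite h1 h2.
- apply: derivable_within_continuous => y /[!in_itv]/= yab.
  exact: is_derive_derivable (fdf _ yab).
- by rewrite -subr_ge0 e mulr_ge0// ?subr_ge0// df0.
Qed.

End RealDerivative.

(** The rules follow the syntax of the function and build its derivative in an existential variable;
    [hasd_eq] then leaves an algebraic identity with the announced derivative. *)
Ltac hasd_step := lazymatch goal with
  | |- is_derive ?x _ ?f ?a => change (hasd f x a)
  | |- hasd (fun _ => ?c) _ _ => eapply hasd_cst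
  | |- hasd (fun x => x) _ _ => eapply hasd_id
  | |- hasd (fun x => @?f x + @?g x) _ _ => eapply (@hasd_add _ f g)
  | |- hasd (fun x => - @?f x) _ _ => eapply (@hasd_opp _ f)
  | |- hasd (fun x => @?f x * @?g x) _ _ => eapply (@hasd_mul _ f g)
  | |- hasd (fun x => (@?f x) ^+ 2) _ _ => eapply (@hasd_sqr _ f)
  | |- hasd (fun x => (@?f x)^-1) _ _ => eapply (@hasd_inv _ f)
  | |- hasd (fun x => expR (@?f x)) _ _ => eapply (@hasd_exp _ f)
  | |- hasd (fun x => cos (@?f x)) _ _ => eapply (@hasd_cos _ f)
  | |- hasd (fun x => sin (@?f x)) _ _ => eapply (@hasd_sin _ f)
  | |- hasd (fun x => ln (@?f x)) _ _ => eapply (@hasd_ln _ f)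
  end.

Ltac deriv := repeat hasd_step.

(** * Elementary inequalities *)

Section Elementary.
Context {R : realType}.
Implicit Types x y : R.

Lemma sin_le x : 0 <= x -> sin x <= x.
Proof.
move=> x0.
have := @le_is_derive R (fun y => y - sin y) (fun y => 1 - cos y) 0 x x0.
rewrite sin0 !subr0 subr_ge0; by apply=> y _; rewrite subr_ge0 cos_le1.
Qed.

Lemma norm_sin_le x : `|sin x| <= `|x|.
Proof.
wlog x0 : x / 0 <= x.
  move=> h; have [/h//|x0] := leP 0 x.
  by have := h (- x); rewrite sinN !normrN oppr_ge0; apply; exact: ltW.
rewrite (ger0_norm x0) ler_norml sin_le// andbT.
have [x2|x2] := leP x 2; last first.
  by apply: le_trans (sin_geN1 _); rewrite lerN2; lra.
rewrite (@le_trans _ _ 0) ?oppr_le0//; apply: sin_ge0_pi.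
by rewrite x0 (le_trans x2 (@pi_ge2 R)).
Qed.

Lemma cos_ge x : 1 - x ^+ 2 / 2 <= cos x.
Proof.
have -> : cos x = 1 - 2 * sin (x / 2) ^+ 2.
  have {1}-> : x = (x / 2) *+ 2 by rewrite mulr2n; lra.
  by rewrite cos_mulr2n cos2sin2 mulr2n; ring.
have := norm_sin_le (x / 2).
rewrite -[_ <= _]ler_sqr ?nnegrE// !real_normK ?num_real//.
by rewrite !expr2; lra.
Qed.

Lemma coshB2 x : expR x + expR (- x) - 2 = (expR (x / 2) - expR (- (x / 2))) ^+ 2.
Proof.
have h : expR (x / 2) * expR (- (x / 2)) = 1 by rewrite -expRD subrr expR0.
have e1 : expR x = expR (x / 2) ^+ 2 by rewrite expr2 -expRD; congr expR; lra.
have e2 : expR (- x) = expR (- (x / 2)) ^+ 2 by rewrite expr2 -expRD; congr expR; lra.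
by rewrite sqrrB h e1 e2 mulr2n; ring.
Qed.

Lemma sinh_ge x : 0 <= x -> 2 * x <= expR x - expR (- x).
Proof.
move=> x0.
have := @le_is_derive R (fun y => expR y - expR (- y) - 2 * y)
  (fun y => expR y + expR (- y) - 2) 0 x x0.
rewrite oppr0 mulr0 subrr !subr0 subr_ge0; apply=> y _.
  by eapply hasd_eq; [deriv|rewrite /=; ring].
rewrite coshB2; exact: sqr_ge0.
Qed.

(** By [coshB2] the right-hand side is a square, whose root is at least x for x >= 0 by
    [sinh_ge]. *)
Lemma sqr_le_cosh x : x ^+ 2 <= expR x + expR (- x) - 2.
Proof.
wlog x0 : x / 0 <= x.
  move=> h; have [/h//|x0] := leP 0 x.
  by have := h (- x); rewrite opprK sqrrN [expR (- x) + _]addrC; apply; rewrite oppr_ge0 ltW.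
rewrite coshB2.
have x20 : 0 <= x / 2 by rewrite divr_ge0.
have h := sinh_ge x20.
have -> : x ^+ 2 = (2 * (x / 2)) ^+ 2 by congr (_ ^+ 2); lra.
by rewrite ler_sqr ?nnegrE//; lra.
Qed.

(* A positive exponent k is traded for decay at +oo or growth at -oo. *)
Lemma linear_le_expR (k x : R) : 0 <= k -> k * x - expR x <= k ^+ 2.
Proof.
move=> k0; have [x0|x0] := leP x 0.
  have := expR_ge0 x; have : k * x <= 0 by rewrite mulr_ge0_le0.
  by have := sqr_ge0 k; lra.
have := expR_ge1Dx (x / 2) => h.
have : (x / 2) ^+ 2 <= expR x.
  rewrite [in leRHS](_ : x = x / 2 + x / 2); last lra.
  rewrite expRD -expr2 ler_sqr ?nnegrE ?expR_ge0//; lra.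
have := sqr_ge0 (k - x / 2); rewrite sqrrB -mulr_natl !expr2; nra.
Qed.

End Elementary.

(** * Integrals of derivatives over the line *)

Section LineIntegrals.
Context {R : realType}.
Local Notation lam := (@lebesgue_measure R).

Lemma integral_itv_derive (F f : R -> R) (a b : R) : a <= b ->
  (forall x : R, is_derive x 1 F (f x)) -> continuous f ->
  (\int[lam]_(x in `[a, b]) (f x)%:E = (F b - F a)%:E)%E.
Proof.
rewrite le_eqVlt => /predU1P[<- _ _|ab dF cf].
  by rewrite set_itv1 integral_set1 subrr.
have cF x : {for x, continuous F} := is_derive_continuous (dF x).
rewrite (@continuous_FTC2 _ f F)//.
- exact: continuous_subspaceT.
- split; [by move=> x _; exact: is_derive_derivable (dF x)| |].
  + apply: cvg_at_right_filter; exact: cF.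
  + apply: cvg_at_left_filter; exact: cF.
- by move=> x _; exact: is_derive_derive1.
Qed.

Lemma bigcup_itv_natT : \bigcup_n `[(- n%:R)%R, n%:R]%classic = [set: R].
Proof.
apply/seteqP; split => x //= _; exists (Num.bound `|x|%R) => //=; rewrite in_itv/=.
by have := archi_boundP (normr_ge0 x); rewrite ltr_norml => /andP[h1 h2]; rewrite !ltW.
Qed.

Lemma cvg_itv_derive (F f : R -> R) (l l' : R) :
  (forall x : R, is_derive x 1 F (f x)) -> continuous f ->
  F x @[x --> +oo] --> l -> F x @[x --> -oo] --> l' ->
  (\int[lam]_(x in `[(- n%:R)%R, n%:R]) (f x)%:E @[n --> \oo] --> (l - l')%:E)%E.
Proof.
move=> dF cf Fl Fl'.
under eq_fun do rewrite (integral_itv_derive _ dF cf) ?ge0_cp//.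
apply: cvg_EFin; first by near=> n.
have n1 : (n%:R : R) @[n --> \oo] --> +oo by exact: cvgr_idn.
have n2 : (- n%:R : R) @[n --> \oo] --> -oo.
  by apply/cvgNry; suff -> : (- (fun n : nat => - n%:R) : nat -> R) = (fun n => n%:R) by []; apply/funext => n; exact: opprK.
by apply: cvgB; [exact: cvg_comp n1 Fl|exact: cvg_comp n2 Fl'].
Unshelve. all: by end_near. Qed.

Lemma ge0_integral_derive (F f : R -> R) (l l' : R) :
  (forall x : R, is_derive x 1 F (f x)) -> continuous f -> (forall x, 0 <= f x) ->
  F x @[x --> +oo] --> l -> F x @[x --> -oo] --> l' ->
  (\int[lam]_x (f x)%:E = (l - l')%:E)%E.
Proof.
move=> dF cf f0 Fl Fl'.
rewrite -(cvg_lim _ (cvg_itv_derive dF cf Fl Fl'))//.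
apply/esym/cvg_lim => //; rewrite -bigcup_itv_natT.
apply: ge0_nondecreasing_set_cvg_integral => //.
- apply/nondecreasing_seqP => n; apply/subsetPset => x /=; rewrite !in_itv/= => /andP[h1 h2].
  by rewrite (le_trans _ h1) ?(le_trans h2)// ?lerN2 ler_nat.
- move=> n; apply/measurable_EFinP; apply: measurable_funTS; exact: continuous_measurable_fun.
- by move=> n x _; rewrite lee_fin.
Qed.

(** Dominated convergence for the truncations to [- n, n], with |f| as majorant. *)
Lemma integral_derive (F f : R -> R) (l l' : R) :
  (forall x : R, is_derive x 1 F (f x)) -> continuous f ->
  lam.-integrable setT (EFin \o f) ->
  F x @[x --> +oo] --> l -> F x @[x --> -oo] --> l' ->
  (\int[lam]_x (f x)%:E = (l - l')%:E)%E.
Proof.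
move=> dF cf If Fl Fl'.
rewrite -(cvg_lim _ (cvg_itv_derive dF cf Fl Fl'))//.
apply/esym/cvg_lim => //.
under eq_fun do rewrite integral_mkcond.
have mf : measurable_fun setT (EFin \o f).
  by apply/measurable_EFinP; exact: continuous_measurable_fun.
have [|||||_ _] := @dominated_convergence _ _ _ lam setT measurableT
  (fun n => (EFin \o f) \_ `[(- n%:R)%R, n%:R]) (EFin \o f) (abse \o (EFin \o f)).
- by move=> n; apply/(measurable_restrictT _ _).1 => //; exact: measurable_funTS.
- by [].
- apply: aeW => x _; apply: cvg_near_cst.
  near=> n; rewrite patchE mem_set// /= in_itv/= -ler_norml.
  by near: n; exact: nbhs_infty_ger.
- exact: integrable_abse.
- apply: aeW => x n _; rewrite patchE; case: ifP => _ /=; first exact: lexx.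
  by rewrite normr0 lee_fin.
- exact.
Unshelve. all: by end_near. Qed.

End LineIntegrals.

Section Integrability.
Context d (T : measurableType d) (R : realType) (mu : {measure set T -> \bar R}).
Implicit Types f g : T -> R.

Lemma integrable_le_norm f g : measurable_fun setT f ->
  mu.-integrable setT (EFin \o g) -> (forall x, `|f x| <= g x) ->
  mu.-integrable setT (EFin \o f).
Proof.
move=> mf Ig fg; apply: (le_integrable _ _ _ Ig) => //.
  exact/measurable_EFinP.
move=> x _ /=; rewrite lee_fin (le_trans (fg x))//; exact: ler_norm.
Qed.

Lemma integrable_ext f g : f =1 g -> mu.-integrable setT (EFin \o f) ->
  mu.-integrable setT (EFin \o g).
Proof. by move=> /funext ->. Qed.

Lemma integrable_mulC (k : R) f : mu.-integrable setT (EFin \o f) ->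
  mu.-integrable setT (EFin \o (fun x => k * f x)).
Proof. by move=> If; exact: (integrableZl measurableT k If). Qed.

Lemma integrable_add f g : mu.-integrable setT (EFin \o f) ->
  mu.-integrable setT (EFin \o g) ->
  mu.-integrable setT (EFin \o (fun x => f x + g x)).
Proof. by move=> If Ig; exact: (integrableD measurableT If Ig). Qed.

Lemma integrable_opp f : mu.-integrable setT (EFin \o f) ->
  mu.-integrable setT (EFin \o (fun x => - f x)).
Proof. by move=> If; exact: (integrableN If). Qed.

Lemma ge0_integrable f : measurable_fun setT f -> (forall x, 0 <= f x) ->
  (\int[mu]_x (f x)%:E < +oo)%E -> mu.-integrable setT (EFin \o f).
Proof.
move=> mf f0 fy; apply/integrableP; split; first exact/measurable_EFinP.
by under eq_integral do rewrite /= ger0_norm//.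
Qed.

Lemma EFin_Rintegral f : mu.-integrable setT (EFin \o f) ->
  ((\int[mu]_x f x)%R%:E = \int[mu]_x (f x)%:E)%E.
Proof. by move=> If; rewrite /Rintegral fineK//; exact: integrable_fin_num. Qed.

(** A zero integral would make the set where f is nonzero negligible, but that set is the whole
    space. *)
Lemma Rintegral_gt0 f : (0 < mu setT)%E -> mu.-integrable setT (EFin \o f) ->
  (forall x, 0 < f x) -> 0 < \int[mu]_x f x.
Proof.
move=> muT If f0; rewrite lt_neqAle Rintegral_ge0 ?andbT; last by move=> x _; exact: ltW.
apply/eqP => e0.
have mf : measurable_fun setT (EFin \o f) by exact: measurable_int If.
have : (\int[mu]_x `|(f x)%:E| = 0)%E.
  rewrite -[RHS]/((0:R)%:E) e0 (EFin_Rintegral If).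
  by apply: eq_integral => x _ /=; rewrite gtr0_norm.
move/(ae_eq_integral_abs mu measurableT mf).1 => [N [mN N0 sN]].
have NT : N = setT.
  apply/seteqP; split => // x _; apply: sN => /= /(_ Logic.I) [] fx0.
  by have := f0 x; rewrite fx0 ltxx.
by move: muT; rewrite -NT N0 ltxx.
Qed.

End Integrability.

Section ExponentialDecay.
Context {R : realType}.
Local Notation lam := (@lebesgue_measure R).
Implicit Types (c : R) (f : R -> R).

Lemma lebesgue_measureT_gt0 : (0 < lam setT)%E.
Proof.
apply: (@lt_le_trans _ _ (lam `[(0:R), 1]%classic)).
  by rewrite lebesgue_measure_itv/= lte_fin ltr01 oppr0 adde0 lte_fin.
by apply: le_measure => //=; rewrite inE.
Qed.

Lemma cvg_expNabs_pinfty c : 0 < c -> expR (- (c * `|x|)) @[x --> +oo] --> (0 : R).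
Proof.
move=> c0; have h : c * `|x| @[x --> (+oo : set_system R)] --> +oo.
  apply/cvgryPge => A; near=> x.
  rewrite mulrC -ler_pdivrMr//; apply: le_trans (ler_norm x).
  by near: x; apply: nbhs_pinfty_ge; exact: num_real.
exact: (cvg_comp _ _ h (@cvgr_expR R)).
Unshelve. all: by end_near. Qed.

Lemma cvg_expNabs_ninfty c : 0 < c -> expR (- (c * `|x|)) @[x --> -oo] --> (0 : R).
Proof.
move=> c0; have h : c * `|x| @[x --> (-oo : set_system R)] --> +oo.
  apply/cvgryPge => A; near=> x.
  rewrite mulrC -ler_pdivrMr//; rewrite -normrN; apply: le_trans (ler_norm (- x)).
  rewrite lerNr; by near: x; apply: nbhs_ninfty_le; exact: num_real.
exact: (cvg_comp _ _ h (@cvgr_expR R)).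
Unshelve. all: by end_near. Qed.

Lemma cvg0_expNabs f c C : 0 < c -> (forall x, `|f x| <= C * expR (- (c * `|x|))) ->
  f x @[x --> +oo] --> (0 : R) /\ f x @[x --> -oo] --> (0 : R).
Proof.
move=> c0 fC; split.
- apply: (@squeeze_cvgr _ _ _ _ (fun x => - (C * expR (- (c * `|x|)))) (fun x => C * expR (- (c * `|x|)))).
  + by apply: nearW => x; rewrite -ler_norml.
  + by rewrite -oppr0 -(mulr0 C); apply: cvgN; apply: cvgM; [exact: cvg_cst|]; exact: cvg_expNabs_pinfty.
  + by rewrite -(mulr0 C); apply: cvgM; [exact: cvg_cst|]; exact: cvg_expNabs_pinfty.
- apply: (@squeeze_cvgr _ _ _ _ (fun x => - (C * expR (- (c * `|x|)))) (fun x => C * expR (- (c * `|x|)))).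
  + by apply: nearW => x; rewrite -ler_norml.
  + by rewrite -oppr0 -(mulr0 C); apply: cvgN; apply: cvgM; [exact: cvg_cst|]; exact: cvg_expNabs_ninfty.
  + by rewrite -(mulr0 C); apply: cvgM; [exact: cvg_cst|]; exact: cvg_expNabs_ninfty.
Qed.

Lemma continuous_expNabs c : continuous (fun x : R => expR (- (c * `|x|))).
Proof.
move=> x; apply: continuous_comp; last exact: continuous_expR.
by apply: cvgN; apply: cvgM; [exact: cvg_cst|exact: norm_continuous].
Qed.

(** The majorant is 4 / c times the derivative [f] of the logistic function [F], whose total mass is
    read off from its limits. With q = e^(- c x), the 4 bounds (1 + q) ^ 2 for x >= 0, where q <= 1,
    and (1 + q) ^ 2 / q ^ 2 for x < 0, where q >= 1. *)
Lemma integrable_expNabs c : 0 < c ->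
  lam.-integrable setT (EFin \o (fun x => expR (- (c * `|x|)))).
Proof.
move=> c0.
pose q x := expR (- (c * x)).
pose F x := (1 + q x)^-1; pose f x := c * q x / (1 + q x) ^+ 2.
have q0 x : 0 < q x by exact: expR_gt0.
have q1 x : 0 < 1 + q x by rewrite addr_gt0.
have dq (x : R) : is_derive x 1 (fun y => 1 + q y) (- c * q x).
  by eapply hasd_eq; [rewrite /q; deriv|rewrite /q/=; ring].
have dF (x : R) : is_derive x 1 F (f x).
  have h : 1 + q x != 0 by rewrite gt_eqF.
  refine (is_derive_eq (@is_derive_invf _ (fun y => 1 + q y) _ _ h (dq x)) _).
  by rewrite /f !mulNr opprK.
have cq : continuous q by move=> x; eapply (@hasd_continuous _ q); rewrite /q; deriv.
have cf : continuous f.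
  move=> x; apply: cvgM; first by apply: cvgM; [exact: cvg_cst|exact: cq].
  apply: cvgV; first by rewrite sqrf_eq0 gt_eqF.
  by apply: cvgM; (apply: cvgD; [exact: cvg_cst|exact: cq]).
have f0 x : 0 <= f x by rewrite /f divr_ge0 ?mulr_ge0 ?sqr_ge0// ltW.
have qy : q x @[x --> +oo] --> (0 : R).
  have := cvg_expNabs_pinfty c0; apply: cvg_trans; apply: near_eq_cvg.
  by near=> x; rewrite /q ger0_norm.
have Fy : F x @[x --> +oo] --> (1 : R).
  have -> : (1 : R) = (1 + 0)^-1 by rewrite addr0 invr1.
  apply: cvgV; first by rewrite addr0 oner_eq0.
  by apply: cvgD; [exact: cvg_cst|].
have Fny : F x @[x --> -oo] --> (0 : R).
  apply: (@squeeze_cvgr _ _ _ _ (cst 0) (fun x => expR (- (c * `|x|)))).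
  + near=> x; rewrite /F invr_ge0 ltW//= ler0_norm// mulrN opprK.
    rewrite -[leRHS]invrK lef_pV2 ?posrE ?invr_gt0 ?expR_gt0// -expRN.
    by rewrite -/(q x); lra.
  + exact: cvg_cst.
  + exact: cvg_expNabs_ninfty.
have If : lam.-integrable setT (EFin \o f).
  apply: ge0_integrable => //; first exact: continuous_measurable_fun.
  by rewrite (ge0_integral_derive dF cf f0 Fy Fny) ltry.
apply: (@integrable_le_norm _ (measurableTypeR R) R lam _ (fun x => 4 / c * f x)).
- exact: continuous_measurable_fun (@continuous_expNabs c).
- exact: integrable_mulC.
- move=> x; rewrite ger0_norm ?expR_ge0// /f.
  have -> : 4 / c * (c * q x / (1 + q x) ^+ 2) = 4 * q x / (1 + q x) ^+ 2.
    by field; rewrite !gt_eqF.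
  rewrite ler_pdivlMr ?exprn_gt0//.
  have [x0|x0] := leP 0 x.
    rewrite ger0_norm// -/(q x).
    have : q x <= 1 by rewrite /q -expR0 ler_expR oppr_le0 mulr_ge0// ltW.
    move=> h; have := q0 x; set e := q x in h *; move=> e0; rewrite expr2.
    have h2 : (1 + e) * (1 + e) <= 4 by nra.
    by rewrite mulrC ler_wpM2r// ltW.
  rewrite ltr0_norm// mulrN opprK.
  have h : expR (c * x) * q x = 1 by rewrite -expRD subrr expR0.
  have : 1 <= q x by rewrite /q -expR0 ler_expR oppr_ge0 mulr_ge0_le0// ltW.
  move=> h1; have := expR_gt0 (c * x); set e := expR (c * x) in h *; move=> e0.
  have -> : 4 * q x = e * (4 * q x ^+ 2) by rewrite -[LHS]mul1r -h; ring.
  have := q0 x; set k := q x in h1 *; move=> k0; rewrite !expr2.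
  have h2 : (1 + k) * (1 + k) <= 4 * (k * k) by nra.
  by rewrite ler_wpM2l// ltW.
Unshelve. all: by end_near. Qed.

Lemma integrable_le_expNabs f c C : 0 < c -> measurable_fun setT f ->
  (forall x, `|f x| <= C * expR (- (c * `|x|))) ->
  lam.-integrable setT (EFin \o f).
Proof.
move=> c0 mf fC; apply: (@integrable_le_norm _ (measurableTypeR R) R lam _ _ mf _ fC).
by apply: integrable_mulC; exact: integrable_expNabs.
Qed.

End ExponentialDecay.

(** * The Gamma function on vertical lines *)

Section Measurability.
Context d (T : measurableType d) (R : realType).
Implicit Types f g : T -> R.

Lemma measurable_fun_expf f : measurable_fun setT f -> measurable_fun setT (fun x => expR (f x)).
Proof. exact: (measurableT_comp (@measurable_expR R)). Qed.

Lemma measurable_fun_cosf f : measurable_fun setT f -> measurable_fun setT (fun x => cos (f x)).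
Proof. exact: (measurableT_comp (continuous_measurable_fun (@continuous_cos R))). Qed.

Lemma measurable_fun_sinf f : measurable_fun setT f -> measurable_fun setT (fun x => sin (f x)).
Proof. exact: (measurableT_comp (continuous_measurable_fun (@continuous_sin R))). Qed.

Lemma measurable_fun_oppf f : measurable_fun setT f -> measurable_fun setT (fun x => - f x).
Proof. exact: measurable_funN. Qed.

Lemma measurable_fun_addf f g : measurable_fun setT f -> measurable_fun setT g ->
  measurable_fun setT (fun x => f x + g x).
Proof. exact: measurable_funD. Qed.

Lemma measurable_fun_mulf f g : measurable_fun setT f -> measurable_fun setT g ->
  measurable_fun setT (fun x => f x * g x).
Proof. exact: measurable_funM. Qed.

Lemma measurable_fun_cstf (c : R) : measurable_fun setT (fun _ : T => c).
Proof. exact: measurable_cst. Qed.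

End Measurability.

Ltac meas := repeat first
  [ assumption | apply: measurable_fun_cstf | exact: measurable_id
  | exact: measurable_fst | exact: measurable_snd
  | apply: measurable_fun_addf | apply: measurable_fun_mulf | apply: measurable_fun_oppf
  | apply: measurable_fun_expf | apply: measurable_fun_cosf | apply: measurable_fun_sinf ].

Section GammaKernel.
Context {R : realType}.
Local Notation lam := (@lebesgue_measure R).
Implicit Types (b m x : R).

(* Euler's integrand t ^ (b - 1) * exp (- t) in the variable x = ln t. *)
Definition gker b x : R := expR (b * x - expR x).

Lemma gker_gt0 b x : 0 < gker b x. Proof. exact: expR_gt0. Qed.

Lemma gker_ge0 b x : 0 <= gker b x. Proof. exact: expR_ge0. Qed.

Lemma gkerS b x : gker (b + 1) x = expR x * gker b x.
Proof. by rewrite /gker -expRD; congr expR; ring. Qed.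

Lemma is_derive_gker b x : is_derive x 1 (gker b) ((b - expR x) * gker b x).
Proof. by eapply hasd_eq; [rewrite /gker; deriv|rewrite /gker/=; ring]. Qed.

Lemma continuous_gker b : continuous (gker b).
Proof. by move=> x; exact: is_derive_continuous (is_derive_gker b x). Qed.

Lemma measurable_gker b : measurable_fun setT (gker b).
Proof. exact: continuous_measurable_fun (@continuous_gker b). Qed.

(** To the right of 0, [linear_le_expR] with slope 2 b leaves the constant (2 b) ^ 2 and a surplus b
    x of decay; to the left b x is itself the decay and e^x is dropped. *)
Lemma gker_le b x : 0 < b -> gker b x <= expR (4 * b ^+ 2) * expR (- (b * `|x|)).
Proof.
move=> b0; rewrite /gker -expRD ler_expR.
have [x0|x0] := leP 0 x.
  rewrite ger0_norm//; have : 0 <= 2 * b by lra.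
  by move/(linear_le_expR x); rewrite !expr2; nra.
rewrite ltr0_norm// mulrN opprK; have := expR_ge0 x; have := sqr_ge0 b; lra.
Qed.

Lemma integrable_gkerM b (h : R -> R) C : 0 < b -> measurable_fun setT h ->
  (forall x, `|h x| <= C) ->
  lam.-integrable setT (EFin \o (fun x => gker b x * h x)).
Proof.
move=> b0 mh hC.
apply: (@integrable_le_expNabs R _ b (expR (4 * b ^+ 2) * C)) => //.
  by apply: measurable_fun_mulf => //; exact: measurable_gker.
move=> x; rewrite normrM (ger0_norm (gker_ge0 _ _)) mulrAC.
by apply: ler_pM => //; [exact: gker_ge0|exact: gker_le].
Qed.

Lemma integrable_gker b : 0 < b -> lam.-integrable setT (EFin \o gker b).
Proof.
move=> b0; apply: (@integrable_ext _ _ _ lam (fun x => gker b x * 1)).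
  by move=> x; rewrite mulr1.
by apply: (@integrable_gkerM b (fun=> 1) 1 b0) => // x; rewrite normr1.
Qed.

(** [gam b] is Gamma at b; [gamC b m] and [gamS b m] are the real and imaginary parts of Gamma at b
    + i m (see [GammaE]). *)
Definition gam b := \int[lam]_x gker b x.
Definition gamC b m := \int[lam]_x (gker b x * cos (m * x)).
Definition gamS b m := \int[lam]_x (gker b x * sin (m * x)).

Lemma gam_gt0 b : 0 < b -> 0 < gam b.
Proof.
move=> b0; apply: Rintegral_gt0; first exact: lebesgue_measureT_gt0.
- exact: integrable_gker.
- by move=> x; exact: gker_gt0.
Qed.

Lemma integrable_gkerC b m (k : R) : 0 < b ->
  lam.-integrable setT (EFin \o (fun x => gker b x * cos (m * x + k))).
Proof. by move=> b0; apply: (@integrable_gkerM _ _ 1) => //; [meas|move=> x; exact: cos_max]. Qed.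

Lemma integrable_gkerS b m (k : R) : 0 < b ->
  lam.-integrable setT (EFin \o (fun x => gker b x * sin (m * x + k))).
Proof. by move=> b0; apply: (@integrable_gkerM _ _ 1) => //; [meas|move=> x; exact: sin_max]. Qed.

Lemma gker_phase b m k : 0 < b ->
  \int[lam]_x (gker b x * cos (m * x + k)) = cos k * gamC b m - sin k * gamS b m.
Proof.
move=> b0; have hc := @integrable_gkerC b m 0 b0; have hs := @integrable_gkerS b m 0 b0.
have ic : lam.-integrable setT (EFin \o (fun x => gker b x * cos (m * x))).
  by apply: integrable_ext hc => x; rewrite addr0.
have iis : lam.-integrable setT (EFin \o (fun x => gker b x * sin (m * x))).
  by apply: integrable_ext hs => x; rewrite addr0.
rewrite /gamC /gamS -!RintegralZl//.
rewrite -RintegralB//; [|exact: integrable_mulC|exact: integrable_mulC].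
by apply: eq_Rintegral => x _ /=; rewrite cosD; ring.
Qed.

(** Integration by parts, with boundary values that vanish at both ends. The free phase k lets this
    one identity yield the real part (k = 0) and the imaginary part (k = - pi / 2) of Gamma (z + 1)
    = z Gamma (z). *)
Lemma gker_phase_derive b m k : 0 < b ->
  \int[lam]_x (gker (b + 1) x * cos (m * x + k)) =
  b * \int[lam]_x (gker b x * cos (m * x + k)) - m * \int[lam]_x (gker b x * sin (m * x + k)).
Proof.
move=> b0; have b1 : 0 < b + 1 by rewrite addr_gt0.
have h2 := @integrable_gkerC b m k b0; have h3 := @integrable_gkerS b m k b0.
have h1 := @integrable_gkerC (b + 1) m k b1.
pose F x := gker b x * cos (m * x + k).
pose f x := b * (gker b x * cos (m * x + k)) - m * (gker b x * sin (m * x + k))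
  - gker (b + 1) x * cos (m * x + k).
have dF (x : R) : is_derive x 1 F (f x).
  eapply hasd_eq.
    eapply hasd_mul; [exact: is_derive_gker|deriv].
  by rewrite /f gkerS /=; ring.
have i2 := integrable_mulC b h2; have i3 := integrable_mulC m h3.
have If : lam.-integrable setT (EFin \o f).
  by apply: integrable_add; [apply: integrable_add => //; exact: integrable_opp|exact: integrable_opp].
have [Fy Fny] : F x @[x --> +oo] --> (0 : R) /\ F x @[x --> -oo] --> (0 : R).
  apply: (@cvg0_expNabs _ _ b (expR (4 * b ^+ 2))) => // x.
  rewrite normrM (ger0_norm (gker_ge0 _ _)) -[leRHS]mulr1.
  by apply: ler_pM => //; [exact: gker_ge0|exact: gker_le|exact: cos_max].
have cf : continuous f.
  move=> x; apply: cvgB; last first.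
    by apply: cvgM; [exact: continuous_gker|eapply (@hasd_continuous _ (fun x => cos (m * x + k))); deriv].
  apply: cvgB; (apply: cvgM; [exact: cvg_cst|]); (apply: cvgM; [exact: continuous_gker|]).
    by eapply (@hasd_continuous _ (fun x => cos (m * x + k))); deriv.
  by eapply (@hasd_continuous _ (fun x => sin (m * x + k))); deriv.
have : \int[lam]_x f x = 0 by rewrite /Rintegral (integral_derive dF cf If Fy Fny) subrr.
rewrite /f RintegralB//; last by apply: integrable_add => //; exact: integrable_opp.
by rewrite RintegralB// !RintegralZl// => /eqP; rewrite subr_eq0 => /eqP ->.
Qed.

Lemma gamD1 b : 0 < b -> gam (b + 1) = b * gam b.
Proof.
move=> b0; have := gker_phase_derive 0 0 b0.
rewrite mul0r subr0 /gam => h.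
transitivity (\int[lam]_x (gker (b + 1) x * cos (0 * x + 0))).
  by apply: eq_Rintegral => x _; rewrite mul0r addr0 cos0 mulr1.
rewrite h; congr (_ * _).
by apply: eq_Rintegral => x _; rewrite mul0r addr0 cos0 mulr1.
Qed.

Lemma gamC_gamS b m : 0 < b ->
  gamC (b + 1) m = b * gamC b m - m * gamS b m /\
  gamS (b + 1) m = b * gamS b m + m * gamC b m.
Proof.
move=> b0; have b1 : 0 < b + 1 by rewrite addr_gt0.
have S k : \int[lam]_x (gker b x * sin (m * x + k)) = - \int[lam]_x (gker b x * cos (m * x + (k + pi / 2))).
  rewrite -mulN1r -RintegralZl//; last exact: integrable_gkerC.
  by apply: eq_Rintegral => x _ /=; rewrite addrA cosDpihalf; ring.
split.
  have := gker_phase_derive m 0 b0.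
  rewrite S add0r (gker_phase m 0 b1) (gker_phase m 0 b0) (gker_phase m (pi / 2) b0).
  rewrite cos0 sin0 cos_pihalf sin_pihalf.
  move: (gamC (b + 1) m) (gamS (b + 1) m) (gamC b m) (gamS b m) => A B C D h; lra.
have := gker_phase_derive m (- (pi / 2)) b0.
rewrite S addNr (gker_phase m 0 b0) (gker_phase m (- (pi / 2)) b1) (gker_phase m (- (pi / 2)) b0).
rewrite cos0 sin0 cosN sinN cos_pihalf sin_pihalf.
  move: (gamC (b + 1) m) (gamS (b + 1) m) (gamC b m) (gamS b m) => A B C D h; lra.
Qed.

Definition gamN b m := gamC b m ^+ 2 + gamS b m ^+ 2.

Lemma gamN_D1 b m : 0 < b -> gamN (b + 1) m = (b ^+ 2 + m ^+ 2) * gamN b m.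
Proof. by move=> b0; rewrite /gamN; have [-> ->] := gamC_gamS m b0; ring. Qed.

(* The phase is centred at ln b, where the density gker b concentrates; the
   variance of exp (x - ln b) is controlled by the functional equation. *)
Lemma gamN_large b m : 1 < b -> m ^+ 2 < 2 * (b - 1) -> gamN b m != 0.
Proof.
move=> b1 mb; have b0 : 0 < b by lra.
have b10 : 0 < b - 1 by lra.
have b20 : 0 < b + 1 by lra.
apply/negP => /eqP N0.
have [C0 S0] : gamC b m = 0 /\ gamS b m = 0.
  move/eqP: N0; rewrite /gamN paddr_eq0 ?sqr_ge0// !sqrf_eq0.
  by move=> /andP[/eqP -> /eqP ->].
pose q := ln b.
have eq : expR q = b by rewrite lnK.
have := @gker_phase b m (- (m * q)) b0.
rewrite C0 S0 !mulr0 subr0 => h0.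
have hc := @integrable_gkerC b m (- (m * q)) b0.
have Ib := integrable_gker b0; have Ib1 := integrable_gker b10; have Ib2 := integrable_gker b20.
have J : lam.-integrable setT (EFin \o (fun x => m ^+ 2 / 2 * (b^-1 * gker (b + 1) x + b * gker (b - 1) x + - 2 * gker b x))).
  by apply: integrable_mulC; do 2 (apply: integrable_add; last exact: integrable_mulC); exact: integrable_mulC.
(* The left-hand side is [gam b], since the centred cosine integral vanishes by [h0]. On the right 1
   - cos y <= y ^ 2 / 2 and (x - q) ^ 2 <= e^(x - q) + e^(q - x) - 2, whose integral against the
   density is exactly [gam (b - 1)]. As [gam b] is (b - 1) times [gam (b - 1)], this contradicts m ^
   2 < 2 (b - 1). *)
have : \int[lam]_x (gker b x - gker b x * cos (m * x + - (m * q))) <=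
   \int[lam]_x (m ^+ 2 / 2 * (b^-1 * gker (b + 1) x + b * gker (b - 1) x + - 2 * gker b x)).
  apply: le_Rintegral => //; first by apply: integrable_add => //; exact: integrable_opp.
  move=> x _; rewrite gkerS.
  have -> : gker (b - 1) x = expR (- x) * gker b x.
    by rewrite /gker -expRD; congr expR; ring.
  have -> : b^-1 * (expR x * gker b x) + b * (expR (- x) * gker b x) + - 2 * gker b x
    = (expR (x - q) + expR (- (x - q)) - 2) * gker b x.
    have -> : expR (x - q) = expR x * b^-1 by rewrite expRB eq.
    have -> : expR (- (x - q)) = b * expR (- x) by rewrite opprB expRD eq.
    by ring.
  have h1 := cos_ge (m * x + - (m * q)); have h2 := sqr_le_cosh (x - q).
  have g0 := gker_gt0 b x; have m0 := sqr_ge0 m.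
  have h3 : 1 - cos (m * x + - (m * q)) <= m ^+ 2 / 2 * (expR (x - q) + expR (- (x - q)) - 2).
    have : m ^+ 2 * (x - q) ^+ 2 <= m ^+ 2 * (expR (x - q) + expR (- (x - q)) - 2) by rewrite ler_wpM2l.
    have : (m * x + - (m * q)) ^+ 2 = m ^+ 2 * (x - q) ^+ 2 by ring.
    by lra.
  by rewrite mulrA -[X in X - _]mulr1 -mulrBr mulrC ler_wpM2r// ltW.
rewrite RintegralB// h0 subr0 RintegralZl//; last first.
  by do 2 (apply: integrable_add; last exact: integrable_mulC); exact: integrable_mulC.
rewrite RintegralD//; [|by apply: integrable_add; exact: integrable_mulC|exact: integrable_mulC].
rewrite RintegralD//; [|exact: integrable_mulC|exact: integrable_mulC].
rewrite !RintegralZl// -!/(gam _) gamD1// mulrA mulVf ?gt_eqF// mul1r.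
have gb : gam b = (b - 1) * gam (b - 1) by rewrite -(gamD1 b10) subrK.
have g1 := gam_gt0 b10.
have -> : gam b + b * gam (b - 1) + - 2 * gam b = gam (b - 1) by rewrite gb; ring.
rewrite gb => h.
have : m ^+ 2 / 2 * gam (b - 1) < (b - 1) * gam (b - 1) by rewrite (ltr_pM2r g1) ltr_pdivrMr// mulrC.
by rewrite ltNge h.
Qed.

(** The functional equation carries non-vanishing from b + k down to b, and [gamN_large] supplies it
    as soon as k exceeds 2 + m ^ 2. *)
Lemma gamN_gt0 b m : 0 < b -> 0 < gamN b m.
Proof.
move=> b0; rewrite lt_neqAle addr_ge0 ?sqr_ge0// andbT eq_sym.
have H (k : nat) : gamN (b + k%:R) m != 0 -> gamN b m != 0.
  elim: k => [|k IH]; first by rewrite addr0.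
  rewrite -addn1 natrD addrA gamN_D1 ?ltr_wpDr// mulf_eq0 negb_or => /andP[_].
  exact: IH.
pose k := (Num.bound (2 + m ^+ 2)).
have k0 : 2 + m ^+ 2 < k%:R by apply: archi_boundP; have := sqr_ge0 m; lra.
apply: (H k); apply: gamN_large; have := sqr_ge0 m; lra.
Qed.

End GammaKernel.

(** * Quadratic remainders of the exponential *)

Section QuadraticBound.
Context {R : realType}.

(** The remainder divided by h is at most |C| |h|. This form suits [tric], where a pointwise
    quadratic bound on the integrand integrates to one on the function. *)
Lemma is_derive_quadratic (f : R -> R) (x l C e : R) : 0 < e ->
  (forall h, `|h| < e -> `|f (x + h) - f x - h * l| <= C * h ^+ 2) ->
  is_derive x 1 f l.
Proof.
move=> e0 H.
have C0 : 0 <= `|C| := normr_ge0 C.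
have L : h^-1 *: (f (h *: (1 : R) + x) - f x) @[h --> (0 : R)^'] --> l.
  apply/cvgrPdist_le => /= eps eps0; near=> h.
  have h0 : h != 0 by near: h; exact: nbhs_dnbhs_neq.
  have he : `|h| < e.
    near: h; apply: dnbhs0_lt; exact: e0.
  have hC : (`|C| + 1) * `|h| <= eps.
    rewrite mulrC -ler_pdivlMr ?ltr_wpDl//; near: h; apply: dnbhs0_le.
    by rewrite divr_gt0// ltr_wpDl.
  rewrite /GRing.scale/= mulr1 [h + x]addrC.
  have -> : l - h^-1 * (f (x + h) - f x) = - (h^-1 * (f (x + h) - f x - h * l)).
    by field.
  rewrite normrN normrM normfV ler_pdivrMl ?normr_gt0//.
  apply: (le_trans (H _ he)); rewrite -(ger0_norm (sqr_ge0 h)) normrX expr2.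
  apply: (@le_trans _ _ (`|C| * (`|h| * `|h|))).
    by rewrite ler_wpM2r ?mulr_ge0// ler_norm.
  have := normr_ge0 h; nra.
split; first by apply/cvg_ex; exists l.
exact: cvg_lim L.
Unshelve. all: by end_near. Qed.

Lemma expR_lip (x y : R) : 0 <= x -> 0 <= y -> `|expR (- y) - expR (- x)| <= `|y - x|.
Proof.
wlog xy : x y / x <= y.
  move=> h x0 y0; have [xy|yx] := leP x y; first exact: h.
  by rewrite distrC [leRHS]distrC; apply: h => //; exact: ltW.
move=> x0 y0; rewrite distrC ger0_norm; last by rewrite subr_ge0 ler_expR lerN2.
rewrite ger0_norm ?subr_ge0//.
have -> : expR (- y) = expR (- x) * expR (x - y) by rewrite -expRD; congr expR; ring.
have h1 := expR_ge1Dx (x - y); have h2 := expR_gt0 (- x).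
have h3 : expR (- x) <= 1 by rewrite -expR0 ler_expR oppr_le0.
nra.
Qed.

Lemma expR_quadratic (x y : R) : 0 <= x -> 0 <= y ->
  `|expR (- y) - expR (- x) + (y - x) * expR (- x)| <= (y - x) ^+ 2.
Proof.
move=> x0 y0.
have h1 : 0 <= expR (- y) - expR (- x) + (y - x) * expR (- x).
  have -> : expR (- y) = expR (- x) * expR (x - y) by rewrite -expRD; congr expR; ring.
  have := expR_ge1Dx (x - y); have := expR_gt0 (- x); nra.
have h2 : expR (- y) - expR (- x) + (y - x) * expR (- x) <=
    (y - x) * (expR (- x) - expR (- y)).
  have -> : expR (- x) = expR (- y) * expR (y - x) by rewrite -expRD; congr expR; ring.
  have := expR_ge1Dx (y - x); have := expR_gt0 (- y); nra.
rewrite ger0_norm//; apply: (le_trans h2).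
rewrite -[leRHS](ger0_norm (sqr_ge0 _)); apply: (le_trans (ler_norm _)).
rewrite normrM normrX expr2 ler_wpM2l// distrC [leRHS]distrC -normrN opprB distrC.
by rewrite -normrN opprB; apply: expR_lip.
Qed.

End QuadraticBound.

(** * Integrals for the product measure *)

Section ProductMeasure.
Context {R : realType}.
Local Notation lam := (@lebesgue_measure R).
Local Notation lam2 := (lam \x lam)%E.
Implicit Types f g : R -> R.

Lemma integrable_prod f g : lam.-integrable setT (EFin \o f) ->
  lam.-integrable setT (EFin \o g) ->
  lam2.-integrable setT (EFin \o (fun p => f p.1 * g p.2)).
Proof.
move=> If Ig.
have mf : measurable_fun setT f by apply/measurable_EFinP; exact: measurable_int If.
have mg : measurable_fun setT g by apply/measurable_EFinP; exact: measurable_int Ig.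
have mfg : measurable_fun setT (fun p : measurableTypeR R * measurableTypeR R => f p.1 * g p.2).
  by apply: measurable_fun_mulf; apply: measurableT_comp.
apply/integrable12ltyP; first exact/measurable_EFinP.
under eq_integral => x _.
  under eq_integral => y _ do rewrite /= normrM EFinM.
  rewrite ge0_integralZl_EFin//; last by apply/measurable_EFinP; exact: measurableT_comp.
  over.
rewrite ge0_integralZr//; last 2 first.
- by apply/measurable_EFinP; exact: measurableT_comp.
- exact: integral_ge0.
by apply: lte_mul_pinfty; [exact: integral_ge0| |];
  [rewrite ge0_fin_numE ?integral_ge0//|]; [case/integrableP: If|case/integrableP: Ig].
Qed.

Lemma Rintegral_prod f g : lam.-integrable setT (EFin \o f) ->
  lam.-integrable setT (EFin \o g) ->
  \int[lam2]_p (f p.1 * g p.2) = (\int[lam]_x f x) * (\int[lam]_y g y).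
Proof.
move=> If Ig; apply: EFin_inj; rewrite (EFin_Rintegral (integrable_prod If Ig)).
have := @integral12_prod_meas1 _ _ _ _ _ lam lam _ (integrable_prod If Ig).
rewrite /fubini_F => <-.
under eq_integral => x _.
  under eq_integral => y _ do rewrite /= EFinM.
  rewrite integralZl// -(EFin_Rintegral Ig) -EFinM.
  over.
rewrite EFinM (EFin_Rintegral If) -integralZr//.
Qed.

Lemma Rintegral_prod2 (h : R * R -> R) : lam2.-integrable setT (EFin \o h) ->
  ((\int[lam2]_p h p)%R%:E = \int[lam]_y \int[lam]_x (h (x, y))%:E)%E.
Proof.
move=> Ih; rewrite (EFin_Rintegral Ih).
by have := @integral21_prod_meas1 _ _ _ _ _ lam lam _ Ih; rewrite /fubini_G => <-.
Qed.

Lemma Rintegral_prod1 (h : R * R -> R) : lam2.-integrable setT (EFin \o h) ->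
  ((\int[lam2]_p h p)%R%:E = \int[lam]_x \int[lam]_y (h (x, y))%:E)%E.
Proof.
move=> Ih; rewrite (EFin_Rintegral Ih).
by have := @integral12_prod_meas1 _ _ _ _ _ lam lam _ Ih; rewrite /fubini_F => <-.
Qed.

Lemma integrable_gker2M (a b C : R) (h : R * R -> R) : 0 < a -> 0 < b ->
  measurable_fun setT (h : measurableTypeR R * measurableTypeR R -> R) ->
  (forall p, `|h p| <= C) ->
  lam2.-integrable setT (EFin \o (fun p => gker a p.1 * gker b p.2 * h p)).
Proof.
move=> a0 b0 mh hC.
have I2 := integrable_prod (integrable_gker a0) (integrable_gker b0).
apply: (integrable_le_norm _ (integrable_mulC C I2)).
  apply: measurable_fun_mulf => //; apply: measurable_fun_mulf.
    by apply: (measurableT_comp (measurable_gker a)); exact: measurable_fst.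
  by apply: (measurableT_comp (measurable_gker b)); exact: measurable_snd.
move=> p; rewrite normrM ger0_norm ?mulr_ge0 ?gker_ge0// mulrC.
by rewrite ler_wpM2r// mulr_ge0 ?gker_ge0.
Qed.

End ProductMeasure.

(** * The double integral for the Whittaker function *)

Ltac genatoms := repeat match goal with
  | |- context [gker ?a ?b] => move: (gker a b) => ?
  | |- context [expR ?a] => move: (expR a) => ?
  | |- context [cos ?a] => move: (cos a) => ?
  | |- context [sin ?a] => move: (sin a) => ?
  end.

Ltac derivg := repeat first [ hasd_step | eapply is_derive_gker ].

Section Tricomi.
Context {R : realType}.
Local Notation lam := (@lebesgue_measure R).
Local Notation lam2 := (lam \x lam)%E.
Implicit Types (a m z : R) (p : R * R).

Lemma measurable_fstR : measurable_fun setT (fun p : measurableTypeR R * measurableTypeR R => p.1 : R).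
Proof. exact: measurable_fst. Qed.

Lemma measurable_sndR : measurable_fun setT (fun p : measurableTypeR R * measurableTypeR R => p.2 : R).
Proof. exact: measurable_snd. Qed.

Lemma cvg0_gkerM b (h : R -> R) (C : R) : 0 < b -> (forall x, `|h x| <= C) ->
  gker b x * h x @[x --> +oo] --> (0 : R) /\ gker b x * h x @[x --> -oo] --> (0 : R).
Proof.
move=> b0 hC; apply: (@cvg0_expNabs _ _ b (expR (4 * b ^+ 2) * C)) => // x.
rewrite normrM (ger0_norm (gker_ge0 _ _)) mulrAC.
by apply: ler_pM => //; [exact: gker_ge0|exact: gker_le].
Qed.

Definition ucos m z p := expR (- (z * expR (p.1 + p.2))) * cos (m * (p.1 - p.2)).
Definition usin m z p := expR (- (z * expR (p.1 + p.2))) * sin (m * (p.1 - p.2)).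

Lemma measurable_ucos m z : measurable_fun setT (ucos m z : measurableTypeR R * measurableTypeR R -> R).
Proof. by rewrite /ucos; meas. Qed.

Lemma measurable_usin m z : measurable_fun setT (usin m z : measurableTypeR R * measurableTypeR R -> R).
Proof. by rewrite /usin; meas. Qed.

Lemma expRN_le1 (x : R) : 0 <= x -> expR (- x) <= 1.
Proof. by move=> x0; rewrite -expR0 ler_expR oppr_le0. Qed.

Lemma ucos_le1 m z p : 0 <= z -> `|ucos m z p| <= 1.
Proof.
move=> z0; rewrite normrM (ger0_norm (expR_ge0 _)) mulr_ile1 ?expR_ge0 ?cos_max//.
by rewrite expRN_le1// mulr_ge0 ?expR_ge0.
Qed.

Lemma usin_le1 m z p : 0 <= z -> `|usin m z p| <= 1.
Proof.
move=> z0; rewrite normrM (ger0_norm (expR_ge0 _)) mulr_ile1 ?expR_ge0 ?sin_max//.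
by rewrite expRN_le1// mulr_ge0 ?expR_ge0.
Qed.

Lemma integrable_ucos a b m z : 0 < a -> 0 < b -> 0 <= z ->
  lam2.-integrable setT (EFin \o (fun p => gker a p.1 * gker b p.2 * ucos m z p)).
Proof.
move=> a0 b0 z0; apply: (@integrable_gker2M _ _ _ 1) => //; first exact: measurable_ucos.
by move=> p; exact: ucos_le1.
Qed.

Lemma integrable_usin a b m z : 0 < a -> 0 < b -> 0 <= z ->
  lam2.-integrable setT (EFin \o (fun p => gker a p.1 * gker b p.2 * usin m z p)).
Proof.
move=> a0 b0 z0; apply: (@integrable_gker2M _ _ _ 1) => //; first exact: measurable_usin.
by move=> p; exact: usin_le1.
Qed.

(* |Gamma (a + i m)| ^ 2 times the Tricomi function of argument 1 / z, up to
   elementary factors: both s and y in int int exp (- s - y - z s y)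
   s ^ (a - 1 + i m) y ^ (a - 1 - i m) ds dy are written in log coordinates. *)
Definition tric a m z := \int[lam2]_p (gker a p.1 * gker a p.2 * ucos m z p).

(** Without the coupling factor e^(- z e^(x + y)), the cosine of m x - m y separates the variables
    and leaves Gamma (a + i m) times its conjugate. *)
Lemma tric0 a m : 0 < a -> tric a m 0 = gamN a m.
Proof.
move=> a0.
have Ic : lam.-integrable setT (EFin \o (fun x => gker a x * cos (m * x))).
  by apply: (@integrable_gkerM _ _ _ 1) => //; [meas|move=> x; exact: cos_max].
have Is : lam.-integrable setT (EFin \o (fun x => gker a x * sin (m * x))).
  by apply: (@integrable_gkerM _ _ _ 1) => //; [meas|move=> x; exact: sin_max].
rewrite /gamN !expr2 /gamC /gamS -!Rintegral_prod//.
rewrite -RintegralD//; [|exact: (integrable_prod Ic Ic)|exact: (integrable_prod Is Is)].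
apply: eq_Rintegral => p _ /=; rewrite /ucos mul0r oppr0 expR0 mul1r mulrBr cosB; genatoms; ring.
Qed.

(** Put r = e^(x + y). The remainder of e^(- z r) is at most (h r) ^ 2 by [expR_quadratic], the
    factor r ^ 2 raises the exponents of both kernels by 2, and the cosine is bounded by 1; hence
    the constant [gam (a + 2) ^+ 2]. *)
Lemma tric_quadratic a m z h : 0 < a -> 0 <= z -> 0 <= z + h ->
  `|tric a m (z + h) - tric a m z - h * - tric (a + 1) m z| <= gam (a + 2) ^+ 2 * h ^+ 2.
Proof.
move=> a0 z0 zh0; have a1 : 0 < a + 1 by lra.
have a2 : 0 < a + 2 by lra.
have i1 := @integrable_ucos a a m (z + h) a0 a0 zh0.
have i2 := @integrable_ucos a a m z a0 a0 z0.
have i3 := @integrable_ucos (a + 1) (a + 1) m z a1 a1 z0.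
have I2 := integrable_prod (integrable_gker a2) (integrable_gker a2).
rewrite mulrN opprK /tric -RintegralZl//.
rewrite -RintegralB// -RintegralD//; last first.
- exact: integrable_mulC.
- by apply: integrable_add => //; exact: integrable_opp.
have i5 := integrable_add (integrable_add i1 (integrable_opp i2)) (integrable_mulC h i3).
apply: (le_trans (le_normr_Rintegral measurableT i5)).
rewrite expr2 mulrC /gam -Rintegral_prod//; [|exact: integrable_gker|exact: integrable_gker].
rewrite -RintegralZl//.
apply: le_Rintegral => //.
- by have := integrable_norm i5.
- exact: integrable_mulC.
move=> p _.
set r := expR (p.1 + p.2).
have e1 : gker (a + 1) p.1 * gker (a + 1) p.2 = r * (gker a p.1 * gker a p.2).
  by rewrite !gkerS /r expRD; genatoms; ring.
have e2 : gker (a + 2) p.1 * gker (a + 2) p.2 = r ^+ 2 * (gker a p.1 * gker a p.2).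
  by rewrite (_ : a + 2 = a + 1 + 1); [rewrite !gkerS /r expRD; genatoms; ring|ring].
rewrite e1 e2 /ucos -/r.
set g := gker a p.1 * gker a p.2.
have g0 : 0 <= g by rewrite /g mulr_ge0 ?gker_ge0.
have r0 : 0 <= r by exact: expR_ge0.
set c := cos _.
have -> : g * (expR (- ((z + h) * r)) * c) - g * (expR (- (z * r)) * c) +
   h * (r * g * (expR (- (z * r)) * c)) =
   (expR (- ((z + h) * r)) - expR (- (z * r)) + ((z + h) * r - z * r) * expR (- (z * r))) * g * c by ring.
rewrite normrM -[leRHS]mulr1; apply: ler_pM => //; last exact: cos_max.
rewrite normrM (ger0_norm g0) mulrA ler_wpM2r//.
have q1 : 0 <= z * r by rewrite mulr_ge0.
have q2 : 0 <= (z + h) * r by rewrite mulr_ge0.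
apply: (le_trans (expR_quadratic q1 q2)).
by rewrite -mulrBl addrAC subrr add0r exprMn.
Qed.

Lemma is_derive_tric a m z : 0 < a -> 0 < z -> is_derive z 1 (tric a m) (- tric (a + 1) m z).
Proof.
move=> a0 z0; apply: (@is_derive_quadratic _ _ _ _ (gam (a + 2) ^+ 2) z) => // h hz.
apply: tric_quadratic => //; first exact: ltW.
by move: hz; rewrite ltr_norml => /andP[]; lra.
Qed.

(** The endpoint z = 0 corresponds to x = +oo: this first-order bound yields the asymptotics of the
    Whittaker function. *)
Lemma tric_lip0 a m z : 0 < a -> 0 <= z -> `|tric a m z - tric a m 0| <= gam (a + 1) ^+ 2 * z.
Proof.
move=> a0 z0; have a1 : 0 < a + 1 by lra.
have i1 := @integrable_ucos a a m z a0 a0 z0.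
have i2 := @integrable_ucos a a m 0 a0 a0 (lexx 0).
have I2 := integrable_prod (integrable_gker a1) (integrable_gker a1).
rewrite /tric -RintegralB//.
have i5 := integrable_add i1 (integrable_opp i2).
apply: (le_trans (le_normr_Rintegral measurableT i5)).
rewrite expr2 mulrC /gam -Rintegral_prod//; [|exact: integrable_gker|exact: integrable_gker].
rewrite -RintegralZl//.
apply: le_Rintegral => //.
- by have := integrable_norm i5.
- exact: integrable_mulC.
move=> p _.
set r := expR (p.1 + p.2).
have e1 : gker (a + 1) p.1 * gker (a + 1) p.2 = r * (gker a p.1 * gker a p.2).
  by rewrite !gkerS /r expRD; genatoms; ring.
rewrite e1 /ucos -/r.
set g := gker a p.1 * gker a p.2.
have g0 : 0 <= g by rewrite /g mulr_ge0 ?gker_ge0.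
have r0 : 0 <= r by exact: expR_ge0.
set c := cos _.
have -> : g * (expR (- (z * r)) * c) - g * (expR (- (0 * r)) * c) =
  (expR (- (z * r)) - expR (- (0 * r))) * g * c by ring.
rewrite normrM -[leRHS]mulr1; apply: ler_pM => //; last exact: cos_max.
rewrite normrM (ger0_norm g0) mulrA ler_wpM2r//.
have q1 : 0 <= 0 * r by rewrite mul0r.
have q2 : 0 <= z * r by rewrite mulr_ge0.
apply: (le_trans (expR_lip q1 q2)).
by rewrite mul0r subr0 ger0_norm// mulr_ge0.
Qed.

(* The integrand of the left-hand side is the divergence
   d/dx [(a - z e^(x + y)) E cos + m E sin] + d/dy [e^x E cos]. *)
Lemma tric_ode a m z : 0 < a -> 0 <= z ->
  z ^+ 2 * tric (a + 2) m z - (2 * a * z + z + 1) * tric (a + 1) m z +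
    (a ^+ 2 + m ^+ 2) * tric a m z = 0.
Proof.
move=> a0 z0; have a1 : 0 < a + 1 by lra.
have a2 : 0 < a + 2 by lra.
pose K j k p := gker j p.1 * gker k p.2.
have iC j k : 0 < j -> 0 < k -> lam2.-integrable setT (EFin \o (fun p => K j k p * ucos m z p)).
  by move=> j0 k0; exact: integrable_ucos.
have iS j k : 0 < j -> 0 < k -> lam2.-integrable setT (EFin \o (fun p => K j k p * usin m z p)).
  by move=> j0 k0; exact: integrable_usin.
have K0 j k p : 0 <= K j k p by rewrite /K mulr_ge0 ?gker_ge0.
pose L p := z ^+ 2 * (K (a + 2) (a + 2) p * ucos m z p) +
  - (2 * a * z + z + 1) * (K (a + 1) (a + 1) p * ucos m z p) +
  (a ^+ 2 + m ^+ 2) * (K a a p * ucos m z p).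
pose dB p := a * (K (a + 1) a p * ucos m z p) + - 1 * (K (a + 1) (a + 1) p * ucos m z p)
  + - z * (K (a + 2) (a + 1) p * ucos m z p) + m * (K (a + 1) a p * usin m z p).
have iL : lam2.-integrable setT (EFin \o L).
  by do 2 (apply: integrable_add; last by apply: integrable_mulC; apply: iC);
    apply: integrable_mulC; apply: iC.
have idB : lam2.-integrable setT (EFin \o dB).
  apply: integrable_add; last by apply: integrable_mulC; apply: iS.
  by do 2 (apply: integrable_add; last by apply: integrable_mulC; apply: iC);
    apply: integrable_mulC; apply: iC.
have idA := integrable_add iL (integrable_opp idB).
have eL : z ^+ 2 * tric (a + 2) m z - (2 * a * z + z + 1) * tric (a + 1) m z +
    (a ^+ 2 + m ^+ 2) * tric a m z = \int[lam2]_p L p.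
  rewrite /L RintegralD//; last first.
  - by apply: integrable_mulC; apply: iC.
  - by apply: integrable_add; apply: integrable_mulC; apply: iC.
  rewrite RintegralD//; [|by apply: integrable_mulC; apply: iC|by apply: integrable_mulC; apply: iC].
  by rewrite !RintegralZl//; [rewrite mulNr|exact: iC|exact: iC|exact: iC].
rewrite eL.
have -> : \int[lam2]_p L p = \int[lam2]_p (L p - dB p) + \int[lam2]_p dB p.
  by rewrite RintegralB// subrK.
have sl (h : measurableTypeR R * measurableTypeR R -> R) : measurable_fun setT h ->
    (forall x, measurable_fun setT (fun y : R => h (x, y))) /\
    (forall y, measurable_fun setT (fun x : R => h (x, y))).
  by move=> mh; split => [x|y]; [exact: measurableT_comp mh (measurable_pair1 x)
    |exact: measurableT_comp mh (measurable_pair2 y)].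
have [mc1 mc2] := sl _ (measurable_ucos m z).
have [ms1 ms2] := sl _ (measurable_usin m z).
have bc k x y u : `|gker k u * ucos m z (x, y)| <= gker k u.
  by rewrite normrM (ger0_norm (gker_ge0 _ _)) ler_piMr ?gker_ge0// ucos_le1.
have bs k x y u : `|gker k u * usin m z (x, y)| <= gker k u.
  by rewrite normrM (ger0_norm (gker_ge0 _ _)) ler_piMr ?gker_ge0// usin_le1.
have iC2 j k y : 0 < j -> lam.-integrable setT (EFin \o (fun x => K j k (x, y) * ucos m z (x, y))).
  move=> j0; apply: (@integrable_ext _ _ _ lam (fun x => gker j x * (gker k y * ucos m z (x, y)))).
    by move=> x; rewrite /K/= mulrA.
  by apply: (@integrable_gkerM _ _ _ (gker k y)) => //; apply: measurable_fun_mulf; [meas|exact: mc2].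
have iS2 j k y : 0 < j -> lam.-integrable setT (EFin \o (fun x => K j k (x, y) * usin m z (x, y))).
  move=> j0; apply: (@integrable_ext _ _ _ lam (fun x => gker j x * (gker k y * usin m z (x, y)))).
    by move=> x; rewrite /K/= mulrA.
  by apply: (@integrable_gkerM _ _ _ (gker k y)) => //; apply: measurable_fun_mulf; [meas|exact: ms2].
have iC1 j k x : 0 < k -> lam.-integrable setT (EFin \o (fun y => K j k (x, y) * ucos m z (x, y))).
  move=> k0; apply: (@integrable_ext _ _ _ lam (fun y => gker k y * (gker j x * ucos m z (x, y)))).
    by move=> y; rewrite /K/= mulrCA mulrA.
  by apply: (@integrable_gkerM _ _ _ (gker j x)) => //; apply: measurable_fun_mulf; [meas|exact: mc1].
have iS1 j k x : 0 < k -> lam.-integrable setT (EFin \o (fun y => K j k (x, y) * usin m z (x, y))).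
  move=> k0; apply: (@integrable_ext _ _ _ lam (fun y => gker k y * (gker j x * usin m z (x, y)))).
    by move=> y; rewrite /K/= mulrCA mulrA.
  by apply: (@integrable_gkerM _ _ _ (gker j x)) => //; apply: measurable_fun_mulf; [meas|exact: ms1].
have a12 : a + 2 = a + 1 + 1 by ring.
(* [L - dB] is an exact x-derivative for each y and [dB] an exact y-derivative for each x, so
   Fubini's theorem is used in opposite orders for the two. *)
suff [-> ->] : \int[lam2]_p (L p - dB p) = 0 /\ \int[lam2]_p dB p = 0 by rewrite addr0.
split; apply: EFin_inj.
- rewrite (Rintegral_prod2 idA); apply: integral0_eq => y _.
  pose F x := a * (gker a x * (gker a y * ucos m z (x, y))) +
    - (z * expR y) * (gker (a + 1) x * (gker a y * ucos m z (x, y))) +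
    m * (gker a x * (gker a y * usin m z (x, y))).
  have dF (x : R) : is_derive x 1 F (L (x, y) - dB (x, y)).
    eapply hasd_eq; first by rewrite /F /ucos /usin/=; derivg.
    rewrite /L /dB /K /ucos /usin /= a12 !gkerS !expRD; genatoms; ring.
  have cf : continuous (fun x => L (x, y) - dB (x, y)).
    by move=> x; eapply hasd_continuous; rewrite /L /dB /K /ucos /usin /=; derivg.
  have If : lam.-integrable setT (EFin \o (fun x => L (x, y) - dB (x, y))).
    apply: integrable_add; last apply: integrable_opp.
      by do 2 (apply: integrable_add; last by apply: integrable_mulC; apply: iC2);
        apply: integrable_mulC; apply: iC2.
    apply: integrable_add; last by apply: integrable_mulC; apply: iS2.
    by do 2 (apply: integrable_add; last by apply: integrable_mulC; apply: iC2);
      apply: integrable_mulC; apply: iC2.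
  have [c1 c2] := @cvg0_gkerM a (fun x => gker a y * ucos m z (x, y)) _ a0 (fun x => bc a x y y).
  have [c3 c4] := @cvg0_gkerM (a + 1) (fun x => gker a y * ucos m z (x, y)) _ a1 (fun x => bc a x y y).
  have [c5 c6] := @cvg0_gkerM a (fun x => gker a y * usin m z (x, y)) _ a0 (fun x => bs a x y y).
  have e0 : (0 : R) = a * 0 + - (z * expR y) * 0 + m * 0 by ring.
  have Fy : F x @[x --> +oo] --> (0 : R).
    by rewrite e0; apply: cvgD; [apply: cvgD|]; (apply: cvgM; [exact: cvg_cst|]).
  have Fny : F x @[x --> -oo] --> (0 : R).
    by rewrite e0; apply: cvgD; [apply: cvgD|]; (apply: cvgM; [exact: cvg_cst|]).
  by rewrite (integral_derive dF cf If Fy Fny) subrr.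
- rewrite (Rintegral_prod1 idB); apply: integral0_eq => x _.
  pose F y := gker a y * (gker (a + 1) x * ucos m z (x, y)).
  have dF (y : R) : is_derive y 1 F (dB (x, y)).
    eapply hasd_eq; first by rewrite /F /ucos /usin/=; derivg.
    rewrite /dB /K /ucos /usin /= a12 !gkerS !expRD; genatoms; ring.
  have cf : continuous (fun y => dB (x, y)).
    by move=> y; eapply hasd_continuous; rewrite /dB /K /ucos /usin /=; derivg.
  have If : lam.-integrable setT (EFin \o (fun y => dB (x, y))).
    apply: integrable_add; last by apply: integrable_mulC; apply: iS1.
    by do 2 (apply: integrable_add; last by apply: integrable_mulC; apply: iC1);
      apply: integrable_mulC; apply: iC1.
  have [Fy Fny] := @cvg0_gkerM a (fun y => gker (a + 1) x * ucos m z (x, y)) _ a0 (fun y => bc (a + 1) x y x).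
  by rewrite (integral_derive dF cf If Fy Fny) subrr.
Qed.

End Tricomi.

(** * Uniqueness of the recessive solution *)

Section RecessiveUniqueness.
Context {R : realType}.

Lemma pinfty_nbhsP (P : R -> Prop) : (\forall x \near +oo, P x) ->
  exists M : R, forall x, M < x -> P x.
Proof. by move=> [M [_ H]]; exists M. Qed.

Lemma is_derive0_eq (f : R -> R) (a b : R) : a <= b ->
  (forall x, a <= x <= b -> is_derive x 1 f 0) -> f a = f b.
Proof.
move=> ab df; apply/eqP; rewrite eq_le; apply/andP; split.
  exact: (@le_is_derive _ f (fun=> 0)).
rewrite -lerN2; apply: (@le_is_derive _ (fun x => - f x) (fun=> 0)) => // x xab.
by rewrite -oppr0; apply: is_derive_oppf; exact: df.
Qed.

Context (Q f f1 w w1 g : R -> R) (G : R).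
Hypothesis df : forall x : R, 0 < x -> is_derive x 1 f (f1 x).
Hypothesis df1 : forall x : R, 0 < x -> is_derive x 1 f1 (- (Q x * f x)).
Hypothesis dw : forall x : R, 0 < x -> is_derive x 1 w (w1 x).
Hypothesis dw1 : forall x : R, 0 < x -> is_derive x 1 w1 (- (Q x * w x)).
Hypothesis Qb : forall a : R, 0 < a -> exists M, forall x, a <= x -> `|Q x| <= M.
Hypothesis g0 : forall x : R, 0 < g x.
Hypothesis gG : forall x : R, 1 <= x -> g x <= G.
Hypothesis fg : f x / g x @[x --> +oo] --> (0 : R).
Hypothesis wg : w x / g x @[x --> +oo] --> (1 : R).

Let W (x : R) := f x * w1 x - f1 x * w x.

Let W_const (x y : R) : 0 < x -> x <= y -> W x = W y.
Proof.
move=> x0 xy; apply: is_derive0_eq => // z /andP[xz zy].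
have z0 : 0 < z by exact: lt_le_trans xz.
apply: (@hasd_eq _ _ _ (f1 z * w1 z + f z * - (Q z * w z)
  + - (- (Q z * f z) * w z + f1 z * w1 z))); last by ring.
by apply: hasd_add; [|apply: hasd_opp]; apply: hasd_mul;
  [exact: df|exact: dw1|exact: df1|exact: dw].
Qed.

Lemma recessive_far (e : R) : 0 < e -> exists X, [/\ 1 <= X, forall x, X <= x -> g x / 2 <= w x <= 2 * g x
  & forall x, X <= x -> `|f x| <= e * w x].
Proof.
move=> e0; have e2 : 0 < e / 2 by lra.
move/cvgrPdist_le : fg => /(_ _ e2) /pinfty_nbhsP[M1 H1].
move/cvgrPdist_le : wg => /(_ (1 / 2)) /(_ ltac:(lra)) /pinfty_nbhsP[M2 H2].
exists (Num.max 1 (Num.max (M1 + 1) (M2 + 1))).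
have h x : Num.max 1 (Num.max (M1 + 1) (M2 + 1)) <= x -> [/\ 1 <= x, M1 < x & M2 < x].
  rewrite !ge_max => /andP[-> /andP[a b]]; split=> //; lra.
have hw x : Num.max 1 (Num.max (M1 + 1) (M2 + 1)) <= x -> g x / 2 <= w x <= 2 * g x.
  move=> /h[_ _ /H2]; rewrite ler_norml => /andP[a b].
  have gx := g0 x; have -> : w x = w x / g x * g x by rewrite divfK// gt_eqF.
  by apply/andP; split; [rewrite mulrC ler_pM2r//|rewrite ler_pM2r//]; lra.
split => [||x hx]; [by rewrite le_max lexx|exact: hw|].
have [_ /H1 a _] := h _ hx; have /andP[b _] := hw _ hx.
have gx := g0 x; move: a; rewrite sub0r normrN normrM normfV (gtr0_norm gx).
rewrite ler_pdivrMr// => a; apply: (le_trans a).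
have -> : e / 2 * g x = e * (g x / 2) by ring.
by rewrite ler_wpM2l// ltW.
Qed.

(** If the constant Wronskian c were positive, - f / w would have derivative c / w ^ 2, which is at
    least c / K because w <= 2 G far out. It would grow linearly, although f is negligible with
    respect to w. *)
Lemma wronskian_le0 (x : R) : 0 < x -> f x * w1 x - f1 x * w x <= 0.
Proof.
move=> x0; rewrite -/(W x) leNgt; apply/negP => Wx.
have [X [X1 Hw Hf]] := recessive_far ltr01.
pose Y := Num.max x X; pose c := W x.
have Y0 : 0 < Y by rewrite lt_max x0.
have cE y : Y <= y -> W y = c.
  by rewrite ge_max => /andP[xy _]; rewrite /c (W_const x0 xy).
have w0 y : Y <= y -> 0 < w y.
  rewrite ge_max => /andP[_ /Hw /andP[h _]]; apply: lt_le_trans h.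
  by rewrite divr_gt0.
have Y1 : 1 <= Y by rewrite le_max X1 orbT.
have G0 : 0 < G by exact: lt_le_trans (g0 Y) (gG Y1).
pose K := (2 * G) ^+ 2; have K0 : 0 < K by rewrite exprn_gt0// mulr_gt0.
pose psi y := - (f y / w y) - c / K * y.
have dpsi y : Y <= y -> is_derive y 1 psi (c / w y ^+ 2 - c / K).
  move=> Yy; have y0 : 0 < y by exact: lt_le_trans Yy.
  have wy := w0 _ Yy.
  apply: (@hasd_eq _ _ _ (- (f1 y * (w y)^-1 + f y * (- w1 y / w y ^+ 2)) +
     - (0 * y + c / K * 1))); last first.
    by rewrite -(cE _ Yy) /W; field; rewrite !gt_eqF.
  apply: hasd_add; apply: hasd_opp; apply: hasd_mul.
  - exact: df.
  - by apply: hasd_inv; [rewrite gt_eqF|exact: dw].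
  - exact: hasd_cst.
  - exact: hasd_id.
(* Over this length - f / w gains at least 3, more than the width 2 of the interval [- 1, 1] that
   contains its values. *)
pose Z := Y + 3 * K / c.
have YZ : Y <= Z by rewrite /Z lerDl divr_ge0 ?mulr_ge0// ltW.
have H y : Y <= y <= Z -> 0 <= c / w y ^+ 2 - c / K.
  move=> /andP[Yy _]; rewrite subr_ge0; apply: ler_wpM2l; first exact: ltW Wx.
  have wy2 : 0 < w y ^+ 2 by rewrite exprn_gt0// w0.
  rewrite lef_pV2 ?posrE//.
  have y0 : 0 < y by exact: lt_le_trans Yy.
  have Xy : X <= y by apply: le_trans Yy; rewrite le_max lexx orbT.
  have /andP[_ h] := Hw y Xy.
  rewrite /K ler_sqr ?nnegrE; [|exact: ltW (w0 y Yy)|by rewrite mulr_ge0// ltW].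
  by apply: (le_trans h); rewrite ler_wpM2l// gG// (le_trans Y1).
have hpsi : psi Y <= psi Z.
  exact: (@le_is_derive _ psi (fun y => c / w y ^+ 2 - c / K) _ _ YZ (fun u Hu => dpsi u (proj1 (andP Hu))) H).
have fw y : Y <= y -> - 1 <= - (f y / w y) <= 1.
  move=> Yy; have Xy : X <= y by apply: le_trans Yy; rewrite le_max lexx orbT.
  rewrite -ler_norml normrN normrM normfV (gtr0_norm (w0 _ Yy)) ler_pdivrMr ?w0//.
  exact: Hf.
have /andP[h1 _] := fw _ (lexx Y); have /andP[_ h2] := fw _ YZ.
have h3 : c / K * Z = c / K * Y + 3 by rewrite /Z; field; rewrite !gt_eqF.
by move: hpsi; rewrite /psi h3; lra.
Qed.

End RecessiveUniqueness.

Section RecessiveUniqueness2.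
Context {R : realType}.

(* Two solutions of y'' + Q y = 0, one of which is negligible with respect to
   the other, recessive, one: their Wronskian is constant, hence 0, so f / w is
   constant, hence 0, near +oo; f then vanishes by uniqueness for the Cauchy
   problem. *)
Lemma recessive_unique (Q f f1 w w1 g : R -> R) (G : R) :
  (forall x : R, 0 < x -> is_derive x 1 f (f1 x)) ->
  (forall x : R, 0 < x -> is_derive x 1 f1 (- (Q x * f x))) ->
  (forall x : R, 0 < x -> is_derive x 1 w (w1 x)) ->
  (forall x : R, 0 < x -> is_derive x 1 w1 (- (Q x * w x))) ->
  (forall a : R, 0 < a -> exists M, forall x, a <= x -> `|Q x| <= M) ->
  (forall x : R, 0 < g x) -> (forall x : R, 1 <= x -> g x <= G) ->
  f x / g x @[x --> +oo] --> (0 : R) -> w x / g x @[x --> +oo] --> (1 : R) ->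
  forall x, 0 < x -> f x = 0.
Proof.
move=> df df1 dw dw1 Qb g0 gG fg wg.
have W0 x : 0 < x -> f x * w1 x - f1 x * w x = 0.
  move=> x0; apply/eqP; rewrite eq_le.
  rewrite (wronskian_le0 df df1 dw dw1 g0 gG fg wg x0)/= -oppr_le0.
  (* The opposite inequality is [wronskian_le0] applied to - f. *)
  have dNf (y : R) : 0 < y -> is_derive y 1 (fun y => - f y) (- f1 y).
    by move=> y0; apply: is_derive_oppf; exact: df.
  have dNf1 (y : R) : 0 < y -> is_derive y 1 (fun y => - f1 y) (- (Q y * - f y)).
    by move=> y0; rewrite mulrN; apply: is_derive_oppf; exact: df1.
  have fgN : - f x / g x @[x --> +oo] --> (0 : R).
    rewrite -oppr0; under eq_fun do rewrite mulNr; exact: cvgN.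
  by have := wronskian_le0 dNf dNf1 dw dw1 g0 gG fgN wg x0; rewrite !mulNr opprK opprD opprK.
have [X [X1 Hw _]] := recessive_far g0 fg wg ltr01.
have X0 : 0 < X by lra.
have w0 y : X <= y -> 0 < w y.
  by move=> /Hw /andP[h _]; apply: lt_le_trans h; rewrite divr_gt0.
have fE y : X <= y -> f y = f X / w X * w y.
  move=> Xy; have y0 : 0 < y by exact: lt_le_trans Xy.
  suff -> : f X / w X = f y / w y by rewrite divfK// gt_eqF// w0.
  apply: (@is_derive0_eq _ (fun y => f y / w y)) => // z /andP[Xz _].
  have z0 : 0 < z by exact: lt_le_trans Xz.
  have wz := w0 _ Xz.
  apply: (@hasd_eq _ _ _ (f1 z * (w z)^-1 + f z * (- w1 z / w z ^+ 2))).
    apply: hasd_mul; first exact: df.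
    by apply: hasd_inv; [rewrite gt_eqF|exact: dw].
  have -> : f1 z / w z + f z * (- w1 z / w z ^+ 2) = - (f z * w1 z - f1 z * w z) / w z ^+ 2.
    by field; rewrite gt_eqF.
  by rewrite W0// oppr0 mul0r.
set k := f X / w X in fE.
have k0 : k = 0.
  (* Otherwise |f| = |k| w beyond X, against |f| <= |k| / 4 * w, which holds far out because f is
     negligible. *)
  apply/eqP/negP => /negP kn0; have k2 : 0 < `|k| / 4 by rewrite divr_gt0// normr_gt0.
  have [Y [Y1 Hw' Hf']] := recessive_far g0 fg wg k2.
  pose Z := Num.max X Y.
  have XZ : X <= Z by rewrite le_max lexx.
  have YZ : Y <= Z by rewrite le_max lexx orbT.
  have := Hf' _ YZ; rewrite fE// normrM (gtr0_norm (w0 _ XZ)) ler_pM2r ?w0//.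
  have kp : 0 < `|k| by rewrite normr_gt0.
  by lra.
have fX : f X = 0 by rewrite fE// k0 mul0r.
have f1X : f1 X = 0.
  have := W0 _ X0; rewrite fX mul0r sub0r => /eqP; rewrite oppr_eq0 mulf_eq0.
  by rewrite (gt_eqF (w0 _ (lexx X))) orbF => /eqP.
move=> x x0; have [Xx|xX] := leP X x; first by rewrite fE// k0 mul0r.
have [M HM] := Qb x x0.
(* Uniqueness backwards from X: the weight e^((1 + M) y) makes this energy nondecreasing on [x, X],
   since |2 f f1 (1 - Q)| <= (1 + M) (f ^ 2 + f1 ^ 2). It is nonnegative and vanishes at X, hence
   also at x. *)
pose E y := expR ((1 + M) * y) * (f y ^+ 2 + f1 y ^+ 2).
pose dE y := expR ((1 + M) * y) * ((1 + M) * (f y ^+ 2 + f1 y ^+ 2)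
   + 2 * f y * f1 y * (1 - Q y)).
have hE : E x <= E X.
  apply: (@le_is_derive _ E dE); first exact: ltW.
  - move=> y /andP[xy _]; have y0 : 0 < y by exact: lt_le_trans xy.
    apply: (@hasd_eq _ _ _ ((0 * y + (1 + M) * 1) * expR ((1 + M) * y) * (f y ^+ 2 + f1 y ^+ 2) +
      expR ((1 + M) * y) * (2 * f1 y * f y + 2 * (- (Q y * f y)) * f1 y))); last first.
      by rewrite /dE; move: (expR _) => e; ring.
    apply: hasd_mul; first by deriv.
    by apply: hasd_add; apply: hasd_sqr; [exact: df|exact: df1].
  - move=> y /andP[xy _]; rewrite mulr_ge0 ?expR_ge0//.
    have := HM _ xy; rewrite ler_norml => /andP[q1 q2].
    move: (f y) (f1 y) (Q y) q1 q2 => u v q q1 q2.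
    have := sqr_ge0 (u + v); have := sqr_ge0 (u - v); rewrite !expr2 => s1 s2.
    have [q0|q0] := leP 0 (1 - q); nra.
have : E X = 0 by rewrite /E fX f1X expr0n/= addr0 mulr0.
move=> EX; move: hE; rewrite EX /E pmulr_rle0 ?expR_gt0// => h.
have : f x ^+ 2 <= 0 by have := sqr_ge0 (f1 x); lra.
by move=> h2; apply/eqP; rewrite -sqrf_eq0 eq_le h2 sqr_ge0.
Qed.

End RecessiveUniqueness2.

(** * Identification of the Whittaker function *)

Section Whittaker.
Context {R : realType}.
Local Open Scope complex_scope.
Implicit Types (mu m x : R).

Lemma near_pos_nbhs (x : R) : 0 < x -> \forall y \near x, 0 < y.
Proof. by move=> x0; exact: (lt_nbhsr x0). Qed.

Lemma second_derivative_pos (f f1 f2 : R -> R) :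
  (forall x : R, 0 < x -> is_derive x 1 f (f1 x)) ->
  (forall x : R, 0 < x -> is_derive x 1 f1 (f2 x)) ->
  forall x : R, 0 < x -> is_derive x 1 (f^`()%classic) (f2 x).
Proof.
move=> df df1 x x0; have D := df1 x x0.
apply: (near_eq_is_derive (f := f1)) => //.
by near=> y; rewrite (is_derive_derive1 (df y _))//; near: y; exact: near_pos_nbhs.
Unshelve. all: by end_near. Qed.

(* Junk for x <= 0. *)
Definition whitt mu m x : R :=
  expR (mu * ln x - x / 2) * (tric (1 / 2 - mu) m x^-1 / gamN (1 / 2 - mu) m).

(** The index is nu = i m, so 1 / 4 - nu ^ 2 becomes 1 / 4 + m ^ 2. *)
Definition whittQ mu m x : R := - 4^-1 + mu / x + (4^-1 + m ^+ 2) / x ^+ 2.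

Definition whitt1 mu m x : R := expR (mu * ln x - x / 2) / gamN (1 / 2 - mu) m *
  ((mu / x - 1 / 2) * tric (1 / 2 - mu) m x^-1 + tric (1 / 2 - mu + 1) m x^-1 / x ^+ 2).

Lemma is_derive_tric_inv a m x : 0 < a -> 0 < x ->
  is_derive x 1 (fun y => tric a m y^-1) (tric (a + 1) m x^-1 / x ^+ 2).
Proof.
move=> a0 x0; have xi : 0 < x^-1 by rewrite invr_gt0.
apply: (@hasd_eq _ _ _ (- 1 / x ^+ 2 * - tric (a + 1) m x^-1)); last by ring.
apply: (@is_derive_compf _ (fun y => y^-1)); first exact: is_derive_tric.
by apply: hasd_inv; [rewrite gt_eqF|exact: hasd_id].
Qed.

Lemma is_derive_whitt mu m x : mu < 1 / 2 -> 0 < x ->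
  is_derive x 1 (whitt mu m) (whitt1 mu m x).
Proof.
move=> hmu x0; have a0 : 0 < 1 / 2 - mu by lra.
have N0 := gamN_gt0 m a0.
apply: (@hasd_eq _ _ _ ((0 * ln x + mu * (1 / x) + - (1 * 2^-1 + x * 0)) * expR (mu * ln x - x / 2) *
  (tric (1 / 2 - mu) m x^-1 / gamN (1 / 2 - mu) m) + expR (mu * ln x - x / 2) *
  (tric (1 / 2 - mu + 1) m x^-1 / x ^+ 2 * (gamN (1 / 2 - mu) m)^-1 + tric (1 / 2 - mu) m x^-1 * 0))); last first.
  rewrite /whitt1; move: (expR _) => e; move: (ln x) => l.
  move: (tric (1 / 2 - mu + 1) _ _) => t2; move: (tric (1 / 2 - mu) _ _) => t1.
  move: (gamN _ _) N0 => N N0.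
  by field; rewrite !gt_eqF.
apply: hasd_mul; first by deriv.
apply: hasd_mul; last exact: hasd_cst.
exact: is_derive_tric_inv.
Qed.

Lemma is_derive_whitt1 mu m x : mu < 1 / 2 -> 0 < x ->
  is_derive x 1 (whitt1 mu m) (- (whittQ mu m x * whitt mu m x)).
Proof.
move=> hmu x0; have a0 : 0 < 1 / 2 - mu by lra.
have a1 : 0 < 1 / 2 - mu + 1 by lra.
have N0 := gamN_gt0 m a0.
apply: (@hasd_eq _ _ _ (
  ((0 * ln x + mu * (1 / x) + - (1 * 2^-1 + x * 0)) * expR (mu * ln x - x / 2) * (gamN (1 / 2 - mu) m)^-1 +
    expR (mu * ln x - x / 2) * 0) *
  ((mu / x - 1 / 2) * tric (1 / 2 - mu) m x^-1 + tric (1 / 2 - mu + 1) m x^-1 / x ^+ 2) +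
  expR (mu * ln x - x / 2) / gamN (1 / 2 - mu) m *
  (((0 * x^-1 + mu * (- 1 / x ^+ 2) + 0) * tric (1 / 2 - mu) m x^-1 +
    (mu / x - 1 / 2) * (tric (1 / 2 - mu + 1) m x^-1 / x ^+ 2)) +
   (tric (1 / 2 - mu + 1 + 1) m x^-1 / x ^+ 2 * (x ^+ 2)^-1 +
    tric (1 / 2 - mu + 1) m x^-1 * (- (2 * 1 * x) / (x ^+ 2) ^+ 2))))); last first.
  have xi : 0 <= x^-1 by rewrite invr_ge0 ltW.
  have := tric_ode m a0 xi; rewrite (_ : 1 / 2 - mu + 2 = 1 / 2 - mu + 1 + 1); last by ring.
  rewrite /whittQ /whitt.
  move: (expR _) => e; move: (ln x) => l; move: (tric (1 / 2 - mu + 1 + 1) _ _) => t2.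
  move: (tric (1 / 2 - mu + 1) _ _) => t1; move: (tric (1 / 2 - mu) _ _) => t0.
  move: (gamN _ _) N0 => N N0 ode.
  (* [tric_ode] at z = 1 / x is solved for its second-order term, which turns the goal into a
     rational identity. *)
  have ode2 : t2 = (- ((1 / 2 - mu) ^+ 2 + m ^+ 2) * t0 + (2 * (1 / 2 - mu) * x^-1 + x^-1 + 1) * t1) * x ^+ 2.
    have -> : t2 = (x^-1 ^+ 2 * t2) * x ^+ 2 by field; rewrite gt_eqF.
    by congr (_ * _); move: ode; set A := x^-1 ^+ 2 * t2; lra.
  by rewrite ode2; field; rewrite !gt_eqF.
apply: hasd_mul.
  by apply: hasd_mul; [deriv|exact: hasd_cst].
apply: hasd_add; apply: hasd_mul.
- apply: hasd_add; last exact: hasd_cst.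
  apply: hasd_mul; first exact: hasd_cst.
  by apply: hasd_inv; [rewrite gt_eqF|exact: hasd_id].
- exact: is_derive_tric_inv.
- exact: is_derive_tric_inv.
- apply: hasd_inv; first by rewrite sqrf_eq0 gt_eqF.
  by apply: hasd_sqr; exact: hasd_id.
Qed.

Lemma whitt_div mu m x : whitt mu m x / expR (mu * ln x - x / 2) =
  tric (1 / 2 - mu) m x^-1 / gamN (1 / 2 - mu) m.
Proof. by rewrite /whitt mulrC mulKf// gt_eqF// expR_gt0. Qed.

(** The divisor [gamN] is the value of [tric] at 0, which normalises the limit to 1; [tric_lip0]
    gives the rate 1 / x. *)
Lemma cvg_whitt mu m : mu < 1 / 2 ->
  whitt mu m x / expR (mu * ln x - x / 2) @[x --> +oo] --> (1 : R).
Proof.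
move=> hmu; have a0 : 0 < 1 / 2 - mu by lra.
have N0 := gamN_gt0 m a0.
under eq_fun do rewrite whitt_div.
set N := gamN _ _.
have eN : N / N = 1 by rewrite divff// gt_eqF.
suff : tric (1 / 2 - mu) m x^-1 / N @[x --> +oo] --> N / N by rewrite eN.
apply: cvgM; last exact: cvg_cst.
apply/cvgrPdist_le => e e0; near=> x.
have x0 : 0 < x by near: x; exact: nbhs_pinfty_gt.
have xi : 0 <= x^-1 by rewrite invr_ge0 ltW.
have hx : gam (1 / 2 - mu + 1) ^+ 2 / e <= x.
  by near: x; apply: nbhs_pinfty_ge; exact: num_real.
rewrite distrC /N -(tric0 m a0) (le_trans (tric_lip0 m a0 xi))//.
by rewrite ler_pdivrMr// [e * x]mulrC -ler_pdivrMr.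
Unshelve. all: by end_near. Qed.

Lemma whittQ_bounded mu m a : 0 < a -> exists M, forall x, a <= x -> `|whittQ mu m x| <= M.
Proof.
move=> a0; exists (4^-1 + `|mu| / a + (4^-1 + m ^+ 2) / a ^+ 2) => x ax.
have x0 : 0 < x by exact: lt_le_trans ax.
have m0 := sqr_ge0 m.
rewrite /whittQ; apply: le_trans (ler_normD _ _) _; apply: lerD.
  apply: le_trans (ler_normD _ _) _; apply: lerD.
    by rewrite normrN ger0_norm// invr_ge0.
  by rewrite normrM normfV (gtr0_norm x0) ler_wpM2l// lef_pV2.
rewrite ger0_norm; last by rewrite divr_ge0 ?sqr_ge0// addr_ge0// invr_ge0.
rewrite ler_wpM2l//; first by rewrite addr_ge0// invr_ge0.
rewrite lef_pV2 ?posrE ?exprn_gt0//.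
by rewrite ler_sqr ?nnegrE//; exact: ltW.
Qed.

(** Half of [linear_le_expR] with slope 2 |mu| at ln x: |mu| ln x - x / 2 <= 2 mu ^ 2. *)
Lemma whitt_weight_le mu x : 1 <= x -> expR (mu * ln x - x / 2) <= expR (2 * mu ^+ 2).
Proof.
move=> x1; rewrite ler_expR.
have x0 : 0 < x by lra.
have m0 : 0 <= 2 * `|mu| by rewrite mulr_ge0.
have := linear_le_expR (ln x) m0; rewrite lnK ?posrE// exprMn real_normK ?num_real//.
have : mu * ln x <= `|mu| * ln x by rewrite ler_wpM2r ?ln_ge0// ler_norm.
rewrite !expr2 -!mulrA; move: (mu * ln x) (`|mu| * ln x) (mu * mu) => a b c; lra.
Qed.

Lemma real_complexV (r : R) : r^-1%:C = (r%:C)^-1.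
Proof. exact: fmorphV. Qed.

Lemma Re_mulr (r : R) (z : R[i]) : complex.Re (r%:C * z) = r * complex.Re z.
Proof. by case: z => a b /=; rewrite mul0r subr0. Qed.

Lemma Im_mulr (r : R) (z : R[i]) : complex.Im (r%:C * z) = r * complex.Im z.
Proof. by case: z => a b /=; rewrite mul0r addr0. Qed.

Lemma Re_addr (u v : R[i]) : complex.Re (u + v) = complex.Re u + complex.Re v.
Proof. by case: u v => ? ? []. Qed.

Lemma Im_addr (u v : R[i]) : complex.Im (u + v) = complex.Im u + complex.Im v.
Proof. by case: u v => ? ? []. Qed.

Lemma cexp_real (r : R) : cexp r%:C = (expR r)%:C.
Proof. by rewrite /cexp/= cos0 sin0 mulr1 mulr0. Qed.

Lemma cpow_real (x r : R) : cpow x r%:C = (expR (r * ln x))%:C.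
Proof. by rewrite /cpow -rmorphM cexp_real. Qed.

Lemma whittaker_potential mu m x :
  (- 4%:R^-1 + mu%:C / x%:C + (4%:R^-1 - (0 +i* m) ^+ 2) / (x ^+ 2)%:C : R[i]) = (whittQ mu m x)%:C.
Proof.
rewrite /whittQ !rmorphD rmorphN !rmorphM rmorphD !fmorphV rmorph_nat.
have -> : (0 +i* m) ^+ 2 = - (m ^+ 2)%:C by apply/eqP; rewrite eq_complex/= expr2/=; apply/andP; split; apply/eqP; ring.
by rewrite opprK -(rmorphM _ x x).
Qed.

Lemma is_whittakerW_whitt mu m : mu < 1 / 2 ->
  is_whittakerW mu%:C (0 +i* m) (fun x => (whitt mu m x)%:C).
Proof.
move=> hmu; have dw x := @is_derive_whitt mu m x hmu; have dw1 x := @is_derive_whitt1 mu m x hmu.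
have dd := second_derivative_pos dw dw1.
have d0 (x : R) : is_derive x 1 (fun=> 0 : R) 0 by exact: is_derive_cst.
have e0 : (fun=> 0 : R)^`()%classic = (fun=> 0) by apply/funext => x; exact: is_derive_derive1.
split.
  move=> x x0; split.
  - by split; [exact: is_derive_derivable (dw x x0)|exact: is_derive_derivable (d0 x)].
  - split; first exact: is_derive_derivable (dd x x0).
    by rewrite /cderive/= e0; exact: is_derive_derivable (d0 x).
  - rewrite whittaker_potential -rmorphM /cderive/= e0 (is_derive_derive1 (dd x x0)) (is_derive_derive1 (d0 x)).
    by apply/eqP; rewrite eq_complex/= addNr addr0 eqxx.
have eq x : (whitt mu m x)%:C / ((expR (- (x / 2)))%:C * cpow x mu%:C) =
    (whitt mu m x / expR (mu * ln x - x / 2))%:C.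
  by rewrite cpow_real -rmorphM -expRD -real_complexV -rmorphM [- _ + _]addrC.
split; under eq_fun do rewrite eq /=; [exact: cvg_whitt|exact: cvg_cst].
Qed.

(** Subtracting l times [whitt] leaves a solution negligible with respect to [whitt], so
    [recessive_unique] applies. The limit l stays free because the real part of a complex solution
    is used with l = 1 and the imaginary part with l = 0. *)
Lemma whittaker_real_unique mu m (w : R -> R) : mu < 1 / 2 ->
  (forall x, 0 < x -> derivable w x 1) -> (forall x, 0 < x -> derivable (w^`()%classic) x 1) ->
  (forall x, 0 < x -> (w^`())^`()%classic x + whittQ mu m x * w x = 0) ->
  forall l : R, w x / expR (mu * ln x - x / 2) @[x --> +oo] --> l ->
  forall x, 0 < x -> w x = l * whitt mu m x.
Proof.
move=> hmu dw dw1 ode l wl x x0; apply/eqP; rewrite -subr_eq0; apply/eqP.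
have W1 x := @is_derive_whitt mu m x hmu; have W2 x := @is_derive_whitt1 mu m x hmu.
have V1 (y : R) : 0 < y -> is_derive y 1 w (w^`()%classic y).
  by move=> y0; rewrite derive1E; apply: derivableP; exact: dw.
have V2 (y : R) : 0 < y -> is_derive y 1 (w^`()%classic) (- (whittQ mu m y * w y)).
  move=> y0; have := ode y y0; rewrite derive1E => /eqP; rewrite addr_eq0 => /eqP <-.
  by apply: derivableP; exact: dw1.
apply: (@recessive_unique _ (whittQ mu m) (fun y => w y - l * whitt mu m y)
  (fun y => w^`()%classic y - l * whitt1 mu m y) (whitt mu m) (whitt1 mu m)
  (fun y => expR (mu * ln y - y / 2)) (expR (2 * mu ^+ 2))) => //.
- move=> y y0; apply: (@hasd_eq _ _ _ (w^`()%classic y + - (0 * whitt mu m y + l * whitt1 mu m y))); last by ring.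
  by apply: hasd_add; [exact: V1|apply: hasd_opp; apply: hasd_mul; [exact: hasd_cst|exact: W1]].
- move=> y y0; apply: (@hasd_eq _ _ _ (- (whittQ mu m y * w y) + - (0 * whitt1 mu m y + l * - (whittQ mu m y * whitt mu m y)))); last by ring.
  by apply: hasd_add; [exact: V2|apply: hasd_opp; apply: hasd_mul; [exact: hasd_cst|exact: W2]].
- by move=> a a0; exact: whittQ_bounded.
- by move=> y; exact: expR_gt0.
- by move=> y; exact: whitt_weight_le.
- under eq_fun do rewrite mulrBl -mulrA.
  have el : l - l * 1 = 0 by rewrite mulr1 subrr.
  rewrite -el; apply: cvgB => //; apply: cvgM; [exact: cvg_cst|exact: cvg_whitt].
- exact: cvg_whitt.
Qed.

(** [is_whittakerW_whitt] shows that the choice made by [xget] is a genuine solution. The potential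
    is real, so the equation splits into one for the real and one for the imaginary part. *)
Lemma whittakerW_whitt mu m x : mu < 1 / 2 -> 0 < x ->
  whittakerW mu%:C (0 +i* m) x = (whitt mu m x)%:C.
Proof.
move=> hmu x0; rewrite /whittakerW.
have : is_whittakerW mu%:C (0 +i* m) (xget (fun=> 0) [set w | is_whittakerW mu%:C (0 +i* m) w]).
  by apply: (@xgetPex _ _ [set w | is_whittakerW mu%:C (0 +i* m) w]); exists (fun x => (whitt mu m x)%:C); exact: is_whittakerW_whitt.
move: (xget _ _) => w [dw [wRe wIm]].
have eqq (y : R) : (expR (- (y / 2)))%:C * cpow y mu%:C = (expR (mu * ln y - y / 2))%:C.
  by rewrite cpow_real -rmorphM -expRD addrC.
have qE (y : R) : w y / ((expR (- (y / 2)))%:C * cpow y mu%:C) =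
    ((expR (mu * ln y - y / 2))^-1)%:C * w y.
  by rewrite eqq real_complexV mulrC.
have odeE (y : R) : 0 < y -> and
    (((fun t => complex.Re (w t))^`())^`()%classic y + whittQ mu m y * complex.Re (w y) = 0)
    (((fun t => complex.Im (w t))^`())^`()%classic y + whittQ mu m y * complex.Im (w y) = 0).
  move=> y0; have [_ _] := dw y y0; rewrite whittaker_potential => /eqP.
  rewrite eq_complex => /andP[/eqP + /eqP]; rewrite Re_addr Im_addr Re_mulr Im_mulr.
  by rewrite /cderive [complex.Re (_ +i* _)]/= [complex.Im (_ +i* _)]/= => h1 h2; split.
have d1Re (y : R) : 0 < y -> derivable (fun t => complex.Re (w t)) y 1.
  by move=> y0; have [[h _] _ _] := dw y y0.
have d1Im (y : R) : 0 < y -> derivable (fun t => complex.Im (w t)) y 1.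
  by move=> y0; have [[_ h] _ _] := dw y y0.
have d2Re (y : R) : 0 < y -> derivable ((fun t => complex.Re (w t))^`()%classic) y 1.
  by move=> y0; have [_ [h _] _] := dw y y0; move: h; rewrite /cderive /=.
have d2Im (y : R) : 0 < y -> derivable ((fun t => complex.Im (w t))^`()%classic) y 1.
  by move=> y0; have [_ [_ h] _] := dw y y0; move: h; rewrite /cderive /=.
have o1 (y : R) (y0 : 0 < y) := proj1 (odeE y y0).
have o2 (y : R) (y0 : 0 < y) := proj2 (odeE y y0).
have lRe : complex.Re (w x) / expR (mu * ln x - x / 2) @[x --> +oo] --> (1 : R).
  by move: wRe; under eq_fun do rewrite qE Re_mulr mulrC.
have lIm : complex.Im (w x) / expR (mu * ln x - x / 2) @[x --> +oo] --> (0 : R).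
  by move: wIm; under eq_fun do rewrite qE Im_mulr mulrC.
have Re1 := whittaker_real_unique hmu d1Re d2Re o1 lRe x0.
have Im0 := whittaker_real_unique hmu d1Im d2Im o2 lIm x0.
by apply/eqP; rewrite eq_complex/= Re1 Im0 mul1r mul0r !eqxx.
Qed.

End Whittaker.

(** * Bound by contour shift *)

Section StripShift.
Context {R : realType}.
Local Notation lam := (@lebesgue_measure R).

Lemma is_derive_Rintegral (F D : R -> R -> R) (g : R -> R) (lo hi th : R) :
  lo < th < hi ->
  (forall s : R, lo < s < hi -> lam.-integrable setT (EFin \o F s)) ->
  (forall s v : R, lo < s < hi -> is_derive s 1 (fun s => F s v) (D s v)) ->
  lam.-integrable setT (EFin \o g) ->
  (forall s v : R, lo < s < hi -> `|D s v| <= g v) ->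
  is_derive th 1 (fun s => \int[lam]_v F s v) (\int[lam]_v D th v).
Proof.
move=> thI iF dF ig Dg.
have g0 y : 0 <= g y by exact: le_trans (normr_ge0 _) (Dg th y thI).
have Ith : `]lo, hi[%classic th by rewrite /= in_itv.
have I1 x : `]lo, hi[%classic x -> lam.-integrable setT (EFin \o F x).
  by rewrite /= in_itv/=; exact: iF.
have I2 x y : `]lo, hi[%classic x -> [set: R] y -> derivable (F ^~ y) x 1.
  by rewrite /= in_itv/= => xI _; exact: is_derive_derivable (dF x y xI).
have pE x y : lo < x < hi -> partial1of2 F x y = D x y.
  by move=> xI; rewrite /partial1of2; exact: is_derive_derive1 (dF x y xI).
have I3 x y : `]lo, hi[%classic x -> [set: R] y -> `|partial1of2 F x y| <= g y.
  by rewrite /= in_itv/= => xI _; rewrite pE//; exact: Dg.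
have H1 := @derivable_under_integral R _ (measurableTypeR R) lam F setT measurableT th lo hi Ith I1 I2 g g0 ig I3.
have H2 := @differentiation_under_integral R _ (measurableTypeR R) lam F setT measurableT th lo hi Ith I1 I2 g g0 ig I3.
have <- : \int[lam]_y partial1of2 F th y = \int[lam]_y D th y.
  by apply: eq_Rintegral => y _; rewrite pE.
by rewrite -H2 derive1E; exact: derivableP.
Qed.

(* Cauchy's theorem on a strip: [F + i G'] is holomorphic when d F / d th = d G / d v. *)
Lemma strip_shift (F G D : R -> R -> R) (g : R -> R) (lo hi th0 th1 : R) :
  lo < th0 -> th0 <= th1 -> th1 < hi ->
  (forall th : R, lo < th < hi -> lam.-integrable setT (EFin \o F th)) ->
  (forall th v : R, lo < th < hi -> is_derive th 1 (fun s => F s v) (D th v)) ->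
  (forall th v : R, lo < th < hi -> is_derive v 1 (G th) (D th v)) ->
  (forall th : R, lo < th < hi -> continuous (D th)) ->
  lam.-integrable setT (EFin \o g) ->
  (forall th v : R, lo < th < hi -> `|D th v| <= g v) ->
  (forall th : R, lo < th < hi -> G th x @[x --> +oo] --> (0 : R) /\ G th x @[x --> -oo] --> (0 : R)) ->
  \int[lam]_v F th0 v = \int[lam]_v F th1 v.
Proof.
move=> lo0 th01 hi1 iF dF dG cD ig Dg G0.
have in0 th : th0 <= th <= th1 -> lo < th < hi.
  by move=> /andP[h1 h2]; rewrite (lt_le_trans lo0 h1) (le_lt_trans h2 hi1).
apply: (@is_derive0_eq _ (fun th => \int[lam]_v F th v)) => // th /in0 thI.
suff <- : \int[lam]_y D th y = 0 by exact: is_derive_Rintegral thI iF dF ig Dg.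
have [Gy Gny] := G0 th thI.
have iD : lam.-integrable setT (EFin \o D th).
  apply: (@integrable_le_norm _ (measurableTypeR R) R lam _ g) => //.
    by apply: continuous_measurable_fun; exact: cD.
  by move=> v; exact: Dg.
by rewrite /Rintegral (integral_derive (fun v => dG th v thI) (cD th thI) iD Gy Gny) subrr.
Qed.

Lemma cosh_ge (v : R) : expR `|v| / 2 <= cosh v.
Proof.
rewrite /cosh ler_pM2r ?invr_gt0//; have := expR_gt0 v; have := expR_gt0 (- v).
by have [v0|v0] := leP 0 v; rewrite ?(ger0_norm v0) ?(ltr0_norm v0); lra.
Qed.

Lemma cosh_le (v : R) : cosh v <= expR `|v|.
Proof.
have h : expR v <= expR `|v| by rewrite ler_expR ler_norm.
have h' : expR (- v) <= expR `|v| by rewrite ler_expR -normrN ler_norm.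
by rewrite /cosh; lra.
Qed.

Lemma norm_sinh_le (v : R) : `|sinh v| <= expR `|v|.
Proof.
have h : expR v <= expR `|v| by rewrite ler_expR ler_norm.
have h' : expR (- v) <= expR `|v| by rewrite ler_expR -normrN ler_norm.
have := expR_gt0 v; have := expR_gt0 (- v).
by rewrite /sinh ler_norml; lra.
Qed.

Lemma cosh_gt0 (v : R) : 0 < cosh v.
Proof. by apply: lt_le_trans (cosh_ge v); rewrite divr_gt0// expR_gt0. Qed.

Lemma hasd_cosh (v : R) : hasd (@cosh R) v (sinh v).
Proof. by eapply hasd_eq; [rewrite /cosh; deriv|rewrite /sinh/=; genatoms; lra]. Qed.

Lemma hasd_sinh (v : R) : hasd (@sinh R) v (cosh v).
Proof. by eapply hasd_eq; [rewrite /sinh; deriv|rewrite /cosh/=; genatoms; lra]. Qed.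

(** This is [linear_le_expR] at ln (kap / 2) + |v|. The constant is e^(k ^ 2) (kap / 2) ^ (- k), so
    a slow decay rate k costs only a small negative power of kap. *)
Lemma expN_cosh_le (kap k v : R) : 0 < kap -> 0 <= k ->
  expR (- (kap * cosh v)) <= expR (k ^+ 2 - k * ln (kap / 2)) * expR (- (k * `|v|)).
Proof.
move=> kap0 k0; rewrite -expRD ler_expR.
have h0 : 0 < kap / 2 by rewrite divr_gt0.
have := linear_le_expR (ln (kap / 2) + `|v|) k0; rewrite expRD lnK ?posrE//.
have : kap * (expR `|v| / 2) <= kap * cosh v by rewrite ler_wpM2l ?cosh_ge// ltW.
rewrite mulrDr => h1; have -> : kap / 2 * expR `|v| = kap * (expR `|v| / 2) by ring.
by move: h1; move: (kap * cosh v) (kap * _) (k * ln _) (k * `|v|) => x y z w; lra.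
Qed.

Lemma integrable_expN_cosh (kap : R) : 0 < kap ->
  lam.-integrable setT (EFin \o (fun v => expR (- (kap * cosh v)))).
Proof.
move=> kap0; apply: (@integrable_le_expNabs _ _ 1 (expR (1 ^+ 2 - 1 * ln (kap / 2)))) => //.
  apply: measurable_fun_expf; apply: measurable_fun_oppf; apply: measurable_fun_mulf => //.
  by rewrite /cosh; meas.
by move=> v; rewrite ger0_norm ?expR_ge0//; apply: expN_cosh_le.
Qed.

Lemma strip_ring1 (b q s e c1 s1 x y cs sn : R) :
  (- (0 * s + b * 1) - ((0 * cs + 2 * q * - (1 * sn)) * x + 2 * q * cs * 0)) * e * c1 +
  e * - ((0 - ((0 * sn + 2 * q * (1 * cs)) * y + 2 * q * sn * 0)) * s1) =
  e * ((- b + 2 * q * sn * x) * c1 + 2 * q * cs * y * s1).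
Proof. ring. Qed.

(** Twice the modified Bessel function K of index i b at 2 q. *)
Definition bess (b q : R) := \int[lam]_v (expR (- (2 * q * cosh v)) * cos (b * v)).

(* Along v + i th the modulus of the integrand of [bess] gains the factor
   exp (- b th). *)
Lemma bess_le (b q th : R) : 0 <= b -> 0 < q -> 0 <= th < pi / 2 ->
  `|bess b q| <= expR (- (b * th)) * \int[lam]_v expR (- (2 * q * cos th * cosh v)).
Proof.
move=> b0 q0 /andP[t0 t1].
(* The open strip |s| < hi contains the heights 0 and th, and cos s >= cos hi > 0 on it. *)
pose hi := (th + pi / 2) / 2.
have thi : th < hi by rewrite /hi; lra.
have hi0 : 0 < hi by exact: le_lt_trans thi.
have hi1 : hi < pi / 2 by rewrite /hi; lra.
have chi0 : 0 < cos hi by apply: cos_gt0_pihalf; lra.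
have chi s : - hi < s < hi -> cos hi <= cos s.
  move=> /andP[h1 h2]; rewrite -(cos_norm s) ltW// ltr_cos ?in_itv/=.
  - by rewrite ltr_norml h1 h2.
  - have nl : `|s| < hi by rewrite ltr_norml h1 h2.
    by rewrite normr_ge0/=; have := @pi_gt0 R; lra.
  - by apply/andP; split; [exact: ltW|have := @pi_gt0 R; lra].
(* Modulus and phase of exp (i b w - 2 q cosh w) at w = v + i s, from cosh w = cosh v cos s + i sinh
   v sin s. [F] is the real part, [G] minus the imaginary part, and [D] their common derivative, in
   s and in v respectively. *)
pose A s v := expR (- (b * s) - 2 * q * cos s * cosh v).
pose ph s v := b * v - 2 * q * sin s * sinh v.
pose F s v := A s v * cos (ph s v).
pose G s v := - (A s v * sin (ph s v)).
pose D s v := A s v * ((- b + 2 * q * sin s * cosh v) * cos (ph s v) + 2 * q * cos s * sinh v * sin (ph s v)).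
pose kap := 2 * q * cos hi.
have kap0 : 0 < kap by rewrite !mulr_gt0.
(* The rate k = 2 in [expN_cosh_le] leaves e^(- |v|) after the growth e^|v| of cosh and sinh in [D]
   has been absorbed. *)
pose C := expR (2 ^+ 2 - 2 * ln (kap / 2)).
have C0 : 0 <= C by exact: expR_ge0.
have A_le s v : - hi < s < hi -> A s v <= expR (b * hi) * C * expR (- (2 * `|v|)).
  move=> sI; rewrite -mulrA.
  apply: (@le_trans _ _ (expR (b * hi) * expR (- (kap * cosh v)))); last first.
    by rewrite ler_wpM2l ?expR_ge0// expN_cosh_le.
  rewrite /A expRD; apply: ler_pM; rewrite ?expR_ge0// ler_expR.
    by rewrite -mulrN ler_wpM2l//; move: sI => /andP[]; lra.
  by rewrite lerN2 /kap ler_wpM2r ?(ltW (cosh_gt0 v))// ler_wpM2l ?chi// mulr_ge0// ltW.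
have A0 s v : 0 <= A s v by exact: expR_ge0.
have mc : measurable_fun setT (@cosh R) by rewrite /cosh; meas.
have ms : measurable_fun setT (@sinh R) by rewrite /sinh; meas.
have mF s : measurable_fun setT (F s) by rewrite /F /A /ph; meas.
have iF s : - hi < s < hi -> lam.-integrable setT (EFin \o F s).
  move=> sI; apply: (@integrable_le_expNabs _ _ 2 (expR (b * hi) * C)) => // v.
  rewrite /F normrM (ger0_norm (A0 _ _)) -[leRHS]mulr1.
  by apply: ler_pM => //; [exact: A_le|exact: cos_max].
have D1 (s v : R) : - hi < s < hi -> is_derive s 1 (fun s => F s v) (D s v).
  move=> _; eapply hasd_eq; first by rewrite /F /A /ph; deriv.
  rewrite /D /A /ph/=; move: (expR _) => e; move: (cos (_ - _)) (sin (_ - _)) => c1 s1.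
  by move: (cosh v) (sinh v) (cos s) (sin s) => x y cs sn; exact: strip_ring1.
have dA (s v : R) : hasd (A s) v (- (2 * q * cos s * sinh v) * A s v).
  eapply hasd_eq.
    rewrite /A; eapply hasd_exp; eapply hasd_add; first exact: hasd_cst.
    eapply hasd_opp; eapply hasd_mul; [exact: hasd_cst|exact: hasd_cosh].
  by rewrite /A /=; move: (expR _) => e; move: (cosh v) (sinh v) (cos s) => *; ring.
have dph (s v : R) : hasd (ph s) v (b - 2 * q * sin s * cosh v).
  eapply hasd_eq.
    eapply (@hasd_add _ (fun v => b * v)).
      by eapply hasd_mul; [exact: hasd_cst|exact: hasd_id].
    eapply hasd_opp; eapply hasd_mul; [exact: hasd_cst|exact: hasd_sinh].
  rewrite /=; move: (cosh v) (sinh v) (sin s) => *; ring.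
have D2 (s v : R) : - hi < s < hi -> is_derive v 1 (G s) (D s v).
  move=> _; eapply hasd_eq.
    rewrite /G; eapply hasd_opp; eapply hasd_mul; [exact: dA|].
    by eapply hasd_sin; exact: dph.
  by rewrite /D /=; move: (A s v) (cos (ph _ _)) (sin (ph _ _)) => *; ring.
have cD s : - hi < s < hi -> continuous (D s).
  move=> _ v; eapply hasd_continuous; rewrite /D.
  eapply hasd_mul; first exact: dA.
  eapply hasd_add; eapply hasd_mul.
  - eapply hasd_add; first exact: hasd_cst.
    by eapply hasd_mul; [exact: hasd_cst|exact: hasd_cosh].
  - by eapply hasd_cos; exact: dph.
  - by eapply hasd_mul; [exact: hasd_cst|exact: hasd_sinh].
  - by eapply hasd_sin; exact: dph.
pose g (v : R) := expR (b * hi) * C * (b + 4 * q) * expR (- (1 * `|v|)).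
have ig : lam.-integrable setT (EFin \o g).
  by apply: integrable_mulC; exact: integrable_expNabs.
have Dg (s v : R) : - hi < s < hi -> `|D s v| <= g v.
  move=> sI; rewrite /D normrM (ger0_norm (A0 _ _)).
  have hE : 1 <= expR `|v| by rewrite -expR0 ler_expR.
  have hx : `|(- b + 2 * q * sin s * cosh v) * cos (ph s v) + 2 * q * cos s * sinh v * sin (ph s v)| <= (b + 4 * q) * expR `|v|.
    apply: le_trans (ler_normD _ _) _; rewrite !normrM.
    have q2 : 0 <= 2 * q by rewrite mulr_ge0// ltW.
    have n1 : `|- b + 2 * q * sin s * cosh v| <= b + 2 * q * expR `|v|.
      apply: le_trans (ler_normD _ _) _; rewrite normrN (ger0_norm b0) lerD2l.
      rewrite normrM (ger0_norm (ltW (cosh_gt0 v))) normrM (ger0_norm q2).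
      apply: ler_pM; [by rewrite mulr_ge0|exact: ltW (cosh_gt0 v)| |exact: cosh_le].
      by rewrite ler_piMr// sin_max.
    have n2 : `|2| * `|q| * `|cos s| * `|sinh v| <= 2 * q * expR `|v|.
      rewrite -normrM (ger0_norm q2); apply: ler_pM => //; [by rewrite mulr_ge0| |exact: norm_sinh_le].
      by rewrite ler_piMr// cos_max.
    have n3 : `|- b + 2 * q * sin s * cosh v| * `|cos (ph s v)| <= b + 2 * q * expR `|v|.
      by apply: le_trans n1; rewrite ler_piMr// cos_max.
    have n4 : `|2| * `|q| * `|cos s| * `|sinh v| * `|sin (ph s v)| <= 2 * q * expR `|v|.
      by apply: le_trans n2; rewrite ler_piMr ?sin_max// !mulr_ge0.
    have n5 : b <= b * expR `|v| by rewrite ler_peMr.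
    move: n3 n4 n5; rewrite ?normrM; move: (_ * `|cos (ph s v)|) (_ * `|sin (ph s v)|) (expR `|v|) => x y e; lra.
  have -> : g v = expR (b * hi) * C * expR (- (2 * `|v|)) * ((b + 4 * q) * expR `|v|).
    rewrite /g; have -> : expR (- (1 * `|v|)) = expR (- (2 * `|v|)) * expR `|v|.
      by rewrite -expRD; congr expR; ring.
    by rewrite mulrACA.
  by apply: ler_pM => //; exact: A_le.
have GG (s : R) : - hi < s < hi -> G s x @[x --> +oo] --> (0 : R) /\ G s x @[x --> -oo] --> (0 : R).
  move=> sI; apply: (@cvg0_expNabs _ _ 2 (expR (b * hi) * C)) => // v.
  rewrite /G normrN normrM (ger0_norm (A0 _ _)) -[leRHS]mulr1.
  by apply: ler_pM => //; [exact: A_le|exact: sin_max].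
have lo0 : - hi < 0 by rewrite oppr_lt0.
have := @strip_shift F G D g (- hi) hi 0 th lo0 t0 thi iF D1 D2 cD ig Dg GG.
have -> : \int[lam]_v F 0 v = bess b q.
  apply: eq_Rintegral => v _; rewrite /F /A /ph sin0 cos0.
  by congr (expR _ * cos _); ring.
move=> ->; have thI : - hi < th < hi by rewrite thi andbT (lt_le_trans lo0).
apply: (le_trans (le_normr_Rintegral measurableT (iF th thI))).
have ic : lam.-integrable setT (EFin \o (fun v => expR (- (2 * q * cos th * cosh v)))).
  apply: integrable_expN_cosh; rewrite !mulr_gt0//; apply: cos_gt0_pihalf.
  by rewrite t1 andbT; lra.
rewrite -RintegralZl//.
apply: le_Rintegral => //.
- by have := integrable_norm (iF th thI).
- exact: integrable_mulC.
move=> v _; rewrite /F normrM (ger0_norm (A0 _ _)).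
rewrite -expRD -/(A th v) -[leRHS]mulr1.
by apply: ler_pM => //; exact: cos_max.
Qed.

End StripShift.

(** * Bounds for the double integral *)

Section TricomiBound.
Context {R : realType}.
Local Notation lam := (@lebesgue_measure R).
Local Notation lam2 := (lam \x lam)%E.

Lemma measurable_shear (f : R * R -> R) :
  measurable_fun setT (f : measurableTypeR R * measurableTypeR R -> R) ->
  measurable_fun setT ((fun p => f (p.1, p.2 - p.1)) : measurableTypeR R * measurableTypeR R -> R).
Proof.
move=> mf; apply: (measurableT_comp mf).
apply: measurable_fun_pair => /=; first exact: measurable_fst.
by apply: measurable_fun_addf; [exact: measurable_sndR|apply: measurable_fun_oppf; exact: measurable_fstR].
Qed.

Lemma measurable_section1 (f : R * R -> R) (x : R) :
  measurable_fun setT (f : measurableTypeR R * measurableTypeR R -> R) ->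
  measurable_fun setT (fun y : R => f (x, y)).
Proof. by move=> mf; exact: measurableT_comp mf (pair1_measurable x). Qed.

Lemma measurable_section2 (f : R * R -> R) (y : R) :
  measurable_fun setT (f : measurableTypeR R * measurableTypeR R -> R) ->
  measurable_fun setT (fun x : R => f (x, y)).
Proof. by move=> mf; exact: measurableT_comp mf (pair2_measurable y). Qed.

Lemma integrable_shear (f : R * R -> R) : lam2.-integrable setT (EFin \o f) ->
  lam2.-integrable setT (EFin \o (fun p => f (p.1, p.2 - p.1))).
Proof.
move=> If; have mf : measurable_fun setT (f : measurableTypeR R * measurableTypeR R -> R).
  by apply/measurable_EFinP; exact: measurable_int If.
apply/integrable12ltyP; first by apply/measurable_EFinP; exact: measurable_shear.
have H : (\int[lam]_x \int[lam]_y `|(f (x, y))%:E| < +oo)%E.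
  by apply/(@integrable12ltyP _ _ _ _ R lam lam (EFin \o f)) => //; apply/measurable_EFinP.
apply: le_lt_trans H; rewrite le_eqVlt; apply/orP; left; apply/eqP.
apply: eq_integral => x _ /=.
rewrite -(@ge0_integral_shift _ (- x) (fun y => `|f (x, y)|%:E))//.
by apply/measurable_EFinP; apply: measurableT_comp => //; exact: measurable_section1.
Qed.

Lemma integral_shear_section (f : R * R -> R) (p : R) :
  measurable_fun setT (f : measurableTypeR R * measurableTypeR R -> R) ->
  (\int[lam]_x (f (x, p - x))%:E = \int[lam]_v (f (v + p / 2, p / 2 - v))%:E)%E.
Proof.
move=> mf; rewrite -(@integral_shift _ (p / 2) (fun x => (f (x, p - x))%:E)).
  by apply: eq_integral => v _; congr ((f (_, _))%:E); lra.
apply/measurable_EFinP.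
exact: (@measurable_section2 (fun p => f (p.1, p.2 - p.1)) p (measurable_shear mf)).
Qed.

(** The coordinates p = x + y and v = (x - y) / 2 are reached by a shear and a translation, so that
    only translation invariance in one variable is used. *)
Lemma Rintegral_shear (f : R * R -> R) : lam2.-integrable setT (EFin \o f) ->
  ((\int[lam2]_p f p)%R%:E =
    \int[lam]_p \int[lam]_v (f (v + p / 2, p / 2 - v))%:E)%E.
Proof.
move=> If; have mf : measurable_fun setT (f : measurableTypeR R * measurableTypeR R -> R).
  by apply/measurable_EFinP; exact: measurable_int If.
have Is := integrable_shear If.
transitivity ((\int[lam2]_p f (p.1, p.2 - p.1))%:E).
  rewrite (Rintegral_prod1 If) (Rintegral_prod1 Is).
  apply: eq_integral => x _ /=; apply/esym.
  apply: (@integral_shift _ (- x) (fun y => (f (x, y))%:E)).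
  by apply/measurable_EFinP; exact: measurable_section1.
rewrite (Rintegral_prod2 Is); apply: eq_integral => p _ /=.
exact: integral_shear_section.
Qed.

(** In these coordinates e^x + e^y = 2 e^(p / 2) cosh v, while the coupling term depends on p alone;
    the v-integral is therefore a Bessel function. *)
Lemma tric_section (a m z p : R) :
  (\int[lam]_v (gker a (v + p / 2) * gker a (p / 2 - v) * ucos m z (v + p / 2, p / 2 - v))%:E =
    (expR (a * p - z * expR p) * bess (2 * m) (expR (p / 2)))%:E)%E.
Proof.
have mc : measurable_fun setT (@cosh R) by rewrite /cosh; meas.
have k0 : 0 < 2 * expR (p / 2) by rewrite mulr_gt0// expR_gt0.
have Ib : lam.-integrable setT (EFin \o (fun v => expR (- (2 * expR (p / 2) * cosh v)) * cos (2 * m * v))).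
  apply: (@integrable_le_norm _ (measurableTypeR R) R lam _ _ _ (integrable_expN_cosh k0)).
    by meas.
  by move=> v; rewrite normrM (ger0_norm (expR_ge0 _)) ler_piMr ?expR_ge0// cos_max.
rewrite EFinM /bess (EFin_Rintegral Ib) -(integralZl measurableT Ib).
apply: eq_integral => v _ /=; rewrite -EFinM; congr EFin.
rewrite /gker /ucos/=.
have -> : v + p / 2 + (p / 2 - v) = p by lra.
have -> : v + p / 2 - (p / 2 - v) = 2 * v by lra.
rewrite !mulrA -!expRD (mulrC 2 m); congr (expR _ * _).
rewrite /cosh !expRD expRN; have e0 : expR v != 0 by rewrite gt_eqF// expR_gt0.
by move: (expR (p / 2)) (expR v) (expR p) e0 => x y w e0; field.
Qed.

Lemma tric_bess (a m z : R) : 0 < a -> 0 <= z ->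
  ((tric a m z)%:E = \int[lam]_p (expR (a * p - z * expR p) * bess (2 * m) (expR (p / 2)))%:E)%E.
Proof.
move=> a0 z0; rewrite /tric (Rintegral_shear (integrable_ucos m a0 a0 z0)).
by apply: eq_integral => p _; exact: tric_section.
Qed.

(** Measurability is read off from Fubini's theorem: the function is the section integral of the
    sheared integrand. *)
Lemma measurable_tric_bess (a m z : R) : 0 < a -> 0 <= z ->
  measurable_fun setT (fun p : R => (expR (a * p - z * expR p) * bess (2 * m) (expR (p / 2)))%:E).
Proof.
move=> a0 z0; have If := integrable_ucos m a0 a0 z0.
have mf : measurable_fun setT ((fun p => gker a p.1 * gker a p.2 * ucos m z p) : measurableTypeR R * measurableTypeR R -> R).
  by apply/measurable_EFinP; exact: measurable_int If.
have := measurable_fubini_G (integrable_shear If); congr measurable_fun.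
by apply/funext => p; exact: etrans (integral_shear_section p mf) (tric_section a m z p).
Qed.

(* The constant is uniform in m, and the exponent of x is below a because
   [bess] has a logarithmic singularity at 0. *)
Lemma tric_le (a eps th : R) : 0 < eps -> eps < a -> 0 <= th < pi / 2 ->
  exists2 C, 0 <= C & forall m x, 0 <= m -> 0 < x ->
    `|tric a m x^-1| <= C * expR (- (2 * m * th)) * expR ((a - eps) * ln x).
Proof.
move=> e0 ea tI; have /andP[t0 t1] := tI.
have ct : 0 < cos th by apply: cos_gt0_pihalf; rewrite t1 andbT; lra.
(* With kap = 2 e^(p / 2) cos th, the factor kap ^ (- k) of [expN_cosh_le] becomes a multiple of
   e^(- eps p). *)
pose k := 2 * eps; have k0 : 0 < k by rewrite mulr_gt0.
pose J := \int[lam]_v expR (- (k * `|v|)).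
have J0 : 0 <= J by apply: Rintegral_ge0 => v _; exact: expR_ge0.
pose K := expR (k ^+ 2 - k * ln (cos th)) * J.
have K0 : 0 <= K by rewrite mulr_ge0// expR_ge0.
have ae0 : 0 < a - eps by lra.
exists (K * gam (a - eps)); first exact: mulr_ge0 K0 (ltW (gam_gt0 ae0)).
move=> m x m0 x0; have a0 : 0 < a by lra.
have z0 : 0 <= x^-1 by rewrite invr_ge0 ltW.
have m20 : 0 <= 2 * m by rewrite mulr_ge0.
pose E p := expR (a * p - x^-1 * expR p).
have bb p : `|bess (2 * m) (expR (p / 2))| <= expR (- (2 * m * th)) * (K * expR (- (eps * p))).
  have q0 : 0 < expR (p / 2) by exact: expR_gt0.
  apply: le_trans (bess_le m20 q0 tI) _; rewrite ler_wpM2l ?expR_ge0//.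
  have kap0 : 0 < 2 * expR (p / 2) * cos th by rewrite !mulr_gt0.
  have -> : K * expR (- (eps * p)) = \int[lam]_v (expR (k ^+ 2 - k * ln (2 * expR (p / 2) * cos th / 2)) * expR (- (k * `|v|))).
    rewrite RintegralZl//; last exact: integrable_expNabs.
    rewrite /K -/J mulrAC; congr (_ * J); rewrite -expRD; congr expR.
    have -> : 2 * expR (p / 2) * cos th / 2 = expR (p / 2) * cos th by field.
    by rewrite lnM ?posrE// expRK /k; move: (ln _) => l; lra.
  apply: le_Rintegral => //.
  - exact: integrable_expN_cosh.
  - by apply: integrable_mulC; exact: integrable_expNabs.
  - by move=> v _; apply: expN_cosh_le => //; exact: ltW.
have mG : measurable_fun setT (fun p : R => (E p * bess (2 * m) (expR (p / 2)))%:E).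
  exact: measurable_tric_bess.
rewrite -lee_fin -abse_EFin (tric_bess m a0 z0).
have H := le_abse_integral lam measurableT mG. apply: (le_trans H).
pose c := expR (- (2 * m * th)) * K.
apply: (@le_trans _ _ (\int[lam]_p (c * expR ((a - eps) * p - x^-1 * expR p))%:E)%E).
  apply: ge0_le_integral => //.
  - by apply: measurableT_comp.
  - by apply/measurable_EFinP; meas.
  - move=> p _ /=; rewrite lee_fin normrM (ger0_norm (expR_ge0 _)).
    apply: (@le_trans _ _ (E p * (expR (- (2 * m * th)) * (K * expR (- (eps * p)))))).
      by rewrite ler_wpM2l ?expR_ge0.
    rewrite /c /E le_eqVlt; apply/orP; left; apply/eqP.
    have -> : (a - eps) * p - x^-1 * expR p = (a * p - x^-1 * expR p) + - (eps * p) by ring.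
    by rewrite (expRD (a * p - _)); move: (expR (a * p - _)) (expR (- (eps * p))) (expR (- (2 * m * th))) => u v w; ring.
(* Translating p by ln x pulls out x ^ (a - eps) and leaves the integral of Gamma at a - eps. *)
rewrite -(@ge0_integral_shift _ (ln x) (fun p => (c * expR ((a - eps) * p - x^-1 * expR p))%:E)); first last.
- by move=> p; rewrite lee_fin mulr_ge0 ?expR_ge0// mulr_ge0 ?expR_ge0.
- by apply/measurable_EFinP; meas.
under eq_integral => p _.
  have -> : c * expR ((a - eps) * (p + ln x) - x^-1 * expR (p + ln x)) =
      c * expR ((a - eps) * ln x) * gker (a - eps) p.
    rewrite /gker -mulrA -expRD expRD lnK ?posrE//; congr (_ * expR _).
    by move: (ln x) (expR p) => l e; field; rewrite gt_eqF.
  over.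
rewrite -(EFin_Rintegral (integrable_mulC _ (integrable_gker ae0))) lee_fin.
rewrite RintegralZl//; last exact: integrable_gker.
by rewrite -/(gam _) /c; move: (gam _) (expR ((a - eps) * _)) (expR (- _)) => u v w; rewrite le_eqVlt; apply/orP; left; apply/eqP; ring.
Qed.

End TricomiBound.

(** * The Fourier transform of 1 / (cosh v + cosh u) *)

Section Poisson.
Context {R : realType}.
Local Notation lam := (@lebesgue_measure R).
Implicit Types (b u v th : R).

Lemma cosh_sinh v : cosh v ^+ 2 = 1 + sinh v ^+ 2.
Proof.
have h : expR v * expR (- v) = 1 by rewrite -expRD subrr expR0.
rewrite /cosh /sinh; move: (expR v) (expR (- v)) h => x y h.
have -> : ((x + y) / 2) ^+ 2 = ((x - y) / 2) ^+ 2 + x * y by field.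
by rewrite h addrC.
Qed.

Lemma cosh_ge1 v : 1 <= cosh v.
Proof.
have h := sqr_le_cosh v; have := sqr_ge0 v; rewrite /cosh; move: h.
by move: (v ^+ 2) (expR v) (expR (- v)) => x y z; lra.
Qed.

Lemma norm_sinh_le_cosh v : `|sinh v| <= cosh v.
Proof.
rewrite -[leRHS]gtr0_norm ?cosh_gt0// -ler_sqr ?nnegrE// !real_normK ?num_real//.
by rewrite cosh_sinh lerDr.
Qed.

Lemma invcosh_le v : (cosh v)^-1 <= 2 * expR (- (1 * `|v|)).
Proof.
rewrite mul1r expRN -[leLHS]mul1r ler_pdivrMr ?cosh_gt0//.
have := cosh_ge v; have := expR_gt0 `|v|; move: (expR _) (cosh v) => e c e0 h.
by rewrite mulrAC ler_pdivlMr// mul1r; lra.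
Qed.

Lemma measurable_cosh : measurable_fun setT (@cosh R).
Proof. by apply: continuous_measurable_fun => v; exact: hasd_continuous (hasd_cosh v). Qed.

Lemma integrable_le_invcosh (f : R -> R) C : measurable_fun setT f ->
  (forall v, `|f v| <= C * (cosh v)^-1) -> lam.-integrable setT (EFin \o f).
Proof.
move=> mf fC.
have C0 : 0 <= C.
  have := le_trans (normr_ge0 _) (fC 0).
  by rewrite pmulr_lge0// invr_gt0 cosh_gt0.
apply: (@integrable_le_expNabs _ _ 1 (C * 2)) => // v.
apply: (le_trans (fC v)); rewrite -mulrA ler_wpM2l//; exact: invcosh_le.
Qed.

Lemma cvg0_invcosh (f : R -> R) C : (forall v, `|f v| <= C * (cosh v)^-1) ->
  f x @[x --> +oo] --> (0 : R) /\ f x @[x --> -oo] --> (0 : R).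
Proof.
move=> fC; have C0 : 0 <= C.
  have := le_trans (normr_ge0 _) (fC 0).
  by rewrite pmulr_lge0// invr_gt0 cosh_gt0.
apply: (@cvg0_expNabs _ _ 1 (C * 2)) => // v.
apply: (le_trans (fC v)); rewrite -mulrA ler_wpM2l//; exact: invcosh_le.
Qed.

Definition sechint b := \int[lam]_v (cos (b * v) / (1 + cosh v)).

Lemma measurable_inv_coshD (c : R) : -1 < c -> measurable_fun setT (fun v => (cosh v + c)^-1).
Proof.
move=> c1; apply: continuous_measurable_fun => v; apply: cvgV.
  by rewrite gt_eqF//; have := cosh_ge1 v; lra.
by apply: cvgD; [exact: hasd_continuous (hasd_cosh v)|exact: cvg_cst].
Qed.

(* Green's identity for the harmonic functions
   sin th / (cosh v + cos th) and sinh (b (th1 - th)) cos (b v). *)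
Lemma poisson_sechint b th1 : 0 <= th1 < pi ->
  b * \int[lam]_v (cos (b * v) * (sin th1 / (cosh v + cos th1))) = sinh (b * th1) * sechint b.
Proof.
move=> /andP[t0 t1].
pose hi := (th1 + pi) / 2.
have thi : th1 < hi by rewrite /hi; lra.
have hi0 : 0 < hi by exact: le_lt_trans thi.
have hi1 : hi < pi by rewrite /hi; lra.
have chi1 : -1 < cos hi.
  rewrite -cospi ltr_cos// in_itv/= ?(ltW hi0) ?(ltW hi1)// lexx andbT.
  exact: ltW (@pi_gt0 R).
have chi s : - hi < s < hi -> cos hi <= cos s.
  move=> /andP[h1 h2]; rewrite -(cos_norm s) ltW// ltr_cos ?in_itv/=.
  - by rewrite ltr_norml h1 h2.
  - have nl : `|s| < hi by rewrite ltr_norml h1 h2.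
    by rewrite normr_ge0/=; have := @pi_gt0 R; lra.
  - by apply/andP; split; exact: ltW.
(* Since cosh v >= 1, this value gives cosh v + cos s >= kap * cosh v on the strip, so that every
   term below is bounded by a multiple of 1 / cosh v. *)
pose kap := (1 + cos hi) / 2.
have kap0 : 0 < kap by rewrite /kap; lra.
have den s v : - hi < s < hi -> kap * cosh v <= cosh v + cos s.
  move=> /chi h; have := cosh_ge1 v; have := cos_le1 hi; rewrite /kap; move: h chi1.
  move: (cosh v) (cos hi) (cos s) => C c c' h h0 h1 h2.
  have h3 : 0 <= (C - 1) * (1 - c) by rewrite mulr_ge0// subr_ge0.
  nra.
have den0 s v : - hi < s < hi -> 0 < cosh v + cos s.
  by move=> sI; apply: lt_le_trans (den s v sI); rewrite mulr_gt0// cosh_gt0.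
have ne0 s v : - hi < s < hi -> cosh v + cos s != 0 by move=> sI; rewrite gt_eqF// den0.
(* [k] is the Poisson kernel, [r] and [sv] are its derivatives in s and in v. Its harmonicity is the
   fact that [r'] is both the s-derivative of [r] and minus the v-derivative of [sv]. *)
pose di s v := (cosh v + cos s)^-1.
pose k s v := sin s * di s v.
pose r s v := (1 + cos s * cosh v) * di s v ^+ 2.
pose sv s v := - (sin s * sinh v * di s v ^+ 2).
pose r' s v := sin s * (2 + cos s * cosh v - cosh v ^+ 2) * (di s v * di s v ^+ 2).
pose sh s := sinh (b * (th1 - s)). pose ch s := cosh (b * (th1 - s)).
have di_th (s v : R) : - hi < s < hi -> hasd (fun s => di s v) s (sin s * di s v ^+ 2).
  move=> sI; have n := ne0 s v sI.
  apply: (@hasd_eq _ _ _ (- (0 + - sin s) / (cosh v + cos s) ^+ 2)).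
    apply: hasd_inv => //; apply: hasd_add; [exact: hasd_cst|exact: is_derive_cos].
  by rewrite add0r opprK /di exprVn.
have di_v (s v : R) : - hi < s < hi -> hasd (di s) v (- sinh v * di s v ^+ 2).
  move=> sI; have n := ne0 s v sI.
  apply: (@hasd_eq _ _ _ (- (sinh v + 0) / (cosh v + cos s) ^+ 2)).
    apply: hasd_inv => //; apply: hasd_add; [exact: hasd_cosh|exact: hasd_cst].
  by rewrite addr0 /di exprVn.
have k_th (s v : R) : - hi < s < hi -> hasd (fun s => k s v) s (r s v).
  move=> sI; have n := ne0 s v sI.
  apply: (@hasd_eq _ _ _ (cos s * di s v + sin s * (sin s * di s v ^+ 2))).
    by apply: hasd_mul; [exact: is_derive_sin|exact: di_th].
  rewrite /r /di -[1 in RHS](cos2Dsin2 s); move: (cosh v) (cos s) (sin s) n => C c x n.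
  by field.
have k_v (s v : R) : - hi < s < hi -> hasd (k s) v (sv s v).
  move=> sI; apply: (@hasd_eq _ _ _ (0 * di s v + sin s * (- sinh v * di s v ^+ 2))).
    by apply: hasd_mul; [exact: hasd_cst|exact: di_v].
  by rewrite /sv; move: (di s v) (sinh v) (sin s) => *; ring.
have r_th (s v : R) : - hi < s < hi -> hasd (fun s => r s v) s (r' s v).
  move=> sI; have n := ne0 s v sI.
  apply: (@hasd_eq _ _ _ ((0 + (- sin s * cosh v + cos s * 0)) * di s v ^+ 2 +
     (1 + cos s * cosh v) * (2 * (sin s * di s v ^+ 2) * di s v))).
    apply: hasd_mul; last by apply: hasd_sqr; exact: di_th.
    apply: hasd_add; first exact: hasd_cst.
    by apply: hasd_mul; [exact: is_derive_cos|exact: hasd_cst].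
  by rewrite /r' /di; move: (cosh v) (cos s) (sin s) n => C c x n; field.
have sv_v (s v : R) : - hi < s < hi -> hasd (sv s) v (- r' s v).
  move=> sI; have n := ne0 s v sI.
  apply: (@hasd_eq _ _ _ (- ((0 * sinh v + sin s * cosh v) * di s v ^+ 2 +
     sin s * sinh v * (2 * (- sinh v * di s v ^+ 2) * di s v)))).
    apply: hasd_opp; apply: hasd_mul; last by apply: hasd_sqr; exact: di_v.
    by apply: hasd_mul; [exact: hasd_cst|exact: hasd_sinh].
  have cs := cosh_sinh v; rewrite /r' /di.
  have -> : 2 + cos s * cosh v - cosh v ^+ 2 = cos s * cosh v + cosh v ^+ 2 - 2 * sinh v ^+ 2.
    by move: cs; move: (cosh v ^+ 2) (sinh v ^+ 2) (cos s * cosh v) => x y z; lra.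
  by move: (cosh v) (sinh v) (cos s) (sin s) n => C S c x n; field.
have sh_th (s : R) : hasd sh s (- (b * ch s)).
  apply: (@hasd_eq _ _ _ ((0 * (th1 - s) + b * (0 + - 1)) * cosh (b * (th1 - s)))); last first.
    by rewrite /ch; move: (cosh _) => C; ring.
  by apply: (@is_derive_compf _ (fun s => b * (th1 - s)) (@sinh R)); [exact: hasd_sinh|deriv].
have ch_th (s : R) : hasd ch s (- (b * sh s)).
  apply: (@hasd_eq _ _ _ ((0 * (th1 - s) + b * (0 + - 1)) * sinh (b * (th1 - s)))); last first.
    by rewrite /sh; move: (sinh _) => C; ring.
  by apply: (@is_derive_compf _ (fun s => b * (th1 - s)) (@cosh R)); [exact: hasd_cosh|deriv].
have cb (v : R) : hasd (fun v => cos (b * v)) v (- (b * sin (b * v))).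
  by eapply hasd_eq; [deriv|rewrite /=; move: (sin _) => *; ring].
have sb (v : R) : hasd (fun v => sin (b * v)) v (b * cos (b * v)).
  by eapply hasd_eq; [deriv|rewrite /=; move: (cos _) => *; ring].
(* The flux in Green's identity. At s = 0 the kernel vanishes and its normal derivative is 1 / (1 +
   cosh v), which gives [sechint]; at s = th1 the factor [sh] vanishes and only b times the kernel
   remains. *)
pose F s v := (sh s * r s v + b * ch s * k s v) * cos (b * v).
pose D s v := sh s * (r' s v - b ^+ 2 * k s v) * cos (b * v).
pose G s v := - (sh s * (sv s v * cos (b * v) + b * k s v * sin (b * v))).
have dF (s v : R) : - hi < s < hi -> is_derive s 1 (fun s => F s v) (D s v).
  move=> sI; apply: (@hasd_eq _ _ _ (((- (b * ch s) * r s v + sh s * r' s v) +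
     ((0 * ch s + b * - (b * sh s)) * k s v + b * ch s * r s v)) * cos (b * v) +
     (sh s * r s v + b * ch s * k s v) * 0)).
    apply: hasd_mul; last exact: hasd_cst.
    apply: hasd_add; first by apply: hasd_mul; [exact: sh_th|exact: r_th].
    apply: hasd_mul; last exact: k_th.
    by apply: hasd_mul; [exact: hasd_cst|exact: ch_th].
  by rewrite /D; move: (ch s) (sh s) (r s v) (r' s v) (k s v) (cos _) => *; ring.
have dG (s v : R) : - hi < s < hi -> is_derive v 1 (G s) (D s v).
  move=> sI; apply: (@hasd_eq _ _ _ (- (0 * (sv s v * cos (b * v) + b * k s v * sin (b * v)) +
    sh s * ((- r' s v * cos (b * v) + sv s v * - (b * sin (b * v))) +
    ((0 * k s v + b * sv s v) * sin (b * v) + b * k s v * (b * cos (b * v))))))).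
    apply: hasd_opp; apply: hasd_mul; first exact: hasd_cst.
    apply: hasd_add; apply: hasd_mul; [exact: sv_v|exact: cb| |exact: sb].
    by apply: hasd_mul; [exact: hasd_cst|exact: k_v].
  by rewrite /D; move: (sh s) (sv s v) (r' s v) (k s v) (cos _) (sin _) => *; ring.
have cD s : - hi < s < hi -> continuous (D s).
  move=> sI v; eapply hasd_continuous; rewrite /D /r' /k.
  by repeat first [exact: di_v sI|exact: cb|exact: hasd_cosh|hasd_step].
have cF s : - hi < s < hi -> continuous (F s).
  move=> sI v; eapply hasd_continuous; rewrite /F /r /k.
  by repeat first [exact: di_v sI|exact: cb|exact: hasd_cosh|hasd_step].
pose M := expR (`|b| * (2 * hi)).
have M0 : 0 <= M by exact: expR_ge0.
have argM s : - hi < s < hi -> expR `|b * (th1 - s)| <= M.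
  move=> /andP[s1 s2]; rewrite ler_expR normrM ler_wpM2l// ler_norml; lra.
have shM s : - hi < s < hi -> `|sh s| <= M by move=> sI; apply: le_trans (argM s sI); exact: norm_sinh_le.
have chM s : - hi < s < hi -> `|ch s| <= M.
  by move=> sI; apply: le_trans (argM s sI); rewrite (gtr0_norm (cosh_gt0 _)); exact: cosh_le.
pose y v := kap^-1 * (cosh v)^-1.
have y0 v : 0 < y v by rewrite mulr_gt0// invr_gt0// cosh_gt0.
have Cy v : cosh v * y v = kap^-1 by rewrite /y mulrCA mulfV ?mulr1// gt_eqF// cosh_gt0.
have di0 s v : - hi < s < hi -> 0 <= di s v by move=> sI; rewrite invr_ge0 ltW// den0.
have diy s v : - hi < s < hi -> di s v <= y v.
  move=> sI; rewrite /y -invfM lef_pV2 ?posrE ?den0//; first exact: den.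
  by rewrite mulr_gt0// cosh_gt0.
have di2 s v : - hi < s < hi -> di s v ^+ 2 <= y v ^+ 2.
  by move=> sI; rewrite ler_sqr ?nnegrE ?di0 ?(ltW (y0 v))//; exact: diy.
have kM s v : - hi < s < hi -> `|k s v| <= y v.
  move=> sI; rewrite normrM (ger0_norm (di0 s v sI)) -[leRHS]mul1r.
  by apply: ler_pM => //; [exact: di0|exact: sin_max|exact: diy].
have K0 : 0 <= kap^-1 by rewrite invr_ge0 ltW.
have svM s v : - hi < s < hi -> `|sv s v| <= kap^-1 * y v.
  move=> sI; rewrite normrN normrM (ger0_norm (sqr_ge0 _)) -(Cy v) -mulrA -expr2.
  apply: (ler_pM (normr_ge0 _) (sqr_ge0 _) _ (di2 s v sI)).
  rewrite normrM -[leRHS]mul1r; apply: ler_pM => //; [exact: sin_max|exact: norm_sinh_le_cosh].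
have rM s v : - hi < s < hi -> `|r s v| <= 2 * kap^-1 * y v.
  move=> sI; rewrite normrM (ger0_norm (sqr_ge0 _)).
  have -> : 2 * kap^-1 * y v = 2 * cosh v * y v ^+ 2.
    by rewrite -(Cy v); move: (cosh v) (y v) => *; ring.
  apply: (ler_pM (normr_ge0 _) (sqr_ge0 _) _ (di2 s v sI)).
  have C1 := cosh_ge1 v; apply: le_trans (ler_normD _ _) _; rewrite normr1 normrM (gtr0_norm (cosh_gt0 v)).
  have : `|cos s| * cosh v <= cosh v by rewrite ler_piMl ?cos_max// ltW// cosh_gt0.
  by move: C1; move: (`|cos s| * cosh v) => p; move: (cosh v) => q; lra.
have r'M s v : - hi < s < hi -> `|r' s v| <= 4 * kap^-1 ^+ 2 * y v.
  move=> sI; rewrite normrM normrM (ger0_norm (mulr_ge0 (di0 s v sI) (sqr_ge0 _))).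
  have -> : 4 * kap^-1 ^+ 2 * y v = 4 * cosh v ^+ 2 * (y v * y v ^+ 2).
    by rewrite -(Cy v); move: (cosh v) (y v) => *; ring.
  apply: ler_pM => //; [by rewrite mulr_ge0 ?di0 ?sqr_ge0| |]; last first.
    by apply: ler_pM; [exact: di0|exact: sqr_ge0|exact: diy|exact: di2].
  rewrite -[leRHS]mul1r; apply: ler_pM => //; first exact: sin_max.
  have C1 := cosh_ge1 v; have c1 := cos_max s; rewrite ler_norml in c1.
  by move: (cosh v) (cos s) C1 c1 => C c C1 /andP[c1 c2]; rewrite ler_norml !expr2; nra.
have b1 v : `|cos (b * v)| <= 1 by exact: cos_max.
have b2 v : `|sin (b * v)| <= 1 by exact: sin_max.
have Fb s v : - hi < s < hi -> `|F s v| <= M * (2 * kap^-1 + `|b|) * kap^-1 * (cosh v)^-1.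
  move=> sI; rewrite normrM -[leRHS]mulrA -/(y v) -[leRHS]mulr1; apply: ler_pM => //.
  apply: le_trans (ler_normD _ _) _.
  have -> : M * (2 * kap^-1 + `|b|) * y v = M * (2 * kap^-1 * y v) + `|b| * M * y v.
    by move: `|b| (y v) => *; ring.
  apply: lerD; rewrite normrM.
    by apply: ler_pM => //; [exact: shM|exact: rM].
  apply: ler_pM => //; last exact: kM.
  by rewrite normrM; apply: ler_pM => //; exact: chM.
have Db s v : - hi < s < hi -> `|D s v| <= M * (4 * kap^-1 ^+ 2 + b ^+ 2) * kap^-1 * (cosh v)^-1.
  move=> sI; rewrite normrM -[leRHS]mulrA -/(y v) -[leRHS]mulr1; apply: ler_pM => //.
  rewrite normrM -mulrA; apply: ler_pM => //; first exact: shM.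
  apply: le_trans (ler_normB _ _) _; rewrite mulrDl; apply: lerD; first exact: r'M.
  by rewrite normrM (ger0_norm (sqr_ge0 b)) ler_wpM2l ?sqr_ge0//; exact: kM.
have Gb s v : - hi < s < hi -> `|G s v| <= M * (kap^-1 + `|b|) * kap^-1 * (cosh v)^-1.
  move=> sI; rewrite normrN normrM -[leRHS]mulrA -/(y v) -[leRHS]mulrA; apply: ler_pM => //; first exact: shM.
  apply: le_trans (ler_normD _ _) _; rewrite mulrDl; apply: lerD; rewrite normrM.
    by rewrite -[leRHS]mulr1; apply: ler_pM => //; exact: svM.
  rewrite -[leRHS]mulr1; apply: ler_pM => //.
  by rewrite normrM ler_wpM2l//; exact: kM.
have iF s : - hi < s < hi -> lam.-integrable setT (EFin \o F s).
  move=> sI; apply: (integrable_le_invcosh _ (fun v => Fb s v sI)).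
  by apply: continuous_measurable_fun; exact: cF.
pose g v := M * (4 * kap^-1 ^+ 2 + b ^+ 2) * kap^-1 * (cosh v)^-1.
have ig : lam.-integrable setT (EFin \o g).
  apply: (@integrable_le_invcosh _ (M * (4 * kap^-1 ^+ 2 + b ^+ 2) * kap^-1)).
    apply: measurable_fun_mulf; first exact: measurable_fun_cstf.
    have := @measurable_inv_coshD 0 ltac:(lra); congr measurable_fun.
    by apply/funext => v; rewrite addr0.
  move=> v; rewrite ger0_norm//; apply: mulr_ge0; last by rewrite invr_ge0 ltW ?cosh_gt0.
  apply: mulr_ge0 => //; apply: mulr_ge0 => //; apply: addr_ge0; last exact: sqr_ge0.
  by apply: mulr_ge0 => //; exact: sqr_ge0.
have lo0 : - hi < 0 by rewrite oppr_lt0.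
have GG s (sI : - hi < s < hi) := cvg0_invcosh (fun v => Gb s v sI).
have := @strip_shift R F G D g (- hi) hi 0 th1 lo0 t0 thi iF dF dG cD ig Db GG.
have -> : \int[lam]_v F 0 v = sinh (b * th1) * sechint b.
  rewrite /sechint -RintegralZl//.
    apply: eq_Rintegral => v _.
    rewrite /F /k /r /sh /di sin0 cos0 mul0r mulr0 addr0 subr0 mul1r.
    have n : cosh v + 1 != 0 by rewrite gt_eqF//; have := cosh_ge1 v; lra.
    by rewrite [1 + _]addrC; move: (sinh _) (cosh v) (cos _) n => S C c n; field.
  apply: (@integrable_le_invcosh _ 1).
    apply: measurable_fun_mulf; first by meas.
    have := @measurable_inv_coshD 1 ltac:(lra); congr measurable_fun.
    by apply/funext => v; rewrite addrC.
  move=> v; rewrite normrM normfV; apply: ler_pM => //.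
  have C0 := cosh_gt0 v; have C1 : 0 < 1 + cosh v by exact: addr_gt0.
  by rewrite (gtr0_norm C1) lef_pV2 ?posrE// lerDr.
move=> ->; have thI : - hi < th1 < hi by rewrite thi andbT (lt_le_trans lo0).
have ip : lam.-integrable setT (EFin \o (fun v => cos (b * v) * (sin th1 / (cosh v + cos th1)))).
  apply: (@integrable_le_invcosh _ kap^-1).
    apply: measurable_fun_mulf; first by meas.
    apply: measurable_fun_mulf; first exact: measurable_fun_cstf.
    by apply: measurable_inv_coshD; exact: lt_le_trans chi1 (chi _ thI).
  move=> v; rewrite normrM mulrC -[leRHS]mulr1; apply: ler_pM => //.
  exact: kM.
rewrite -RintegralZl//; apply: eq_Rintegral => v _.
rewrite /F /sh /ch subrr mulr0 /k /di.
have -> : sinh (0 : R) = 0 by rewrite /sinh oppr0 subrr mul0r.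
have -> : cosh (0 : R) = 1 by rewrite /cosh oppr0 expR0; lra.
by move: (cos (b * v)) (sin th1) (_^-1) => x y' z; ring.
Qed.

End Poisson.

Section CosineIntegral.
Context {R : realType}.
Local Notation lam := (@lebesgue_measure R).
Implicit Types (b u v th : R).

Lemma Rintegral_shift (c : R) (f : R -> R) : measurable_fun setT f ->
  \int[lam]_x f (x + c) = \int[lam]_x f x.
Proof.
move=> mf; rewrite /Rintegral; congr fine.
exact: (integral_shift c (f := EFin \o f) ltac:(exact/measurable_EFinP)).
Qed.

Lemma integrable_shift (c : R) (f : R -> R) : lam.-integrable setT (EFin \o f) ->
  lam.-integrable setT (EFin \o (fun x => f (x + c))).
Proof.
move=> /integrableP[mf fy]; have mc : measurable_fun setT (fun x : R => x + c) by meas.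
have mf' : measurable_fun setT f by exact/measurable_EFinP.
have mfc : measurable_fun setT (fun x : R => f (x + c)) := measurableT_comp mf' mc.
apply/integrableP; split; first exact/measurable_EFinP.
apply: le_lt_trans fy.
rewrite le_eqVlt -(@ge0_integral_shift _ c (fun x => `|(f x)%:E|%E)) ?eqxx//.
exact: measurableT_comp.
Qed.

(** An antiderivative is 2 atan ((e^v + cos th) / sin th). It tends to pi at +oo, and at -oo to 2
    atan (cot th) = pi - 2 th. *)
Lemma poisson_mass th : 0 < th < pi ->
  \int[lam]_v (sin th / (cosh v + cos th)) = 2 * th.
Proof.
move=> /andP[t0 t1]; have s0 : 0 < sin th by rewrite sin_gt0_pi// t0.
pose c := cos th; pose s := sin th.
have sc : c ^+ 2 + s ^+ 2 = 1 := cos2Dsin2 th.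
pose F v : R := 2 * atan ((expR v + c) / s).
have c1 : -1 < c by move: s0 sc; rewrite -/s; clear; move: s c => s c; nra.
have den v : 0 < cosh v + c by have := cosh_ge1 v; lra.
have dF (v : R) : is_derive v 1 F (s / (cosh v + c)).
  pose d : R := (expR v + 0) / s + (expR v + c) * 0.
  apply: (@hasd_eq _ _ _ (0 * atan ((expR v + c) / s) +
            2 * (d * (1 + ((expR v + c) / s) ^+ 2)^-1))).
    apply: hasd_mul; first exact: hasd_cst.
    apply: (@is_derive_compf _ (fun v => (expR v + c) / s) (@atan R) v).
    apply: hasd_mul; last exact: hasd_cst.
    by apply: hasd_add; [exact: is_derive_expR|exact: hasd_cst].
  have e0 := expR_gt0 v; have E : cosh v = (expR v + (expR v)^-1) / 2 by rewrite /cosh expRN.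
  have := den v; rewrite E /d; move: s0 sc e0; rewrite -/s; clear.
  move: s c (expR v) => s c e s0 sc e0 h.
  have n1 : s != 0 by rewrite gt_eqF.
  have n2 : e != 0 by rewrite gt_eqF.
  have n3 : 1 + ((e + c) / s) ^+ 2 != 0 by rewrite gt_eqF// ltr_pwDl// sqr_ge0.
  have n4 : (e + e^-1) / 2 + c != 0 by rewrite gt_eqF.
  have key : 1 + ((e + c) / s) ^+ 2 = 2 * e * ((e + e^-1) / 2 + c) / s ^+ 2.
    apply: (mulIf (x := s ^+ 2)); first by rewrite expf_eq0.
    rewrite [RHS]divfK ?expf_eq0// mulrDl expr_div_n divfK ?expf_eq0// mul1r.
    have -> : 2 * e * ((e + e^-1) / 2 + c) = e ^+ 2 + 1 + 2 * e * c by field.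
    by move: sc; clear; lra.
  rewrite key; field; rewrite n1 n2 andbT /=.
  have -> : e * e + 1 + c * (e * 2) = 2 * e * ((e + e^-1) / 2 + c) by field.
  by rewrite !mulf_neq0 ?pnatr_eq0.
have den_cont : continuous (fun v => s / (cosh v + c)).
  move=> v; apply: cvgM; first exact: cvg_cst.
  apply: cvgV; first by rewrite gt_eqF.
  by apply: cvgD; [exact: hasd_continuous (hasd_cosh v)|exact: cvg_cst].
have Fy : F v @[v --> +oo] --> pi.
  have -> : pi = 2 * (pi / 2) :> R by field.
  apply: cvgM; first exact: cvg_cst.
  apply: (@cvg_comp _ _ _ (fun v => (expR v + c) / s) (@atan R) _ +oo%R); last exact: cvgy_atan.
  apply/cvgryPge => A; near=> v.
  rewrite ler_pdivlMr//; have v1 : `|A * s - c| <= v.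
    by near: v; apply: nbhs_pinfty_ge; exact: num_real.
  have := le_trans (ler_norm _) v1; have := expR_ge1Dx v; move: (A * s) (expR v) => *; lra.
have FNy : F v @[v --> -oo] --> pi - 2 * th.
  have E : tan (pi / 2 - th) = c / s.
    rewrite /tan -[pi / 2 - th]opprB sinN cosN sinBpihalf cosBpihalf opprK.
    by [].
  have -> : pi - 2 * th = 2 * atan (c / s).
    rewrite -E tanK; first by field.
    by rewrite in_itv/=; apply/andP; split; lra.
  apply: cvgM; first exact: cvg_cst.
  apply: (@cvg_comp _ _ _ (fun v => (expR v + c) / s) (@atan R)); last exact: continuous_atan.
  apply: cvgM; last exact: cvg_cst.
  rewrite -[X in _ --> X]add0r; apply: cvgD; last exact: cvg_cst.
  by apply/cvgNy_compNP; exact: cvgr_expR.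
rewrite /Rintegral (ge0_integral_derive dF den_cont _ Fy FNy).
  by rewrite /=; lra.
by move=> v; rewrite divr_ge0 ?ltW.
Unshelve. all: by end_near. Qed.

(** As th tends to pi the Poisson kernel, of mass 2 th, concentrates at v = 0, so cos (b v) may be
    replaced by 1 in [poisson_sechint] with an error of order sin th. *)
Lemma sechint_eq b : 0 < b -> sinh (b * pi) * sechint b = 2 * pi * b.
Proof.
move=> b0.
have iK : lam.-integrable setT (EFin \o (fun v => (cosh v)^-1)).
  apply: (@integrable_le_invcosh _ _ 1) => [|v]; last by rewrite mul1r ger0_norm// invr_ge0 ltW ?cosh_gt0.
  have := @measurable_inv_coshD R 0 ltac:(lra); congr measurable_fun.
  by apply/funext => v; rewrite addr0.
(* The factor 2 + b ^ 2 comes from splitting cosh v as (cosh v - 1) + 1 in (1 - cos (b v)) cosh v: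
   the first term uses 1 - cos <= 2, the second 1 - cos (b v) <= (b v) ^ 2 / 2 <= b ^ 2 (cosh v -
   1). *)
pose C := b * ((2 + b ^+ 2) * \int[lam]_v (cosh v)^-1).
have bnd th : 0 < th < pi -> `|2 * th * b - sinh (b * th) * sechint b| <= C * sin th.
  move=> thI; have /andP[t0 t1] := thI.
  have s0 : 0 < sin th by rewrite sin_gt0_pi// t0.
  have c1 : -1 < cos th.
    by have := cos2Dsin2 th; move: s0; clear; move: (sin th) (cos th) => s c; nra.
  have den v : 0 < cosh v + cos th by have := cosh_ge1 v; lra.
  have md : measurable_fun setT (fun v => (cosh v + cos th)^-1) by exact: measurable_inv_coshD.
  have dv v : (cosh v + cos th)^-1 <= (1 + cos th)^-1 * 2 * (cosh v)^-1.
    have C1 := cosh_ge1 v; have C0 := cosh_gt0 v; have D := den v.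
    have -> : (1 + cos th)^-1 * 2 * (cosh v)^-1 = 2 / ((1 + cos th) * cosh v).
      by rewrite [in RHS]invfM mulrA [2 * _]mulrC.
    have p : 0 < (1 + cos th) * cosh v by rewrite mulr_gt0//; move: c1; clear; move: (cos th) => *; lra.
    rewrite ler_pdivlMr//.
    rewrite mulrC ler_pdivrMr//.
    by move: C1 c1 (cos_le1 th); clear; move: (cosh v) (cos th) => k c; nra.
  have i1 : lam.-integrable setT (EFin \o (fun v => sin th / (cosh v + cos th))).
    apply: (@integrable_le_invcosh _ _ ((1 + cos th)^-1 * 2)).
      by apply: measurable_fun_mulf => //; exact: measurable_fun_cstf.
    move=> v; rewrite normrM (ger0_norm (ltW s0)) (@ger0_norm _ (_^-1)) ?invr_ge0 ?(ltW (den v))//.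
    by apply: le_trans (dv v); rewrite ler_piMl ?sin_le1// invr_ge0 ltW.
  have i2 : lam.-integrable setT (EFin \o (fun v => cos (b * v) * (sin th / (cosh v + cos th)))).
    apply: (@integrable_le_norm _ (measurableTypeR R) R lam _ _ _ i1).
      apply: measurable_fun_mulf; first by meas.
      by apply: measurable_fun_mulf => //; exact: measurable_fun_cstf.
    move=> v; have p : 0 <= sin th / (cosh v + cos th) by rewrite divr_ge0 ?ltW.
    by rewrite normrM (ger0_norm p) ler_piMl ?cos_max.
  have := @poisson_sechint R b th; rewrite ltW// t1 => /(_ isT) <-.
  rewrite -(poisson_mass thI) mulrC -mulrBr normrM (gtr0_norm b0) /C -mulrA ler_pM2l//.
  rewrite -RintegralB//; apply: le_trans (le_normr_Rintegral _ _) _ => //.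
    exact: (integrable_add i1 (integrable_opp i2)).
  rewrite mulrAC -RintegralZl//.
  apply: le_Rintegral => //.
  - have := integrable_add i1 (integrable_opp i2); move/integrable_norm; exact.
  - by have := @integrable_mulC _ _ _ lam ((2 + b ^+ 2) * sin th) _ iK.
  move=> v _ /=.
  have D := den v; have C1 := cosh_ge1 v.
  have p : 0 <= sin th / (cosh v + cos th) by rewrite divr_ge0 ?ltW.
  rewrite -[X in X - _]mul1r -mulrBl normrM (ger0_norm p).
  rewrite ger0_norm ?subr_ge0 ?cos_le1//.
  rewrite mulrCA [(2 + _) * _]mulrC -[leRHS]mulrA; apply: ler_wpM2l; first exact: ltW.
  rewrite ler_pdivrMr// mulrAC ler_pdivlMr ?cosh_gt0//.
  have q := sqr_le_cosh v; have cq := cos_ge (b * v); have cl := cos_geN1 (b * v).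
  have qC : v ^+ 2 <= 2 * (cosh v - 1) by rewrite /cosh; move: q; clear; lra.
  rewrite exprMn in cq.
  have h1 : (1 - cos (b * v)) * (cosh v - 1) <= 2 * (cosh v - 1).
    by apply: ler_wpM2r; lra.
  have h2 : b ^+ 2 * v ^+ 2 <= b ^+ 2 * (2 * (cosh v - 1)) by rewrite ler_wpM2l ?sqr_ge0.
  have h3 : (2 + b ^+ 2) * (cosh v - 1) <= (2 + b ^+ 2) * (cosh v + cos th).
    by rewrite ler_wpM2l ?addr_ge0 ?sqr_ge0//; lra.
  move: h1 h2 h3 cq; clear; move: (cosh v) (cos (b * v)) (cos th) (b ^+ 2) (v ^+ 2) => k c c' x y.
  lra.
(* [f] is nonpositive on ]0, pi[ by [bnd], hence at pi by continuity; there the sine vanishes and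
   the identity is left. *)
pose f th : R := `|2 * th * b - sinh (b * th) * sechint b| - C * sin th.
have cf : {for pi, continuous f}.
  apply: cvgB; last first.
    by apply: cvgM; [exact: cvg_cst|exact: continuous_sin].
  apply: cvg_norm; apply: cvgB.
    by apply: cvgM; [apply: cvgM; [exact: cvg_cst|exact: cvg_id]|exact: cvg_cst].
  apply: cvgM; last exact: cvg_cst.
  have h : hasd (fun th => sinh (b * th)) pi ((0 * pi + b * 1) * cosh (b * pi)).
    apply: (@is_derive_compf _ (fun th => b * th) (@sinh R)); [exact: hasd_sinh|deriv].
  exact: hasd_continuous h.
have f_pi : f pi <= 0.
  rewrite leNgt; apply/negP => fp.
  move/cvgrPdist_lt : cf => /(_ _ fp) [e /= e0 he].
  pose th := pi - Num.min (e / 2) (pi / 2) : R.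
  have pi0 := @pi_gt0 R.
  have m1 : 0 < Num.min (e / 2) (pi / 2) by rewrite lt_min !divr_gt0.
  have m2 : Num.min (e / 2) (pi / 2) <= e / 2 by rewrite ge_min lexx.
  have m3 : Num.min (e / 2) (pi / 2) <= pi / 2 by rewrite ge_min lexx orbT.
  have thI : 0 < th < pi by rewrite /th; apply/andP; split; lra.
  have := he th; rewrite /ball/= {1}/th opprB addrCA subrr addr0 gtr0_norm// => /(_ ltac:(lra)).
  have : f th <= 0 by rewrite /f subr_le0; exact: bnd.
  move=> h1 h2; have := le_lt_trans (ler_norm _) h2; lra.
move: f_pi; rewrite /f sinpi mulr0 subr0 normr_le0 subr_eq0 => /eqP <-.
by [].
Qed.

Lemma sinh0 : sinh (0 : R) = 0.
Proof. by rewrite /sinh oppr0 subrr mul0r. Qed.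

(* In [u] both sides have the derivative [cos (b u) * sechint b]: the derivative
   of the kernel splits into two translates of [1 / (1 + cosh v)]. *)
Lemma sinh_kernel_integral b u : 0 <= u ->
  b * \int[lam]_v (cos (b * v) * (sinh u / (cosh v + cosh u))) = sin (b * u) * sechint b.
Proof.
move=> u0.
pose hi := u + 1; pose F s v : R := cos (b * v) * (sinh s / (cosh v + cosh s)).
pose d s v : R := (1 + cosh s * cosh v) / (cosh v + cosh s) ^+ 2.
pose D s v : R := cos (b * v) * d s v.
have den s v : 0 < cosh v + cosh s by rewrite addr_gt0 ?cosh_gt0.
have iD s v : 0 <= (cosh v + cosh s)^-1 <= (cosh v)^-1.
  rewrite invr_ge0 (ltW (den s v)) lef_pV2 ?posrE ?cosh_gt0 ?den// lerDl ltW//.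
  exact: cosh_gt0.
have iF s : lam.-integrable setT (EFin \o F s).
  apply: (@integrable_le_invcosh _ _ `|sinh s|).
    apply: measurable_fun_mulf; first by meas.
    apply: measurable_fun_mulf; first exact: measurable_fun_cstf.
    by apply: measurable_inv_coshD; exact: lt_trans (cosh_gt0 s).
  move=> v; rewrite normrM -[leRHS]mul1r; apply: ler_pM => //; first exact: cos_max.
  by rewrite normrM ler_wpM2l// ger0_norm; have /andP[] := iD s v.
have dF (s v : R) : is_derive s 1 (fun s => F s v) (D s v).
  apply: (@hasd_eq _ _ _ (0 * (sinh s / (cosh v + cosh s)) + cos (b * v) *
    (cosh s * (cosh v + cosh s)^-1 + sinh s * (- (0 + sinh s) / (cosh v + cosh s) ^+ 2)))).
    apply: hasd_mul; first exact: hasd_cst.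
    apply: hasd_mul; first exact: hasd_sinh.
    apply: (@hasd_inv _ (fun s => cosh v + cosh s)); first by rewrite gt_eqF.
    by apply: hasd_add; [exact: hasd_cst|exact: hasd_cosh].
  have n : cosh v + cosh s != 0 by rewrite gt_eqF.
  rewrite /D /d; have cs := cosh_sinh s.
  have -> : 1 + cosh s * cosh v = cosh s * (cosh v + cosh s) - sinh s ^+ 2.
    by move: cs; move: (sinh s ^+ 2) => x; rewrite expr2 => cs; rewrite mulrDr cs; move: (cosh s * cosh v) => y; lra.
  by move: n; clear; move: (cosh v) (cosh s) (sinh s) (cos _) => k c q x n; field.
have DM s v : - hi < s < hi -> `|D s v| <= expR hi * (cosh v)^-1.
  move=> /andP[s1 s2]; rewrite normrM -[leRHS]mul1r; apply: ler_pM => //; first exact: cos_max.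
  have C1 := cosh_ge1 s; have C2 := cosh_ge1 v; have /andP[i1 i2] := iD s v.
  have ch : cosh s <= expR hi.
    by apply: le_trans (cosh_le s) _; rewrite ler_expR ler_norml !ltW.
  rewrite ger0_norm; last first.
    by rewrite divr_ge0 ?sqr_ge0//; apply: addr_ge0 => //; apply: mulr_ge0; exact: ltW (cosh_gt0 _).
  apply: (@le_trans _ _ (cosh s * (cosh v + cosh s)^-1)).
    rewrite ler_pdivrMr ?exprn_gt0// expr2 [leRHS]mulrA divfK ?gt_eqF//.
    by move: C1 C2; clear; move: (cosh s) (cosh v) => x y; nra.
  by apply: ler_pM => //; exact: ltW (cosh_gt0 _).
pose h v := (1 + cosh v)^-1 : R.
have h0 v : 0 <= h v by rewrite invr_ge0 addr_ge0 ?ltW ?cosh_gt0.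
have mh : measurable_fun setT h.
  have := @measurable_inv_coshD R 1 ltac:(lra); congr measurable_fun.
  by apply/funext => v; rewrite /h addrC.
have hC v : h v <= (cosh v)^-1.
  by rewrite lef_pV2 ?posrE ?cosh_gt0 ?addr_gt0 ?cosh_gt0// lerDr.
have ih (w : R -> R) : measurable_fun setT w -> (forall v, `|w v| <= 1) ->
    lam.-integrable setT (EFin \o (fun v => w v * h v)).
  move=> mw w1; apply: (@integrable_le_invcosh _ _ 1); first exact: measurable_fun_mulf.
  by move=> v; rewrite normrM (ger0_norm (h0 v)); apply: ler_pM.
(* Partial fractions: (cosh v + cosh s) ^ 2 = (1 + cosh (v + s)) (1 + cosh (v - s)) by the addition
   formulas. *)
have dh s v : d s v = 2^-1 * (h (v + s) + h (v - s)).
  rewrite /d /h; have cs := cosh_sinh s; have cv := cosh_sinh v.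
  have Dp : cosh (v + s) = cosh v * cosh s + sinh v * sinh s.
    by rewrite /cosh /sinh opprD !expRD; move: (expR v) (expR (- v)) (expR s) (expR (- s)) => *; field.
  have Dm : cosh (v - s) = cosh v * cosh s - sinh v * sinh s.
    by rewrite /cosh /sinh opprB [s - v]addrC !expRD; move: (expR v) (expR (- v)) (expR s) (expR (- s)) => *; field.
  have p1 := cosh_gt0 (v + s); have p2 := cosh_gt0 (v - s).
  rewrite Dp Dm in p1 p2 *; move: cs cv (den s v) p1 p2; clear.
  move: (cosh v) (cosh s) (sinh v) (sinh s) => k c x y cs cv n p1 p2.
  have n1 : 1 + (k * c + x * y) != 0 by rewrite gt_eqF// addr_gt0.
  have n2 : 1 + (k * c - x * y) != 0 by rewrite gt_eqF// addr_gt0.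
  have E : (k + c) ^+ 2 = (1 + (k * c + x * y)) * (1 + (k * c - x * y)).
    have -> : (1 + (k * c + x * y)) * (1 + (k * c - x * y)) = (1 + k * c) ^+ 2 - x ^+ 2 * y ^+ 2 by ring.
    have -> : x ^+ 2 = k ^+ 2 - 1 by rewrite cv addrAC subrr add0r.
    have -> : y ^+ 2 = c ^+ 2 - 1 by rewrite cs addrAC subrr add0r.
    by ring.
  by rewrite E; field; rewrite n1 n2.
have hs s : - hi < s < hi -> is_derive s 1 (fun s => \int[lam]_v F s v) (cos (b * s) * sechint b).
  move=> sI.
  have ig : lam.-integrable setT (EFin \o (fun v => expR hi * (cosh v)^-1)).
    apply: (@integrable_le_invcosh _ _ (expR hi)).
      apply: measurable_fun_mulf; first exact: measurable_fun_cstf.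
      have := @measurable_inv_coshD R 0 ltac:(lra); congr measurable_fun.
      by apply/funext => v; rewrite addr0.
    by move=> v; rewrite ger0_norm// mulr_ge0 ?invr_ge0 ?expR_ge0// ltW// cosh_gt0.
  have := @is_derive_Rintegral _ F D (fun v => expR hi * (cosh v)^-1) (- hi) hi s sI
    (fun s _ => iF s) (fun s v _ => dF s v) ig DM.
  congr is_derive.
  have mt (w : R -> R) c : measurable_fun setT w -> measurable_fun setT (fun v => w (v + c)).
    by move=> mw; apply: (measurableT_comp mw); meas.
  (* Here [w (- c) (v + c)] is cos (b v) times a translate of [h]. A translation moves the shift
     onto the cosine, and the two shifted cosines add up to 2 cos (b s) cos (b v). *)
  pose w c v : R := cos (b * (v + c)) * h v.
  have mc c : measurable_fun setT (fun v : R => cos (b * (v + c))) by meas.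
  have iw c : lam.-integrable setT (EFin \o w c) by apply: ih => // v; exact: cos_max.
  have mw c : measurable_fun setT (w c) by apply: measurable_fun_mulf.
  have -> : \int[lam]_v D s v = \int[lam]_v (2^-1 * (w (- s) (v + s) + w s (v - s))).
    apply: eq_Rintegral => v _; rewrite /D dh /w subrK addrK.
    by move: (cos _) (h _) (h (v - s)) => *; ring.
  have iws c : lam.-integrable setT (EFin \o (fun v => w (- c) (v + c))).
    by apply: integrable_shift.
  have iwm : lam.-integrable setT (EFin \o (fun v => w s (v - s))).
    by have := iws (- s); rewrite opprK.
  rewrite RintegralZl//; last exact: (integrable_add (iws s) iwm).
  rewrite RintegralD//= Rintegral_shift// (@Rintegral_shift (- s))//.
  rewrite -RintegralD//= -RintegralZl//; last exact: (integrable_add (iw (- s)) (iw s)).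
  rewrite /sechint -RintegralZl//.
    apply: eq_Rintegral => v _; rewrite /w /h [b * (v - s)]mulrBr [b * (v + s)]mulrDr cosB cosD.
    by move: (cos (b * v)) (sin (b * v)) (cos (b * s)) (sin (b * s)) ((1 + cosh v)^-1) => *; field.
  by apply: ih => [|v]; [meas|exact: cos_max].
have Z (s : R) : 0 <= s <= u ->
   is_derive s 1 (fun s => b * \int[lam]_v F s v - sin (b * s) * sechint b) 0.
  move=> /andP[s0 su].
  apply: (@hasd_eq _ _ _ (0 * \int[lam]_v F s v + b * (cos (b * s) * sechint b) +
     - ((0 * s + b * 1) * cos (b * s) * sechint b + sin (b * s) * 0))).
    apply: hasd_add.
      apply: hasd_mul; first exact: hasd_cst.
      by apply: hs; rewrite /hi; apply/andP; split; lra.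
    apply: hasd_opp; apply: hasd_mul; last exact: hasd_cst.
    by apply: (@hasd_sin _ (fun s => b * s)); apply: hasd_mul; [exact: hasd_cst|exact: hasd_id].
  by move: (cos _) (sin _) (sechint b) (\int[_]_(_ in _) _)%R => *; ring.
have F0 : \int[lam]_v F 0 v = 0.
  rewrite /Rintegral -[RHS]/(fine 0%E) -(@integral0 _ _ R lam setT); congr fine.
  by apply: eq_integral => v _; rewrite /F sinh0 mul0r mulr0.
have E := is_derive0_eq u0 Z.
have E0 : b * \int[lam]_v F 0 v - sin (b * 0) * sechint b = 0.
  by rewrite F0 !mulr0 sin0 mul0r subr0.
by apply/eqP; rewrite -subr_eq0; apply/eqP; exact: etrans (esym E) E0.
Qed.
End CosineIntegral.

(** * The Laplace transform of the Whittaker function *)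

Section Tonelli3.
Context {R : realType}.
Local Notation lam := (@lebesgue_measure R).
Local Notation mR := (measurableTypeR R).
Local Open Scope ereal_scope.

(** Exchanges bring x to the innermost place, where the translation by [phi y z] is one by a
    constant; further exchanges then put y innermost, ready to be integrated. *)
Lemma tonelli3_shift (H : R -> R -> R -> R) (phi : R -> R -> R) :
  measurable_fun setT ((fun p => H p.1.1 p.1.2 p.2) : mR * mR * mR -> R) ->
  measurable_fun setT ((fun p => phi p.1 p.2) : mR * mR -> R) ->
  (forall x y z, 0 <= H x y z)%R ->
  \int[lam]_x \int[lam]_y \int[lam]_z (H x y z)%:E =
  \int[lam]_z \int[lam]_x \int[lam]_y (H (x + phi y z)%R y z)%:E.
Proof.
move=> mH mphi H0.
have m3 (f : mR * mR * mR -> mR * mR * mR) : measurable_fun setT f ->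
    measurable_fun setT ((fun p => H (f p).1.1 (f p).1.2 (f p).2) : mR * mR * mR -> R).
  by move=> mf; exact: (measurableT_comp mH mf).
have m2 (f : mR * mR -> mR * mR * mR) : measurable_fun setT f ->
    measurable_fun setT ((fun p => H (f p).1.1 (f p).1.2 (f p).2) : mR * mR -> R).
  by move=> mf; exact: (measurableT_comp mH mf).
have m1 (f : mR -> mR * mR * mR) : measurable_fun setT f ->
    measurable_fun setT ((fun p => H (f p).1.1 (f p).1.2 (f p).2) : mR -> R).
  by move=> mf; exact: (measurableT_comp mH mf).
pose G (p : mR * mR) := \int[lam]_z (H p.1 p.2 z)%:E.
have mG : measurable_fun setT G.
  apply: (@measurable_fun_fubini_tonelli_F _ _ (mR * mR)%type mR R lam
    (fun p => (H p.1.1 p.1.2 p.2)%:E)) => [|p]; last by rewrite lee_fin.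
  exact/measurable_EFinP.
have G0 p : 0 <= G p by apply: integral_ge0 => z _; rewrite lee_fin.
have EG := @fubini_tonelli _ _ mR mR R lam lam G mG G0.
apply: (etrans EG); clear EG.
transitivity (\int[lam]_y \int[lam]_z \int[lam]_x (H (x + phi y z)%R y z)%:E).
  apply: eq_integral => y _; rewrite /G.
  have EH := @fubini_tonelli _ _ mR mR R lam lam (fun p => (H p.1 y p.2)%:E).
  apply: (etrans (EH _ _)).
  - apply/measurable_EFinP; apply: (m2 (fun p => (p.1, y, p.2))).
    by apply: measurable_fun_pair => //; exact: measurable_fun_pair.
  - by move=> p; rewrite lee_fin.
  apply: eq_integral => z _ /=; apply: esym.
  apply: (@ge0_integral_shift _ (phi y z) (fun x => (H x y z)%:E)).
  - apply/measurable_EFinP; apply: (m1 (fun x => (x, y, z))).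
    by apply: measurable_fun_pair => //; exact: measurable_fun_pair.
  - by move=> x; rewrite lee_fin.
have mphi3 : measurable_fun setT
    ((fun p => H (p.2 + phi p.1.1 p.1.2)%R p.1.1 p.1.2) : mR * mR * mR -> R).
  apply: (m3 (fun p => (p.2 + phi p.1.1 p.1.2, p.1.1, p.1.2)%R)).
  apply: measurable_fun_pair => /=; last exact: measurableT_comp.
  apply: measurable_fun_pair => /=; last exact: measurableT_comp.
  apply: measurable_funD => //; exact: (measurableT_comp mphi).
pose F (p : mR * mR) := \int[lam]_x (H (x + phi p.1 p.2)%R p.1 p.2)%:E.
have mF : measurable_fun setT F.
  apply: (@measurable_fun_fubini_tonelli_F _ _ (mR * mR)%type mR R lam
    (fun p => (H (p.2 + phi p.1.1 p.1.2)%R p.1.1 p.1.2)%:E)) => [|p]; last by rewrite lee_fin.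
  exact/measurable_EFinP.
have F0 p : 0 <= F p by apply: integral_ge0 => z _; rewrite lee_fin.
have EF := @fubini_tonelli _ _ mR mR R lam lam F mF F0.
apply: (etrans EF); clear EF.
apply: eq_integral => z _; rewrite /F.
have EH := @fubini_tonelli _ _ mR mR R lam lam (fun p => (H (p.2 + phi p.1 z)%R p.1 z)%:E).
apply: (EH _ _).
- apply/measurable_EFinP.
  apply: (measurableT_comp mphi3 (_ : measurable_fun setT (fun p : mR * mR => ((p.1, z), p.2)))).
  by apply: measurable_fun_pair => //; exact: measurable_fun_pair.
- by move=> p; rewrite lee_fin.
Qed.

End Tonelli3.

Section LaplaceIdentity.
Context {R : realType}.
Local Notation lam := (@lebesgue_measure R).
Local Notation mR := (measurableTypeR R).
Implicit Types (a c g r s t x y z k : R).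

Definition softplus s : R := ln (1 + expR s).

Lemma expR_softplus s : expR (softplus s) = 1 + expR s.
Proof. by rewrite lnK// posrE addr_gt0 ?expR_gt0. Qed.

Lemma measurable_softplus : measurable_fun setT softplus.
Proof.
apply: continuous_measurable_fun => s.
have h : hasd softplus s ((0 + 1 * expR s) / (1 + expR s)).
  apply: (@hasd_ln _ (fun s => 1 + expR s)); first by rewrite addr_gt0 ?expR_gt0.
  by apply: hasd_add; [exact: hasd_cst|apply: (@hasd_exp _ (fun s => s)); exact: hasd_id].
exact: hasd_continuous h.
Qed.

Section Density.
Variables (a : R) (a0 : 0 < a) (Psi : R -> R) (M : R).
Hypotheses (mPsi : measurable_fun setT Psi) (PsiM : forall p, 0 <= Psi p <= M).

Definition gconv p : R := \int[lam]_y (gker a y * Psi (p - y)).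

Lemma integrable_gconv p : lam.-integrable setT (EFin \o (fun y => gker a y * Psi (p - y))).
Proof.
apply: (@integrable_gkerM _ _ _ M) => //.
  by apply: (measurableT_comp mPsi); meas.
by move=> y; have /andP[h0 hM] := PsiM (p - y); rewrite ger0_norm.
Qed.

Lemma gconv_ge0 p : 0 <= gconv p.
Proof.
apply: Rintegral_ge0 => y _; rewrite mulr_ge0 ?gker_ge0//.
by have /andP[] := PsiM (p - y).
Qed.

Lemma measurable_gconv : measurable_fun setT gconv.
Proof.
have m : measurable_fun setT ((fun p => gker a p.2 * Psi (p.1 - p.2)) : mR * mR -> R).
  apply: measurable_fun_mulf; first exact: (measurableT_comp (measurable_gker a) measurable_sndR).
  apply: (measurableT_comp mPsi); apply: measurable_fun_addf; first exact: measurable_fstR.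
  by apply: measurable_fun_oppf; exact: measurable_sndR.
have := @measurable_fun_fubini_tonelli_F _ _ mR mR R lam
    (fun p => (gker a p.2 * Psi (p.1 - p.2))%:E) _ _.
move=> h; apply/measurable_EFinP; move: h; rewrite /fubini_F => h.
have -> : EFin \o gconv = fun x => (\int[lam]_y (gker a y * Psi (x - y))%:E)%E.
  by apply/funext => p /=; rewrite (EFin_Rintegral (integrable_gconv p)).
apply: h; first exact/measurable_EFinP.
by move=> p; rewrite lee_fin mulr_ge0 ?gker_ge0//; have /andP[] := PsiM (p.1 - p.2).
Qed.

(** Translating y by - [softplus s] turns e^y + e^(s + y) into e^y, so that a Gamma kernel convolved
    with [Psi] remains. *)
Lemma gconv_section (t s w : R) : 0 <= w ->
  (\int[lam]_y (w * gker a y * expR (- expR (s + y)) * Psi (t - y))%:E =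
   (w * expR (- (a * softplus s)) * gconv (t + softplus s))%:E)%E.
Proof.
move=> w0; pose l := softplus s.
rewrite -(@ge0_integral_shift _ (- l) (fun y => (w * gker a y * expR (- expR (s + y)) * Psi (t - y))%:E)).
- have E y : w * gker a (y - l) * expR (- expR (s + (y - l))) * Psi (t - (y - l)) =
     w * expR (- (a * l)) * (gker a y * Psi (t + l - y)).
    have -> : t - (y - l) = t + l - y by ring.
    have -> : gker a (y - l) = expR (- (a * l)) * expR (a * y - expR (y - l)).
      by rewrite /gker -expRD; congr expR; ring.
    rewrite /gker -!mulrA; congr (_ * (_ * _)); rewrite mulrA; congr (_ * _).
    have K : expR (y - l) + expR (s + (y - l)) = expR y.
      rewrite [expR (s + _)]expRD -{1}[expR (y - l)]mul1r -mulrDl -expR_softplus -expRD -/l.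
      by congr expR; ring.
    by rewrite -expRD; congr expR; rewrite -K; move: (expR _) (expR (y - l)) => *; ring.
  under eq_integral do rewrite E EFinM.
  rewrite integralZl//; last exact: integrable_gconv.
  by rewrite -(EFin_Rintegral (integrable_gconv _)).
- apply/measurable_EFinP; apply: measurable_fun_mulf.
    apply: measurable_fun_mulf; last by meas.
    by apply: measurable_fun_mulf; [exact: measurable_fun_cstf|exact: measurable_gker].
  by apply: (measurableT_comp mPsi); meas.
- move=> y; have /andP[p0 _] := PsiM (t - y).
  by rewrite lee_fin mulr_ge0// mulr_ge0 ?expR_ge0// mulr_ge0 ?gker_ge0.
Qed.

End Density.

(** An antiderivative is the Gumbel distribution function e^(- D e^(g - s)) scaled by e^(- g) /
    D. *)
Lemma integral_expR_gumbel (D : R) g : 0 < D ->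
  (\int[lam]_s (expR (- s - D * expR (g - s)))%:E = (expR (- g) / D)%:E)%E.
Proof.
move=> D0; pose F s : R := expR (- (D * expR (g - s))) * (expR (- g) / D).
have dF (s : R) : is_derive s 1 F (expR (- s - D * expR (g - s))).
  apply: (@hasd_eq _ _ _ ((- (0 * expR (g - s) + D * ((0 + - 1) * expR (g - s)))) *
     expR (- (D * expR (g - s))) * (expR (- g) / D) + expR (- (D * expR (g - s))) * 0)).
    apply: hasd_mul; last exact: hasd_cst.
    apply: (@hasd_exp _ (fun s => - (D * expR (g - s)))); apply: hasd_opp.
    apply: hasd_mul; first exact: hasd_cst.
    apply: (@hasd_exp _ (fun s => g - s)); apply: hasd_add; first exact: hasd_cst.
    by apply: hasd_opp; exact: hasd_id.
  rewrite [RHS]expRD; have -> : expR (- s) = expR (g - s) * expR (- g) by rewrite -expRD; congr expR; ring.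
  have n : D != 0 by rewrite gt_eqF.
  move: (expR (- g)); move: (expR (- (D * expR (g - s)))); move: (expR (g - s)) => *; by field.
rewrite (@ge0_integral_derive _ F _ (expR (- g) / D) 0 dF); first by rewrite subr0.
- by move=> s; eapply hasd_continuous; deriv.
- by move=> s; exact: expR_ge0.
- rewrite -[X in _ --> X]mul1r; apply: cvgM; last exact: cvg_cst.
  rewrite -(@expR0 R) -oppr0 -(mulr0 D).
  apply: (@continuous_cvg _ _ _ _ _ (fun x => - (D * expR (g - x))) (@expR R)); first exact: continuous_expR.
  apply: cvgN; apply: cvgM; first exact: cvg_cst.
  rewrite -(mulr0 (expR g)).
  have -> : (fun x => expR (g - x)) = (fun x => expR g * expR (- x)) by apply/funext => x; rewrite expRD.
  by apply: cvgM; [exact: cvg_cst|exact: cvgr_expR].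
- rewrite -[X in _ --> X](mul0r (expR (- g) / D)); apply: cvgM; last exact: cvg_cst.
  apply/cvgNy_compNP.
  have h : D * expR (g + x) @[x --> (+oo : set_system R)] --> +oo.
    apply/cvgryPge => A; near=> x.
    rewrite mulrC -ler_pdivrMr//; apply: (@le_trans _ _ (1 + (g + x))); last exact: expR_ge1Dx.
    rewrite -lerBlDl -lerBlDl; near: x; apply: nbhs_pinfty_ge; exact: num_real.
  have := cvg_comp _ _ h (@cvgr_expR R); apply: cvg_trans.
  by apply: near_eq_cvg; near=> x; rewrite /= opprK.
Unshelve. all: by end_near. Qed.

(** At q = e^k this is q ^ (2 a) exp (- q ^ 2 / 2 - z q) times the Jacobian q, hence the exponent 2
    a + 1. *)
Definition lapk a z k : R := expR ((2 * a + 1) * k - expR (2 * k) / 2 - z * expR k).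

(** [expR hln2] is the square root of 2, so [expR (hln2 + t / 2)] is sqrt (2 x) at x = e^t. *)
Definition hln2 : R := ln 2 / 2.

Lemma expR_2hln2 : expR (2 * hln2) = 2.
Proof. by rewrite /hln2 mulrC divfK ?pnatr_eq0// lnK// posrE. Qed.

(** This equals 2 e^r (cosh r + c), which is where the hyperbolic kernel comes from. *)
Definition quadD c r : R := 1 + 2 * c * expR r + expR (2 * r).

Lemma quadD_gt0 c r : 0 < c -> 0 < quadD c r.
Proof. by move=> c0; rewrite !addr_gt0 ?mulr_gt0 ?expR_gt0. Qed.

(** With these T and k one has e^T + e^(T + s) = e^(g - s) e^(2 r), e^(2 k) / 2 = e^(g - s) + e^g,
    and the linear term of [lapk] is 2 c e^r e^(g - s). So s enters the exponentials only through
    e^(g - s), with total coefficient [quadD c r], and the remaining e^g belongs to a Gamma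
    kernel. *)
Lemma lap_exponent a c g s r (T := g + (2 * r - s - softplus s))
    (k := softplus s - r + (T / 2 + hln2)) :
  expR ((1 / 2 - a) * T - expR T) * gker a (T + s) * expR (- (a * softplus s)) *
    lapk a (expR (hln2 + T / 2) * c) k =
  expR ((2 * a + 1) * hln2) * gker a g * expR (g + r) *
    expR (- s - quadD c r * expR (g - s)).
Proof.
have X12 : expR T + expR (T + s) = expR (g - s) * expR (2 * r).
  rewrite [expR (T + s)]expRD -{1}[expR T]mulr1 -mulrDr -expR_softplus -!expRD.
  by congr expR; rewrite /T; ring.
have X3 : expR (2 * k) = 2 * (expR (g - s) + expR g).
  have -> : expR (g - s) + expR g = expR (g - s) * expR (softplus s).
    by rewrite expR_softplus mulrDr mulr1 -expRD subrK.
  rewrite -{2}expR_2hln2 -!expRD; congr expR.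
  by rewrite /k /T; move: (softplus s) => l; field.
have X4 : expR (hln2 + T / 2) * c * expR k = 2 * c * expR r * expR (g - s).
  have -> : 2 * c * expR r * expR (g - s) = c * (2 * expR (r + (g - s))).
    by rewrite [expR (r + _)]expRD; move: (expR r) (expR (g - s)) => *; ring.
  rewrite -{2}expR_2hln2 -expRD mulrAC mulrC -expRD; congr (_ * expR _).
  by rewrite /k /T; move: (softplus s) => l; field.
rewrite /gker /lapk -!expRD; congr expR.
rewrite X4 X3 /quadD.
have -> : expR T = expR (g - s) * expR (2 * r) - expR (T + s) by rewrite -X12 addrK.
rewrite /k /T; move: (expR (g - s)) (expR (2 * r)) (expR (T + s)) (expR r) (expR g) => w q x y z.
by move: (softplus s) hln2 => l h; field.
Qed.

End LaplaceIdentity.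

Section LaplaceTonelli.
Context {R : realType}.
Local Notation lam := (@lebesgue_measure R).
Local Notation mR := (measurableTypeR R).
Implicit Types (c g r s t x y z k : R).
Variables (a : R) (a0 : 0 < a) (Psi : R -> R) (M : R).
Hypotheses (mPsi : measurable_fun setT Psi) (PsiM : forall p, 0 <= Psi p <= M).
Local Notation gc := (gconv a Psi).

Lemma measurable_lapk z : measurable_fun setT (lapk a z).
Proof. by rewrite /lapk; meas. Qed.

Let H c t s r : R := expR ((1 / 2 - a) * t - expR t) * gker a (t + s) * expR (- (a * softplus s)) *
    lapk a (expR (hln2 + t / 2) * c) (softplus s - r + (t / 2 + hln2)) * gc (t + s + softplus s).

Let mH c : measurable_fun setT ((fun p => H c p.1.1 p.1.2 p.2) : mR * mR * mR -> R).
Proof.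
have m1 : measurable_fun setT (fun p : mR * mR * mR => p.1.1 : R) by exact: measurableT_comp.
have m2 : measurable_fun setT (fun p : mR * mR * mR => p.1.2 : R) by exact: measurableT_comp.
have m3 : measurable_fun setT (fun p : mR * mR * mR => p.2 : R) by exact: measurable_snd.
have ms : measurable_fun setT (fun p : mR * mR * mR => softplus p.1.2 : R).
  exact: (measurableT_comp (@measurable_softplus R) m2).
have mg : measurable_fun setT (fun p : mR * mR * mR => gc (p.1.1 + p.1.2 + softplus p.1.2)).
  by apply: (measurableT_comp (measurable_gconv a0 mPsi PsiM)); meas.
rewrite /H /lapk /gker; apply: measurable_fun_mulf => //; apply: measurable_fun_mulf.
  by apply: measurable_fun_mulf; [apply: measurable_fun_mulf|]; meas.
by meas.
Qed.

Let H0 c t s r : 0 <= H c t s r.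
Proof.
apply: mulr_ge0; last exact: gconv_ge0 PsiM _.
by rewrite !mulr_ge0 ?expR_ge0 ?gker_ge0.
Qed.

(* All substitutions are translations, in this order: x = t + s, then y is
   shifted by - ln (1 + e^s), k = ln (1 + e^s) - r + t / 2 + (ln 2) / 2, and
   t = g + 2 r - s - ln (1 + e^s); the s-integral is then elementary. *)
Lemma laplace_tonelli c : 0 < c ->
  (\int[lam]_t ((\int[lam]_x \int[lam]_y (expR ((1 / 2 - a) * t - expR t) * gker a x * gker a y *
       expR (- expR (x - t + y)) * Psi (x - y))%:E) *
     \int[lam]_k (lapk a (expR (hln2 + t / 2) * c) k)%:E) =
   \int[lam]_r \int[lam]_g (expR ((2 * a + 1) * hln2) * (expR r / quadD c r) *
     (gker a g * gc (g + 2 * r)))%:E)%E.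
Proof.
move=> c0.
transitivity (\int[lam]_t \int[lam]_s \int[lam]_r (H c t s r)%:E)%E.
  apply: eq_integral => t _.
  pose w x := expR ((1 / 2 - a) * t - expR t) * gker a x.
  have w0 x : 0 <= w x by rewrite mulr_ge0 ?expR_ge0 ?gker_ge0.
  pose q s := w (s + t) * expR (- (a * softplus s)) * gc (s + t + softplus s).
  have mgc := measurable_gconv a0 mPsi PsiM.
  have mq : measurable_fun setT q.
    rewrite /q /w /gker; have ms := @measurable_softplus R.
    apply: measurable_fun_mulf; first by meas.
    by apply: (measurableT_comp mgc (_ : measurable_fun setT (fun s => s + t + softplus s))); meas.
  have q0 s : 0 <= q s.
    by apply: mulr_ge0; [rewrite mulr_ge0 ?expR_ge0|exact: gconv_ge0 PsiM _].
  have -> : (\int[lam]_x \int[lam]_y (expR ((1 / 2 - a) * t - expR t) * gker a x * gker a y *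
       expR (- expR (x - t + y)) * Psi (x - y))%:E = \int[lam]_s (q s)%:E)%E.
    transitivity (\int[lam]_x (q (x - t))%:E)%E.
      apply: eq_integral => x _; rewrite (gconv_section a0 mPsi PsiM x (x - t) (w0 x)).
      by rewrite /q subrK.
    have mqt : measurable_fun setT (fun x => (q (x - t))%:E).
      apply/measurable_EFinP; apply: (measurableT_comp mq (_ : measurable_fun setT (fun x : R => x - t))).
      by meas.
    have qt0 x : (0 <= (q (x - t))%:E)%E by rewrite lee_fin.
    apply: (etrans (esym (ge0_integral_shift t mqt qt0))).
    by apply: eq_integral => s _; rewrite addrK.
  set z := expR (hln2 + t / 2) * c.
  have ml := measurable_lapk z.
  have l0 k : 0 <= lapk a z k by exact: expR_ge0.
  rewrite -ge0_integralZr//; last 3 first.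
  - exact/measurable_EFinP.
  - by move=> s _; rewrite lee_fin.
  - by apply: integral_ge0 => k _; rewrite lee_fin.
  apply: eq_integral => s _.
  rewrite -ge0_integralZl_EFin//; last 2 first.
  - by move=> s' _; rewrite lee_fin.
  - exact/measurable_EFinP.
  (* The substitution k = [k0] - r combines a translation with a reflection. *)
  pose k0 := softplus s + (t / 2 + hln2).
  have mlq : measurable_fun setT (fun k => (q s * lapk a z k)%:E).
    by apply/measurable_EFinP; exact: (measurable_fun_mulf (measurable_fun_cstf (q s)) ml).
  have lq0 k : (0 <= (q s * lapk a z k)%:E)%E by rewrite lee_fin; exact: mulr_ge0.
  have -> : (\int[lam]_k ((q s)%:E * (lapk a z k)%:E) = \int[lam]_k (q s * lapk a z k)%:E)%E.
    by apply: eq_integral => k _; rewrite EFinM.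
  have E1 := ge0_integral_shift k0 mlq lq0.
  have mk : measurable_fun setT (fun k : R => k + k0) by meas.
  have E2 := @ge0_integral_oppr _ (fun k => (q s * lapk a z (k + k0))%:E)
    (measurableT_comp mlq mk) (fun k => lq0 _).
  apply: (etrans (esym E1)); apply: (etrans (esym E2)).
    apply: eq_integral => r _; congr EFin; rewrite /q /H /w -/z [s + t]addrC.
    have -> : - r + k0 = softplus s - r + (t / 2 + hln2) by rewrite /k0; ring.
    by rewrite -!mulrA; congr (_ * (_ * (_ * _))); rewrite mulrC.
pose phi s r : R := 2 * r - s - softplus s.
have mphi : measurable_fun setT ((fun p => phi p.1 p.2) : mR * mR -> R).
  have ms : measurable_fun setT (fun p : mR * mR => softplus p.1 : R).
    exact: (measurableT_comp (@measurable_softplus R) measurable_fstR).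
  by have m1 := @measurable_fstR R; have m2 := @measurable_sndR R; rewrite /phi; meas.
rewrite (tonelli3_shift (mH c) mphi (H0 c)).
apply: eq_integral => r _; apply: eq_integral => g _.
have D0 := quadD_gt0 r c0.
pose K := expR ((2 * a + 1) * hln2) * gker a g * expR (g + r) * gc (g + 2 * r).
have -> : (\int[lam]_s (H c (g + phi s r) s r)%:E =
           \int[lam]_s (K * expR (- s - quadD c r * expR (g - s)))%:E)%E.
  apply: eq_integral => s _; congr EFin; rewrite /H /phi lap_exponent /K.
  have -> : g + (2 * r - s - softplus s) + s + softplus s = g + 2 * r by ring.
  by rewrite mulrAC.
under eq_integral do rewrite EFinM.
rewrite ge0_integralZl_EFin//; last 2 first.
- by apply/measurable_EFinP; meas.
- apply: mulr_ge0; last exact: gconv_ge0 PsiM _.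
  by rewrite !mulr_ge0 ?expR_ge0 ?gker_ge0.
rewrite integral_expR_gumbel// -EFinM; congr EFin; rewrite /K.
have E : expR (g + r) = expR g * expR r := expRD g r.
have N : expR g * expR (- g) = 1 by rewrite -expRD subrr expR0.
rewrite E; move: (expR ((2 * a + 1) * hln2)) (expR (- g)) (expR g) N (gker a g) (gc _) => A n e N b h.
transitivity (A * b * (e * n) * expR r * h / quadD c r); last rewrite N; move: (quadD c r)^-1 (expR r) => *; ring.
Qed.

End LaplaceTonelli.

Section LaplaceKernel.
Context {R : realType}.
Local Notation lam := (@lebesgue_measure R).
Local Notation mR := (measurableTypeR R).
Implicit Types (a c m r t z k : R).

(* Euler-type integral of q ^ (2 a) exp (- q ^ 2 / 2 - z q) in the variable k = ln q. *)
Definition lap a z : R := \int[lam]_k lapk a z k.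

Lemma measurable_lap a : measurable_fun setT (lap a).
Proof.
have m : measurable_fun setT ((fun p => lapk a p.1 p.2) : mR * mR -> R).
  by have m1 := @measurable_fstR R; have m2 := @measurable_sndR R; rewrite /lapk; meas.
have mf : measurable_fun setT (fun z : R => (\int[lam]_k (lapk a z k)%:E)%E).
  apply: (@measurable_fun_fubini_tonelli_F _ _ mR mR R lam (fun p => (lapk a p.1 p.2)%:E)).
    exact/measurable_EFinP.
  by move=> p; rewrite lee_fin expR_ge0.
by apply: (measurableT_comp _ mf); exact: fine_measurable.
Qed.

(** For k >= 0, [linear_le_expR] with slope a + 1 at 2 k - ln 2 gives decay at rate 1; for k < 0 the
    rate is 2 a + 1. The range - 1 < 2 a also covers the index - mu of the parabolic cylinder
    function. *)
Lemma lapk_le a z k : -1 < 2 * a -> 0 <= z ->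
  lapk a z k <= expR ((a + 1) ^+ 2 + (a + 1) * ln 2) * expR (- (Num.min 1 (2 * a + 1) * `|k|)).
Proof.
move=> a0 z0; rewrite /lapk -expRD ler_expR.
have zk : 0 <= z * expR k by rewrite mulr_ge0 ?expR_ge0.
have l2 : 0 < ln 2 :> R by apply: ln_gt0; lra.
have a1 : 0 <= a + 1 by lra.
have m1 : Num.min 1 (2 * a + 1) <= 1 by rewrite ge_min lexx.
have m2 : Num.min 1 (2 * a + 1) <= 2 * a + 1 by rewrite ge_min lexx orbT.
move: (Num.min _ _) m1 m2 => b m1 m2.
have [k0|k0] := leP 0 k.
  have := @linear_le_expR R (a + 1) (2 * k - ln 2) a1.
  have -> : expR (2 * k - ln 2) = expR (2 * k) / 2 by rewrite expRD expRN lnK// posrE.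
  by rewrite (ger0_norm k0); move: (expR (2 * k)) zk => e; move: (z * expR k) (ln 2) => y l; nra.
rewrite (ltr0_norm k0); have := expR_ge0 (2 * k).
by move: (expR (2 * k)) zk => e; move: (z * expR k) (ln 2) l2 => y l; nra.
Qed.

Lemma integrable_lapk a z : -1 < 2 * a -> 0 <= z -> lam.-integrable setT (EFin \o lapk a z).
Proof.
move=> a0 z0.
apply: (@integrable_le_expNabs _ _ (Num.min 1 (2 * a + 1)) (expR ((a + 1) ^+ 2 + (a + 1) * ln 2))).
- by rewrite lt_min ltr01; lra.
- exact: measurable_lapk.
by move=> k; rewrite ger0_norm ?expR_ge0//; exact: lapk_le.
Qed.

Lemma lap_ge0 a z : 0 <= lap a z.
Proof. by apply: Rintegral_ge0 => k _; exact: expR_ge0. Qed.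

Definition hcosi c b := \int[lam]_r (cos (b * r) / (cosh r + c)).

Lemma integrable_hcosi c b : 0 < c ->
  lam.-integrable setT (EFin \o (fun r => cos (b * r) / (cosh r + c))).
Proof.
move=> c0; apply: (@integrable_le_invcosh _ _ 1).
  by apply: measurable_fun_mulf; [meas|apply: measurable_inv_coshD; lra].
move=> v; have C := cosh_gt0 v.
rewrite normrM normfV; apply: ler_pM => //; first exact: cos_max.
have D : 0 < cosh v + c by exact: addr_gt0.
by rewrite gtr0_norm// lef_pV2 ?posrE// lerDl ltW.
Qed.

(** At x = e^t this is |Gamma (a + i m)| ^ 2 times W_(mu, i m) (x) e^(- x / 2) L (sqrt (2 x) c),
    with mu = 1 / 2 - a; the measure dt is dx / x. *)
Definition laplw a c m t := expR ((1 / 2 - a) * t - expR t) * tric a m (expR (- t)) *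
  lap a (expR (hln2 + t / 2) * c).

Lemma measurable_laplw a c m : 0 < a -> measurable_fun setT (laplw a c m).
Proof.
move=> a0; rewrite /laplw; apply: measurable_fun_mulf; last first.
  by apply: (measurableT_comp (measurable_lap a)); meas.
apply: measurable_fun_mulf; first by meas.
apply: continuous_measurable_fun => t.
have h := @is_derive_compf _ (fun t => expR (- t)) (tric a m) t _ _ (is_derive_tric m a0 (expR_gt0 (- t)))
  (hasd_exp (hasd_opp (@hasd_id _ t))).
exact: hasd_continuous h.
Qed.

Section Evaluate.
Variables (a m : R) (a0 : 0 < a).
Let Psi p : R := 1 + cos (m * p).

Let mPsi : measurable_fun setT Psi. Proof. by rewrite /Psi; meas. Qed.

Let Psi2 p : 0 <= Psi p <= 2.
Proof. by have := cos_max (m * p); rewrite ler_norml /Psi => /andP[? ?]; apply/andP; split; lra. Qed.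

Let gconvE p : gconv a Psi p = gam a + (cos (m * p) * gamC a m + sin (m * p) * gamS a m).
Proof.
have i1 := integrable_gker a0.
have i2 : lam.-integrable setT (EFin \o (fun y => gker a y * cos (m * y + - (m * p)))).
  exact: integrable_gkerC.
transitivity (\int[lam]_y (gker a y + gker a y * cos (m * y + - (m * p)))).
  apply: eq_Rintegral => y _; rewrite /Psi mulrDr mulr1.
  have -> : m * (p - y) = - (m * y - m * p) by ring.
  by rewrite cosN.
by rewrite RintegralD// gker_phase// cosN sinN mulNr opprK.
Qed.

(** The second Gamma integral has the phase opposite to that of the first, so the terms in sin (2 m
    r) cancel and C ^ 2 + S ^ 2 remains. In [f3] a sine is written as a cosine shifted by - pi / 2,
    so that [gker_phase] serves for both. *)
Let inner r : (\int[lam]_g (gker a g * gconv a Psi (g + 2 * r))%:E)%E =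
  (gam a ^+ 2 + gamN a m * cos (2 * m * r))%:E.
Proof.
have i1 := integrable_gker a0.
have i2 k : lam.-integrable setT (EFin \o (fun y => gker a y * cos (m * y + k))).
  exact: integrable_gkerC.
pose f1 y := gam a * gker a y.
pose f2 y := gamC a m * (gker a y * cos (m * y + 2 * m * r)).
pose f3 y := gamS a m * (gker a y * cos (m * y + (2 * m * r - pi / 2))).
have if1 : lam.-integrable setT (EFin \o f1) by exact: integrable_mulC.
have if2 : lam.-integrable setT (EFin \o f2) by exact: integrable_mulC.
have if3 : lam.-integrable setT (EFin \o f3) by exact: integrable_mulC.
transitivity ((\int[lam]_y (f1 y + (f2 y + f3 y)))%:E).
  rewrite EFin_Rintegral; last exact: integrable_add if1 (integrable_add if2 if3).
  apply: eq_integral => g _; congr EFin; rewrite gconvE /f1 /f2 /f3.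
  rewrite [m * g + (_ - _)]addrA cosBpihalf.
  have -> : m * (g + 2 * r) = m * g + 2 * m * r by ring.
  by move: (cos _) (sin _) => x y; ring.
rewrite RintegralD//; last exact: integrable_add if2 if3.
rewrite RintegralD// !RintegralZl// !gker_phase// -/(gam a) cosBpihalf sinBpihalf /gamN.
by congr EFin; move: (gam a) (gamC a m) (gamS a m) (cos _) (sin _) => *; ring.
Qed.

Lemma laplwD c : 0 < c ->
  (\int[lam]_t (laplw a c 0 t + laplw a c m t)%:E =
   (expR ((2 * a + 1) * hln2) / 2 * (gam a ^+ 2 * hcosi c 0 + gamN a m * hcosi c (2 * m)))%:E)%E.
Proof.
move=> c0; have := laplace_tonelli a0 mPsi Psi2 c0.
have -> : (\int[lam]_r \int[lam]_g (expR ((2 * a + 1) * hln2) * (expR r / quadD c r) *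
     (gker a g * gconv a Psi (g + 2 * r)))%:E)%E =
   (expR ((2 * a + 1) * hln2) / 2 * (gam a ^+ 2 * hcosi c 0 + gamN a m * hcosi c (2 * m)))%:E.
  have i0 := integrable_hcosi 0 c0; have im := integrable_hcosi (2 * m) c0.
  rewrite /hcosi -!RintegralZl// -RintegralD//; last 2 first.
  - exact: integrable_mulC.
  - exact: integrable_mulC.
  have ia := integrable_add (integrable_mulC (gam a ^+ 2) i0) (integrable_mulC (gamN a m) im).
  rewrite -RintegralZl// EFin_Rintegral; last exact: integrable_mulC.
  apply: eq_integral => r _.
  have D0 := quadD_gt0 r c0; have mg := measurable_gconv a0 mPsi Psi2.
  under eq_integral do rewrite EFinM.
  rewrite ge0_integralZl_EFin//; last 3 first.
  - by move=> g _; rewrite lee_fin mulr_ge0 ?gker_ge0//; exact: gconv_ge0 Psi2 _.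
  - apply/measurable_EFinP; apply: measurable_fun_mulf; first exact: measurable_gker.
    by apply: (measurableT_comp mg); meas.
  - by rewrite mulr_ge0 ?expR_ge0// divr_ge0 ?expR_ge0// ltW.
  rewrite inner -EFinM; congr EFin; rewrite mul0r cos0.
  have -> : expR r / quadD c r = 2^-1 * (cosh r + c)^-1.
    have h : quadD c r = 2 * expR r * (cosh r + c).
      rewrite /quadD /cosh; have -> : expR (2 * r) = expR r * expR r by rewrite -expRD; congr expR; ring.
      have -> : expR (- r) = (expR r)^-1 by rewrite expRN.
      by have := expR_gt0 r; move: (expR r) => e e0; field; rewrite gt_eqF.
    rewrite h; have C := addr_gt0 (cosh_gt0 r) c0; have := expR_gt0 r.
    by move: (expR r) (cosh r + c) C => e k k0 e0; field; rewrite !gt_eqF.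
  by move: (gam a ^+ 2) (gamN a m) (cos _) (_ + c)^-1 (expR _) => *; field.
move=> <-; apply: eq_integral => t _.
have a1 : -1 < 2 * a by apply: lt_trans (ltrN10 R) _; exact: mulr_gt0.
have z0 : 0 <= expR (- t) := expR_ge0 _.
have l0 : 0 <= expR (hln2 + t / 2) * c by rewrite mulr_ge0 ?expR_ge0// ltW.
rewrite -(EFin_Rintegral (integrable_lapk a1 l0)) -/(lap a _).
rewrite /laplw -mulrDl EFinM -mulrDr; congr (_ * _)%E.
pose h p : R := gker a p.1 * gker a p.2 * ucos 0 (expR (- t)) p +
  gker a p.1 * gker a p.2 * ucos m (expR (- t)) p.
have i1 := integrable_ucos 0 a0 a0 z0; have i2 := integrable_ucos m a0 a0 z0.
have ih := integrable_mulC (expR ((1 / 2 - a) * t - expR t)) (integrable_add i1 i2).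
rewrite /tric -RintegralD// -RintegralZl//; last exact: integrable_add.
rewrite (Rintegral_prod1 ih); apply: eq_integral => x _; apply: eq_integral => y _.
congr EFin; rewrite /ucos /Psi /= mul0r cos0.
have -> : expR (- t) * expR (x + y) = expR (x - t + y) by rewrite -expRD; congr expR; ring.
by move: (expR ((1 / 2 - a) * t - expR t)) (gker a x) (gker a y) (expR (- expR _)) (cos _) => *; ring.
Qed.

End Evaluate.

End LaplaceKernel.

Section LaplaceTransform.
Context {R : realType}.
Local Notation lam := (@lebesgue_measure R).
Local Notation mR := (measurableTypeR R).
Implicit Types (a c m t z k u : R).

Lemma norm_tric_le a m z : 0 < a -> 0 <= z -> `|tric a m z| <= tric a 0 z.
Proof.
move=> a0 z0; apply: le_trans (le_normr_Rintegral _ _) _ => //; first exact: integrable_ucos.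
apply: le_Rintegral => //.
- have := integrable_ucos m a0 a0 z0; move/integrable_norm; exact.
- exact: integrable_ucos.
move=> p _ /=; rewrite normrM ger0_norm ?mulr_ge0 ?gker_ge0//.
rewrite ler_wpM2l ?mulr_ge0 ?gker_ge0// /ucos normrM ger0_norm ?expR_ge0//.
by rewrite mul0r cos0 ler_wpM2l ?expR_ge0// cos_max.
Qed.

Lemma tric0_ge0 a z : 0 < a -> 0 <= z -> 0 <= tric a 0 z.
Proof. by move=> a0 z0; apply: le_trans (norm_tric_le 0 a0 z0). Qed.

(** For m = 0 the function is nonnegative and [laplwD] shows its integral to be finite; it dominates
    the others since |tric a m| <= tric a 0. *)
Lemma integrable_laplw a c m : 0 < a -> 0 < c -> lam.-integrable setT (EFin \o laplw a c m).
Proof.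
move=> a0 c0; have z0 t : 0 <= expR (- t) := expR_ge0 _.
have w0 t : 0 <= laplw a c 0 t.
  by rewrite !mulr_ge0 ?expR_ge0 ?lap_ge0 ?tric0_ge0.
have i0 : lam.-integrable setT (EFin \o laplw a c 0).
  apply: ge0_integrable => //; first exact: measurable_laplw.
  apply: (@le_lt_trans _ _ (\int[lam]_t (laplw a c 0 t + laplw a c 0 t)%:E)%E).
    apply: ge0_le_integral => //.
    - by move=> t _; rewrite lee_fin.
    - by apply/measurable_EFinP; exact: measurable_laplw.
    - by apply/measurable_EFinP; apply: measurable_fun_addf; exact: measurable_laplw.
    by move=> t _; rewrite lee_fin lerDl.
  by rewrite laplwD// ltry.
apply: (@integrable_le_norm _ mR R lam _ _ _ i0); first exact: measurable_laplw.
move=> t; rewrite /laplw normrM (ger0_norm (lap_ge0 _ _)) ler_wpM2r ?lap_ge0//.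
by rewrite normrM ger0_norm ?expR_ge0// ler_wpM2l ?expR_ge0// norm_tric_le.
Qed.

(** [laplwD] at m and at 0, where [gamN a 0] is [gam a ^+ 2], gives two linear equations for the two
    integrals. *)
Lemma Rintegral_laplw a c m : 0 < a -> 0 < c ->
  \int[lam]_t laplw a c m t = expR ((2 * a + 1) * hln2) / 2 * (gamN a m * hcosi c (2 * m)).
Proof.
move=> a0 c0.
have E n : \int[lam]_t laplw a c 0 t + \int[lam]_t laplw a c n t =
  expR ((2 * a + 1) * hln2) / 2 * (gam a ^+ 2 * hcosi c 0 + gamN a n * hcosi c (2 * n)).
  have i1 := integrable_laplw 0 a0 c0; have i2 := integrable_laplw n a0 c0.
  by rewrite -RintegralD//; apply: EFin_inj; rewrite -laplwD// EFin_Rintegral//; exact: integrable_add.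
have N0 : gamN a 0 = gam a ^+ 2.
  rewrite /gamN /gam.
  have -> : gamC a 0 = gam a by apply: eq_Rintegral => x _; rewrite mul0r cos0 mulr1.
  have -> : gamS a 0 = 0.
    rewrite /gamS /Rintegral -[RHS]/(fine 0%E) -(@integral0 _ _ R lam setT); congr fine.
    by apply: eq_integral => x _; rewrite mul0r sin0 mulr0.
  by rewrite expr0n addr0.
have := E m; have := E 0; rewrite N0 mulr0.
move: (\int[lam]_t laplw a c 0 t) (\int[lam]_t laplw a c m t) (expR _) => x y k.
by move: (hcosi c 0) (hcosi c (2 * m)) (gam a ^+ 2) (gamN a m) => *; lra.
Qed.

Lemma hcosi_cosh m u : 0 < m -> 0 <= u ->
  sinh (2 * pi * m) * (sinh u * hcosi (cosh u) (2 * m)) = 2 * pi * sin (2 * m * u).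
Proof.
move=> m0 u0; have b0 : 0 < 2 * m by rewrite mulr_gt0.
have h1 := sinh_kernel_integral (2 * m) u0; have h2 := sechint_eq b0.
have E : \int[lam]_v (cos (2 * m * v) * (sinh u / (cosh v + cosh u))) =
   sinh u * hcosi (cosh u) (2 * m).
  rewrite /hcosi -RintegralZl//; last by apply: integrable_hcosi; exact: cosh_gt0.
  by apply: eq_Rintegral => v _; rewrite mulrCA.
rewrite E in h1.
have -> : 2 * pi * m = 2 * m * pi by ring.
apply: (mulfI (x := 2 * m)); first by rewrite gt_eqF.
rewrite mulrCA h1 mulrCA h2.
by rewrite mulrC [2 * pi * (2 * m)]mulrC -[LHS]mulrA.
Qed.

(** Differentiation in z brings down q = e^k, which raises the power 2 a - 1 of q by one; the
    integrand of [lap a] at z = 0 is the majorant. *)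
Lemma is_derive_lap a z : 0 < a -> 0 < z -> is_derive z 1 (lap (a - 1 / 2)) (- lap a z).
Proof.
move=> a0 z0; have a1 : -1 < 2 * (a - 1 / 2) by lra.
have a2 : -1 < 2 * a by lra.
have -> : - lap a z = \int[lam]_k - lapk a z k.
  rewrite -mulN1r /lap -RintegralZl//; last by apply: integrable_lapk => //; exact: ltW.
  by apply: eq_Rintegral => k _; rewrite mulN1r.
apply: (@is_derive_Rintegral _ (lapk (a - 1 / 2)) (fun z k => - lapk a z k) (lapk a 0) 0 (z + 1)).
- by rewrite z0 ltrDl ltr01.
- by move=> s /andP[s0 _]; apply: integrable_lapk => //; exact: ltW.
- move=> s v _.
  apply: (@hasd_eq _ _ _ ((0 + - (1 * expR v + s * 0)) * lapk (a - 1 / 2) s v)).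
    apply: (@hasd_exp _ (fun s => (2 * (a - 1 / 2) + 1) * v - expR (2 * v) / 2 - s * expR v)).
    apply: hasd_add; first exact: hasd_cst.
    by apply: hasd_opp; apply: hasd_mul; [exact: hasd_id|exact: hasd_cst].
  have -> : lapk a s v = expR v * lapk (a - 1 / 2) s v.
    by rewrite /lapk -expRD; congr expR; move: (expR v) (expR (2 * v)) => *; field.
  by move: (expR v) (lapk _ _ _) => *; ring.
- by apply: integrable_lapk.
move=> s v /andP[s0 _]; rewrite normrN ger0_norm ?expR_ge0// ler_expR lerD2l lerN2 mul0r.
by rewrite mulr_ge0 ?expR_ge0 ?ltW.
Qed.

End LaplaceTransform.

(** * Orthogonality and termwise integration *)

Section Orthogonality.
Context {R : realType}.
Local Notation lam := (@lebesgue_measure R).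
Implicit Types (a c t z k u : R) (m n : nat).

Lemma sin_2pin n : sin (2 * n%:R * pi) = 0 :> R.
Proof.
have -> : 2 * n%:R * pi = 0 + pi *+ 2 *+ n :> R.
  by rewrite add0r -[pi *+ 2 *+ n]mulr_natl -[pi *+ 2]mulr_natl; ring.
by rewrite (periodicn (@sinD2pi R)) sin0.
Qed.

Lemma integral_sin_sin n m : (0 < n)%N -> (0 < m)%N ->
  (\int[lam]_(u in `[(0 : R)%R, pi]) (sin (2 * n%:R * u) * sin (2 * m%:R * u))%:E =
   (if m == n then pi / 2 else 0)%:E)%E.
Proof.
move=> n0 m0; pose x : R := 2 * n%:R; pose y : R := 2 * m%:R.
have x0 : 0 < x by rewrite mulr_gt0// ltr0n.
have y0 : 0 < y by rewrite mulr_gt0// ltr0n.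
have sx : sin (x * pi) = 0 by exact: sin_2pin.
have sy : sin (y * pi) = 0 by exact: sin_2pin.
have dl w (u : R) : hasd (fun u => w * u) u w.
  by apply: (@hasd_eq _ _ _ (0 * u + w * 1)); [apply: hasd_mul; [exact: hasd_cst|exact: hasd_id]|ring].
have cf : continuous (fun u : R => sin (x * u) * sin (y * u)).
  move=> u; eapply hasd_continuous; apply: hasd_mul; exact: hasd_sin (dl _ u).
have s2 (u : R) : sin (x * u) * sin (y * u) = (cos (x * u - y * u) - cos (x * u + y * u)) / 2.
  by rewrite cosB cosD; move: (cos _) (sin (x * u)) (cos _) (sin (y * u)) => *; field.
have [mn|mn] := eqVneq m n.
  pose F u : R := (u - sin ((x + y) * u) / (x + y)) / 2.
  rewrite (@integral_itv_derive _ F _ _ _ (pi_ge0 R) _ cf).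
    rewrite /F [(x + y) * pi]mulrDl sinD sx sy mulr0 mul0r !addr0 mulr0 sin0 mul0r subrr mul0r !subr0.
    by [].
  move=> u; apply: (@hasd_eq _ _ _ ((1 + - ((x + y) * cos ((x + y) * u) * (x + y)^-1 +
      sin ((x + y) * u) * 0)) * 2^-1 + (u - sin ((x + y) * u) / (x + y)) * 0)).
    apply: hasd_mul; last exact: hasd_cst.
    apply: hasd_add; first exact: hasd_id.
    apply: hasd_opp; apply: hasd_mul; last exact: hasd_cst.
    exact: hasd_sin (dl _ u).
  rewrite s2 -mulrDl -mulrBl; have -> : x - y = 0 by rewrite /x /y mn subrr.
  rewrite mul0r cos0; have n1 : x + y != 0 by rewrite gt_eqF// addr_gt0.
  by move: (x + y) n1 (cos _) (sin _) => w n1 p q; field.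
have xy : x - y != 0.
  by rewrite subr_eq0 /x /y (inj_eq (mulfI _)) ?pnatr_eq0// eqr_nat eq_sym.
pose F u : R := (sin ((x - y) * u) / (x - y) - sin ((x + y) * u) / (x + y)) / 2.
rewrite (@integral_itv_derive _ F _ _ _ (pi_ge0 R) _ cf).
  rewrite /F [(x + y) * pi]mulrDl [(x - y) * pi]mulrBl sinB sinD sx sy !mulr0 !mul0r !sin0 !mul0r.
  by rewrite !(addr0, subr0, mul0r).
move=> u; apply: (@hasd_eq _ _ _ ((((x - y) * cos ((x - y) * u) * (x - y)^-1 +
      sin ((x - y) * u) * 0) + - ((x + y) * cos ((x + y) * u) * (x + y)^-1 +
      sin ((x + y) * u) * 0)) * 2^-1 + (sin ((x - y) * u) / (x - y) - sin ((x + y) * u) / (x + y)) * 0)).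
  apply: hasd_mul; last exact: hasd_cst.
  apply: hasd_add; last apply: hasd_opp; apply: hasd_mul; try exact: hasd_cst; exact: hasd_sin (dl _ u).
rewrite s2 -mulrDl -mulrBl; have n1 : x + y != 0 by rewrite gt_eqF// addr_gt0.
move: (x + y) n1 (x - y) xy => w n1 w' n2.
by move: (cos (w * u)) (sin (w * u)) (cos _) (sin _) => *; field; rewrite n1 n2.
Qed.

(* [tric a m (1 / x)] with the weight x ^ (1 / 2 - a) exp (- x), in the variable t = ln x. *)
Definition wker a m t : R := expR ((1 / 2 - a) * t - expR t) * tric a m%:R (expR (- t)).

Lemma laplwE a c m t : laplw a c m%:R t = wker a m t * lap a (expR (hln2 + t / 2) * c).
Proof. by []. Qed.

Lemma continuous_wker a m : 0 < a -> continuous (wker a m).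
Proof.
move=> a0 t; apply: cvgM.
  have h1 : hasd (fun t => expR ((1 / 2 - a) * t - expR t)) t
      ((0 * t + (1 / 2 - a) * 1 - 1 * expR t) * expR ((1 / 2 - a) * t - expR t)).
    apply: (@hasd_exp _ (fun t => (1 / 2 - a) * t - expR t)); apply: hasd_add.
      by apply: hasd_mul; [exact: hasd_cst|exact: hasd_id].
    by apply: hasd_opp; apply: (@hasd_exp _ (fun t => t)); exact: hasd_id.
  exact: hasd_continuous h1.
have h := @is_derive_compf _ (fun t => expR (- t)) (tric a m%:R) t _ _
  (is_derive_tric m%:R a0 (expR_gt0 (- t))) (hasd_exp (hasd_opp (@hasd_id _ t))).
exact: hasd_continuous h.
Qed.

Lemma measurable_wker a m : 0 < a -> measurable_fun setT (wker a m).
Proof. by move=> a0; apply: continuous_measurable_fun; exact: continuous_wker. Qed.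

(** The exponent 1 / 2 - a of the weight and a - eps from [tric_le] add up to 1 / 2 - eps, so for
    eps < 1 / 2 the majorant is an integrable Gamma kernel. *)
Lemma wker_le a eps th : 0 < eps -> eps < a -> 0 <= th < pi / 2 ->
  exists2 C : R, 0 <= C & forall m t, `|wker a m t| <= C * expR (- (2 * th * m%:R)) * gker (1 / 2 - eps) t.
Proof.
move=> e0 ea thI; have [C C0 H] := tric_le e0 ea thI; exists C => // m t.
rewrite normrM ger0_norm ?expR_ge0//.
have := H m%:R (expR t) (ler0n _ m) (expR_gt0 t); rewrite -expRN expRK.
have -> : 2 * m%:R * th = 2 * th * m%:R by ring.
move=> Ht; apply: le_trans (ler_wpM2l (expR_ge0 _) Ht) _.
rewrite mulrC -!mulrA; apply: ler_wpM2l => //; rewrite -expRD.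
apply: ler_wpM2l; first exact: expR_ge0.
by rewrite /gker ler_expR le_eqVlt; apply/orP; left; apply/eqP; ring.
Qed.

End Orthogonality.

Section SineProjection.
Context {R : realType}.
Local Notation lam := (@lebesgue_measure R).
Local Notation lam2 := (lam \x lam)%E.
Local Notation mR := (measurableTypeR R).
Implicit Types (a c t z k u : R) (m n : nat).

(** The indicator turns the integral over [0, pi] into one over the line, so that Fubini's theorem
    for the product of the line with itself applies. *)
Definition angk n u : R := \1_(`[(0 : R), pi]%classic) u * (sin (2 * n%:R * u) * sinh u).

Lemma measurable_sinh : measurable_fun setT (@sinh R).
Proof. by apply: continuous_measurable_fun => v; exact: hasd_continuous (hasd_sinh v). Qed.

Lemma measurable_indic_itv : measurable_fun setT (\1_(`[(0 : R), pi]%classic) : R -> R).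
Proof.
have h : measurable (`[(0 : R), pi]%classic : set mR) by exact: measurable_itv.
exact: (@measurable_indic _ mR R setT _ h).
Qed.

Lemma measurable_angk n : measurable_fun setT (angk n).
Proof.
rewrite /angk; apply: (measurable_fun_mulf measurable_indic_itv).
by apply: measurable_fun_mulf; [meas|exact: measurable_sinh].
Qed.

Lemma cosh_le_pi u : 0 <= u -> u <= pi -> cosh u <= cosh pi.
Proof.
move=> u0 u1; apply: (@le_is_derive _ (@cosh R) (@sinh R) u pi) => // v /andP[uv _].
  exact: hasd_cosh.
have v0 := le_trans u0 uv; have := sinh_ge v0; rewrite /sinh => h.
by rewrite divr_ge0//; apply: le_trans h; rewrite mulr_ge0.
Qed.

Lemma norm_angk_le n u : `|angk n u| <= cosh pi * \1_(`[(0 : R), pi]%classic) u.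
Proof.
rewrite /angk indicE; case: (boolP (u \in _)) => [|_]; last by rewrite mul0r mulr0 normr0.
rewrite inE/= in_itv/= mul1r mulr1 => /andP[u0 u1]; rewrite normrM -[leRHS]mul1r.
apply: ler_pM => //; first exact: sin_max.
by apply: le_trans (norm_sinh_le_cosh u) _; exact: cosh_le_pi.
Qed.

Lemma integrable_indic_itv :
  lam.-integrable setT (EFin \o (\1_(`[(0 : R), pi]%classic) : R -> R)).
Proof.
apply: (@ge0_integrable _ mR R lam _ measurable_indic_itv) => //.
have := @integral_indic _ _ R lam setT measurableT `[(0 : R), pi]%classic.
move=> ->//; rewrite setIT.
have E := @lebesgue_measure_itv R `[0, pi]; rewrite /= lte_fin pi_gt0 in E.
by apply: (eq_ind_r (fun x => (x < +oo)%E) _ E); rewrite -EFinB ltry.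
Qed.

Lemma integrable_angk n : lam.-integrable setT (EFin \o angk n).
Proof.
apply: (@integrable_le_norm _ mR R lam _ _ (measurable_angk n) (integrable_mulC (cosh pi) integrable_indic_itv)).
exact: norm_angk_le.
Qed.

(** Up to elementary factors this is Phi_n at x = e^t after the integration by parts (see
    [PhiE]). *)
Definition sinproj a n t := \int[lam]_u (angk n u * lap a (expR (hln2 + t / 2) * cosh u)).

Lemma lap_le a z : 0 < a -> 0 <= z -> lap a z <= lap a 0.
Proof.
move=> a0 z0; have a1 : -1 < 2 * a by apply: lt_trans (ltrN10 R) _; exact: mulr_gt0.
apply: le_Rintegral => //; [exact: integrable_lapk|exact: integrable_lapk|].
move=> k _; rewrite ler_expR lerD2l lerN2 mul0r.
by rewrite mulr_ge0 ?expR_ge0.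
Qed.

Lemma lap_arg_ge0 t u : 0 <= expR (hln2 + t / 2) * cosh u.
Proof. by rewrite mulr_ge0 ?expR_ge0// ltW// cosh_gt0. Qed.

Lemma measurable_angk_lap a n : measurable_fun setT
  ((fun p => angk n p.2 * lap a (expR (hln2 + p.1 / 2) * cosh p.2)) : mR * mR -> R).
Proof.
apply: measurable_fun_mulf; first exact: (measurableT_comp (measurable_angk n) measurable_sndR).
apply: (measurableT_comp (measurable_lap a)); apply: measurable_fun_mulf.
  by have m1 := @measurable_fstR R; meas.
exact: (measurableT_comp (@measurable_cosh R) measurable_sndR).
Qed.

Lemma integrable_angk_lap a n t : 0 < a ->
  lam.-integrable setT (EFin \o (fun u => angk n u * lap a (expR (hln2 + t / 2) * cosh u))).
Proof.
move=> a0.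
apply: (@integrable_le_norm _ mR R lam _ (fun u => lap a 0 * `|angk n u|)).
- exact: (measurable_section1 t (measurable_angk_lap a n)).
- apply: integrable_mulC; have := integrable_angk n; move/integrable_norm; exact.
move=> u; rewrite normrM (ger0_norm (lap_ge0 _ _)) mulrC.
by apply: ler_wpM2r => //; apply: lap_le => //; exact: lap_arg_ge0.
Qed.

Lemma sinproj_le a n t : 0 < a -> `|sinproj a n t| <= lap a 0 * \int[lam]_u `|angk n u|.
Proof.
move=> a0; apply: le_trans (le_normr_Rintegral _ _) _ => //; first exact: integrable_angk_lap.
have ia : lam.-integrable setT (EFin \o (fun u => `|angk n u|)).
  by have := integrable_angk n; move/integrable_norm; exact.
rewrite -RintegralZl//; apply: le_Rintegral => //.
- have := integrable_angk_lap n t a0; move/integrable_norm; exact.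
- exact: integrable_mulC.
move=> u _; rewrite normrM (ger0_norm (lap_ge0 _ _)) mulrC.
by apply: ler_wpM2r => //; apply: lap_le => //; exact: lap_arg_ge0.
Qed.

Lemma integrable_mul_angk_lap a n (w : R -> R) : 0 < a -> lam.-integrable setT (EFin \o w) ->
  lam2.-integrable setT (EFin \o
    (fun p => w p.1 * (angk n p.2 * lap a (expR (hln2 + p.1 / 2) * cosh p.2)))).
Proof.
move=> a0 iw; have i1 := integrable_prod iw (integrable_angk n).
have i2 := integrable_norm i1.
apply: (@integrable_le_norm _ (mR * mR)%type R lam2 _ (fun p => lap a 0 * `|w p.1 * angk n p.2|)).
- apply: measurable_fun_mulf; last exact: measurable_angk_lap.
  have mw : measurable_fun setT w by apply/measurable_EFinP; exact: measurable_int iw.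
  exact: (measurableT_comp mw measurable_fstR).
- exact: (integrable_mulC (lap a 0) i2).
move=> p; rewrite mulrA normrM mulrC; apply: ler_wpM2r => //.
by rewrite (ger0_norm (lap_ge0 _ _)); apply: lap_le => //; exact: lap_arg_ge0.
Qed.

(** Deduced from differentiability on a window of radius 1 around t; on the support of [angk] one
    has cosh u <= cosh pi, which gives an integrable majorant. *)
Lemma continuous_sinproj a n : 0 < a -> continuous (sinproj a n).
Proof.
move=> a0 t; have h0 : 0 < a + 1 / 2 by rewrite addr_gt0.
pose F s u : R := angk n u * lap a (expR (hln2 + s / 2) * cosh u).
pose D s u : R := angk n u *
  (2^-1 * expR (hln2 + s / 2) * cosh u * - lap (a + 1 / 2) (expR (hln2 + s / 2) * cosh u)).
pose K := expR (hln2 + (t + 1) / 2) * cosh pi * lap (a + 1 / 2) 0.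
have ia : lam.-integrable setT (EFin \o (fun u => K * `|angk n u|)).
  by apply: integrable_mulC; have := integrable_angk n; move/integrable_norm; exact.
have dF (s u : R) : t - 1 < s < t + 1 -> is_derive s 1 (fun s => F s u) (D s u).
  move=> _; pose z := expR (hln2 + s / 2) * cosh u.
  have z0 : 0 < z by rewrite mulr_gt0 ?expR_gt0 ?cosh_gt0.
  have dl := is_derive_lap h0 z0; rewrite (addrK (1 / 2) a) in dl.
  have dz : hasd (fun s => expR (hln2 + s / 2) * cosh u) s (2^-1 * expR (hln2 + s / 2) * cosh u).
    apply: (@hasd_eq _ _ _ ((0 + (1 * 2^-1 + s * 0)) * expR (hln2 + s / 2) * cosh u +
      expR (hln2 + s / 2) * 0)).
      apply: hasd_mul; last exact: hasd_cst.
      apply: (@hasd_exp _ (fun s => hln2 + s / 2)); apply: hasd_add; first exact: hasd_cst.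
      by apply: hasd_mul; [exact: hasd_id|exact: hasd_cst].
    by move: (expR _) (cosh u) => *; ring.
  have dc := @is_derive_compf _ (fun s => expR (hln2 + s / 2) * cosh u) (lap a) s _ _ dl dz.
  apply: (@hasd_eq _ _ _ (0 * lap a z + angk n u *
     (2^-1 * expR (hln2 + s / 2) * cosh u * - lap (a + 1 / 2) z))).
    by apply: hasd_mul; [exact: hasd_cst|exact: dc].
  by rewrite mul0r add0r.
have Dg s u : t - 1 < s < t + 1 -> `|D s u| <= K * `|angk n u|.
  move=> /andP[_ s1]; rewrite normrM mulrC.
  have [uI|uI] := boolP (u \in `[(0 : R), pi]%classic); last first.
    have -> : angk n u = 0 by rewrite /angk indicE (negbTE uI) mul0r.
    by rewrite normr0 !mulr0.
  have /andP[u0 u1] : 0 <= u <= pi by move: uI; rewrite inE/= in_itv.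
  apply: ler_wpM2r => //; rewrite normrM normrN (ger0_norm (lap_ge0 _ _)).
  have C0 := cosh_gt0 u; have e0 := expR_gt0 (hln2 + s / 2).
  apply: ler_pM => //; [exact: lap_ge0| |apply: lap_le => //; exact: lap_arg_ge0].
  rewrite ger0_norm; last by rewrite !mulr_ge0// ltW.
  apply: ler_pM; [by rewrite mulr_ge0// ltW|exact: ltW| |exact: cosh_le_pi].
  apply: (@le_trans _ _ (expR (hln2 + s / 2))); last by rewrite ler_expR; lra.
  by move: e0; move: (expR _) => e e0; lra.
have tI : t - 1 < t < t + 1 by rewrite ltrDl ltrBlDr ltrDl ltr01.
have := @is_derive_Rintegral _ F D (fun u => K * `|angk n u|) (t - 1) (t + 1) t tI
  (fun s _ => integrable_angk_lap n s a0) dF ia Dg.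
exact: hasd_continuous.
Qed.

Lemma measurable_sinproj a n : 0 < a -> measurable_fun setT (sinproj a n).
Proof. by move=> a0; apply: continuous_measurable_fun; exact: continuous_sinproj. Qed.

Lemma integrable_mul_sinproj a n (w : R -> R) : 0 < a -> lam.-integrable setT (EFin \o w) ->
  lam.-integrable setT (EFin \o (fun t => w t * sinproj a n t)).
Proof.
move=> a0 iw; have mw : measurable_fun setT w by apply/measurable_EFinP; exact: measurable_int iw.
pose B := lap a 0 * \int[lam]_u `|angk n u|.
apply: (@integrable_le_norm _ mR R lam _ (fun t => B * `|w t|)).
- by apply: measurable_fun_mulf => //; exact: measurable_sinproj.
- by apply: integrable_mulC; have := iw; move/integrable_norm; exact.
by move=> t; rewrite normrM mulrC; apply: ler_wpM2r => //; exact: sinproj_le.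
Qed.

Lemma integrable_wker a m : 0 < a -> lam.-integrable setT (EFin \o wker a m).
Proof.
move=> a0; pose e := Num.min a (1 / 2) / 2.
have h : 0 < Num.min a (1 / 2) by rewrite lt_min a0; lra.
have h1 : Num.min a (1 / 2) <= a by rewrite ge_min lexx.
have h2 : Num.min a (1 / 2) <= 1 / 2 by rewrite ge_min lexx orbT.
have e0 : 0 < e by rewrite /e; lra.
have ea : e < a by rewrite /e; lra.
have pI : 0 <= (0 : R) < pi / 2 by rewrite lexx divr_gt0// pi_gt0.
have [C C0 H] := wker_le e0 ea pI.
have g0 : 0 < 1 / 2 - e by rewrite /e; lra.
apply: (@integrable_le_norm _ mR R lam _ _ (measurable_wker m a0)
  (integrable_mulC (C * expR (- (2 * 0 * m%:R))) (integrable_gker g0))).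
by move=> t; exact: H.
Qed.

(** After the exchange of integrals, the factor sinh u of [angk] absorbs the denominator sinh u of
    the cosine integral ([hcosi_cosh]); what remains is sin (2 m u), and orthogonality applies. *)
Lemma integral_wker_sinproj a n m : 0 < a -> (0 < n)%N -> (0 < m)%N ->
  \int[lam]_t (wker a m t * sinproj a n t) =
  expR ((2 * a + 1) * hln2) * gamN a m%:R * pi / sinh (2 * pi * m%:R) *
    (if m == n then pi / 2 else 0).
Proof.
move=> a0 n0 m0; have m0' : 0 < m%:R :> R by rewrite ltr0n.
have s0 : sinh (2 * pi * m%:R) != 0 :> R.
  have := @sinh_ge R (2 * pi * m%:R); rewrite /sinh.
  have p : 0 < 2 * pi * m%:R :> R by rewrite !mulr_gt0// pi_gt0.
  by move=> /(_ (ltW p)) h; rewrite gt_eqF// divr_gt0//; apply: lt_le_trans h; rewrite mulr_gt0.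
have i1 := integrable_mul_angk_lap n a0 (integrable_wker m a0).
pose K := expR ((2 * a + 1) * hln2) * gamN a m%:R * pi / sinh (2 * pi * m%:R).
have i2 : lam.-integrable setT (EFin \o (fun u => \1_(`[(0 : R), pi]%classic) u *
    (sin (2 * n%:R * u) * sin (2 * m%:R * u)))).
  apply: (@integrable_le_norm _ mR R lam _ _ _ integrable_indic_itv).
    by apply: (measurable_fun_mulf measurable_indic_itv); meas.
  move=> u; rewrite normrM normrM ger0_norm ?indicE//.
  by rewrite -[leRHS]mulr1 ler_wpM2l// -[leRHS]mulr1 ler_pM// sin_max.
apply: EFin_inj.
transitivity (\int[lam2]_p (wker a m p.1 * (angk n p.2 * lap a (expR (hln2 + p.1 / 2) * cosh p.2))))%:E.
  rewrite (Rintegral_prod1 i1) (EFin_Rintegral (integrable_mul_sinproj n a0 (integrable_wker m a0))).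
  apply: eq_integral => t _ /=; rewrite /sinproj -RintegralZl//; last exact: integrable_angk_lap.
  by rewrite (EFin_Rintegral (integrable_mulC (wker a m t) (integrable_angk_lap n t a0))).
rewrite (Rintegral_prod2 i1).
transitivity (\int[lam]_u (K * (\1_(`[(0 : R), pi]%classic) u *
    (sin (2 * n%:R * u) * sin (2 * m%:R * u))))%:E)%E.
  apply: eq_integral => u _ /=; rewrite /angk indicE.
  case: (boolP (u \in _)) => [|_]; last first.
    rewrite !mul0r mulr0; under eq_integral do rewrite !mul0r mulr0.
    by rewrite integral0.
  rewrite inE/= in_itv/= => /andP[u0 u1]; rewrite !mul1r.
  pose A := sin (2 * n%:R * u) * sinh u.
  have -> : (\int[lam]_t (wker a m t * (A * lap a (expR (hln2 + t / 2) * cosh u)))%:E =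
     \int[lam]_t (A * laplw a (cosh u) m%:R t)%:E)%E.
    by apply: eq_integral => t _; rewrite laplwE mulrCA.
  have il := integrable_laplw m%:R a0 (cosh_gt0 u).
  rewrite -EFin_Rintegral; last exact: integrable_mulC.
  rewrite RintegralZl// Rintegral_laplw//; last exact: cosh_gt0.
  congr EFin; rewrite /A /K.
  have h : sinh u * hcosi (cosh u) (2 * m%:R) = 2 * pi * sin (2 * m%:R * u) / sinh (2 * pi * m%:R).
    by rewrite -(hcosi_cosh m0' u0) [sinh (2 * pi * _) * _]mulrC mulfK.
  transitivity (sin (2 * n%:R * u) * (expR ((2 * a + 1) * hln2) / 2 * gamN a m%:R) *
    (sinh u * hcosi (cosh u) (2 * m%:R))).
    by move: (sin _) (sinh u) (expR _) (gamN _ _) (hcosi _ _) => *; ring.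
  rewrite h; move: s0; move: (sinh (2 * pi * m%:R)) => S s0.
  move: (sin (2 * m%:R * u)) => y; move: (sin (2 * n%:R * u)) => x.
  by move: (expR _) (gamN _ _) (@pi R) => *; field.
rewrite -EFin_Rintegral; last exact: (integrable_mulC K i2).
rewrite RintegralZl// -/K; congr ((_ * _)%R)%:E; apply: EFin_inj.
rewrite (EFin_Rintegral i2) -(integral_sin_sin n0 m0) [RHS]integral_mkcond.
by apply: (@eq_integral _ mR R lam) => u _; rewrite epatch_indic/= -EFinM mulrC.
Qed.

End SineProjection.

Section Series.
Context {R : realType}.
Local Notation lam := (@lebesgue_measure R).
Local Notation mR := (measurableTypeR R).
Implicit Types (a t : R) (n N : nat).

Lemma cvg_sum_norm (u : nat -> R) (S : R) :
  (forall N, \sum_(1 <= m < N.+1) `|u m| <= S) ->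
  cvgn (fun N => \sum_(1 <= m < N.+1) u m).
Proof.
move=> uS; pose v k := u k.+1.
have E (w : nat -> R) N : \sum_(1 <= m < N.+1) w m = series (fun k => w k.+1) N.
  by rewrite big_add1.
have -> : (fun N => \sum_(1 <= m < N.+1) u m) = series v by apply/funext => N; exact: E.
apply: normed_cvg; apply: nondecreasing_is_cvgn.
  by apply: nondecreasing_series => k _ _; exact: normr_ge0.
exists S => _ [N _ <-]; have := uS N; rewrite E; exact.
Qed.

Variables (a delta : R) (b : nat -> R) (S : R) (n : nat).
Hypotheses (a0 : 0 < a) (deltaI : 0 <= delta < pi / 2) (n0 : (0 < n)%N).
Hypothesis bS : forall N, \sum_(1 <= m < N.+1) `|b m| * expR (- (2 * delta * m%:R)) <= S.

Let psum N t := \sum_(1 <= m < N.+1) b m * wker a m t.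
(** With b_m the real or imaginary part of a_m / |Gamma (a + i m)| ^ 2, this is the corresponding
    part of f at x = e^t (see [index_whittakerE]). *)
Definition wseries t : R := limn (fun N => \sum_(1 <= m < N.+1) b m * wker a m t).

Let wbound : exists2 eps, 0 < 1 / 2 - eps & exists2 C : R, 0 <= C & forall m t,
  `|wker a m t| <= C * expR (- (2 * delta * m%:R)) * gker (1 / 2 - eps) t.
Proof.
pose e := Num.min a (1 / 2) / 2.
have h : 0 < Num.min a (1 / 2) by rewrite lt_min a0; lra.
have h1 : Num.min a (1 / 2) <= a by rewrite ge_min lexx.
have h2 : Num.min a (1 / 2) <= 1 / 2 by rewrite ge_min lexx orbT.
have e0 : 0 < e by rewrite /e; lra.
have ea : e < a by rewrite /e; lra.
exists e; first by rewrite /e; lra.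
exact: wker_le e0 ea deltaI.
Qed.

(** The factor e^(- 2 delta m) gained by the contour shift is exactly the weight under which the
    coefficients are summable, so the majorant is uniform in N. *)
Let bound : exists2 e, 0 < e & exists2 C : R, 0 <= C &
  forall N t, \sum_(1 <= m < N.+1) `|b m * wker a m t| <= C * gker e t.
Proof.
have [e e0 [C C0 H]] := wbound.
have S0 : 0 <= S by have := bS 0; rewrite big_geq.
exists (1 / 2 - e) => //; exists (C * S); first exact: mulr_ge0.
move=> N t; apply: (@le_trans _ _ (\sum_(1 <= m < N.+1) (C * gker (1 / 2 - e) t) *
    (`|b m| * expR (- (2 * delta * m%:R))))).
  apply: ler_sum => m _; rewrite normrM.
  have -> : C * gker (1 / 2 - e) t * (`|b m| * expR (- (2 * delta * m%:R))) =
      `|b m| * (C * expR (- (2 * delta * m%:R)) * gker (1 / 2 - e) t).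
    by move: (gker _ _) `|b m| (expR _) => *; ring.
  exact: ler_wpM2l.
rewrite -mulr_sumr [leRHS]mulrAC; apply: ler_wpM2l => //.
by rewrite mulr_ge0 ?gker_ge0.
Qed.

Lemma cvg_wseries t : psum N t @[N --> \oo] --> wseries t.
Proof.
have [e _ [C _ H]] := bound; exact: (cvg_sum_norm (H^~ t)).
Qed.

Let continuous_psum N : continuous (psum N).
Proof.
elim: N => [|k IH] t.
  have -> : psum 0 = fun=> 0 by apply/funext => s; rewrite /psum big_geq.
  exact: cvg_cst.
have -> : psum k.+1 = fun s => psum k s + b k.+1 * wker a k.+1 s.
  by apply/funext => s; rewrite /psum big_nat_recr.
apply: cvgD; first exact: IH.
by apply: cvgM; [exact: cvg_cst|exact: continuous_wker].
Qed.

Lemma integral_psum N : \int[lam]_t (psum N t * sinproj a n t) =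
  \sum_(1 <= m < N.+1) b m * \int[lam]_t (wker a m t * sinproj a n t).
Proof.
have iw m := integrable_mul_sinproj n a0 (integrable_wker m a0).
have ip k : lam.-integrable setT (EFin \o psum k).
  elim: k => [|k IH].
    apply: (@integrable_ext _ mR R lam (fun t => 0 * wker a 1 t)).
      by move=> t; rewrite mul0r /psum big_geq.
    exact: (integrable_mulC 0 (integrable_wker 1 a0)).
  apply: (@integrable_ext _ mR R lam (fun t => psum k t + b k.+1 * wker a k.+1 t)).
    by move=> t; rewrite /psum [RHS]big_nat_recr.
  exact: (integrable_add IH (integrable_mulC (b k.+1) (integrable_wker k.+1 a0))).
elim: N => [|k IH].
  rewrite [RHS]big_geq// /Rintegral -[RHS]/(fine 0%E) -(@integral0 _ mR R lam setT); congr fine.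
  by apply: eq_integral => t _; rewrite /psum big_geq// mul0r.
rewrite [RHS]big_nat_recr//= -IH -RintegralZl// -RintegralD//.
- apply: eq_Rintegral => t _; rewrite /psum big_nat_recr//= mulrDl.
  by rewrite [in RHS]mulrA.
- exact: (integrable_mul_sinproj n a0 (ip k)).
- exact: (integrable_mulC (b k.+1) (iw k.+1)).
Qed.

Local Notation D := (`](0 : R)%R, +oo[%classic).

Lemma measurable_fun_pos (f : R -> R) : (forall x : R, 0 < x -> {for x, continuous f}) ->
  measurable_fun D f.
Proof.
move=> cf; apply: open_continuous_measurable_fun; first exact: interval_open.
by move=> x /[!inE]/= /[!in_itv]/= /andP[x0 _]; exact: cf.
Qed.

Lemma continuous_lnV (h : R -> R) (x : R) : continuous h -> 0 < x ->
  {for x, continuous (fun x => h (ln x) / x)}.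
Proof.
move=> ch x0; apply: cvgM.
  by apply: continuous_comp; [exact: continuous_ln|exact: ch].
by apply: cvgV; [rewrite gt_eqF|exact: cvg_id].
Qed.

(** Dominated convergence for the partial sums, with a Gamma kernel as majorant. From N = n on,
    orthogonality makes the integral of the partial sum constant and equal to its n-th term. *)
Lemma wseries_sinproj (f := fun x : R => wseries (ln x) * sinproj a n (ln x) / x) :
  and (lam.-integrable D (EFin \o f))
  ((\int[lam]_(x in D) (f x)%:E)%E =
    (b n * (expR ((2 * a + 1) * hln2) * gamN a n%:R * pi / sinh (2 * pi * n%:R) * (pi / 2)))%:E).
Proof.
have [e e0 [C C0 H]] := bound.
have cP := @continuous_sinproj R a n a0.
pose g N t := psum N t * sinproj a n t.
have cg N : continuous (g N) by move=> t; apply: cvgM; [exact: continuous_psum|exact: cP].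
pose B := C * (lap a 0 * \int[lam]_u `|angk n u|).
have B0 : 0 <= B.
  apply: mulr_ge0 => //; apply: mulr_ge0; first exact: lap_ge0.
  by apply: Rintegral_ge0 => u _; exact: normr_ge0.
have gB N t : `|g N t| <= B * gker e t.
  have P := sinproj_le n t a0; have h := H N t; rewrite normrM /B [leRHS]mulrAC.
  apply: ler_pM => //; apply: le_trans h; exact: ler_norm_sum.
pose fN N x : R := g N (ln x) / x.
have mfN N : measurable_fun D (fN N).
  by apply: measurable_fun_pos => x x0; exact: (continuous_lnV (cg N)).
have ff x : fN N x @[N --> \oo] --> f x.
  apply: cvgM; last exact: cvg_cst.
  by apply: cvgM; [exact: cvg_wseries|exact: cvg_cst].
have mf : measurable_fun D f.
  by apply: (@measurable_fun_cvg _ mR R D fN _ mfN) => x _; exact: ff.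
pose G x : R := B * gker e (ln x) / x.
have cG (x : R) : 0 < x -> {for x, continuous G}.
  apply: (@continuous_lnV (fun t => B * gker e t)) => t.
  by apply: cvgM; [exact: cvg_cst|exact: continuous_gker].
have G0 (x : R) : 0 < x -> 0 <= G x.
  by move=> x0; apply: mulr_ge0; [exact: mulr_ge0 B0 (gker_ge0 _ _)|rewrite invr_ge0 ltW].
have iG : lam.-integrable D (EFin \o G).
  apply/integrableP; split.
    by apply/measurable_EFinP; exact: measurable_fun_pos.
  under eq_integral.
    move=> x /[!inE]/= /[!in_itv]/= /andP[x0 _].
    by rewrite (ger0_norm (G0 x x0)); over.
  rewrite ge0_integral_expR//.
  under eq_integral do rewrite /G expRK divfK ?gt_eqF ?expR_gt0//.
  by rewrite -(EFin_Rintegral (integrable_mulC B (integrable_gker e0))) ltry.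
have fNG N x : D x -> `|fN N x| <= G x.
  rewrite /= in_itv/= andbT => x0; rewrite normrM normfV (gtr0_norm x0).
  by rewrite ler_pM2r ?invr_gt0.
have iF : lam.-integrable D (EFin \o f).
  apply: (le_integrable _ _ _ iG) => //; first exact/measurable_EFinP.
  move=> x Dx /=; rewrite lee_fin; apply: le_trans (ler_norm _).
  have ca : `|fN N x| @[N --> \oo] --> `|f x| by apply: cvg_norm; exact: ff.
  rewrite -(cvg_lim _ ca)//; apply: limr_le; first by apply/cvg_ex; eexists; exact: ca.
  by apply: nearW => N; exact: fNG.
split=> //.
pose I := b n * (expR ((2 * a + 1) * hln2) * gamN a n%:R * pi / sinh (2 * pi * n%:R) * (pi / 2)).
have mfE N : measurable_fun D (fun t => (fN N t)%:E) by exact/measurable_EFinP.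
have ffE x : (fN N x)%:E @[N --> \oo] --> (f x)%:E.
  by apply: cvg_EFin; [exact: nearW|exact: ff].
have C1 := @dominated_cvg _ mR R lam D (measurable_itv _) (fun N t => (fN N t)%:E)
  (EFin \o f) (EFin \o G) mfE (fun x _ => ffE x) (fun x _ => isT) iG (fun N x Dx => fNG N x Dx).
have C2 : (\int[lam]_(x in D) (fN N x)%:E)%E @[N --> \oo] --> I%:E.
  apply: cvg_near_cst; near=> N.
  have nN : (n <= N)%N by near: N; exists n.
  have -> : (\int[lam]_(x in D) (fN N x)%:E = \int[lam]_t (g N t)%:E)%E.
    rewrite integral_expR; last by move=> x x0; exact: (continuous_lnV (cg N)).
    by apply: eq_integral => t _; rewrite /fN expRK divfK ?gt_eqF ?expR_gt0.
  have ig : lam.-integrable setT (EFin \o g N).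
    apply: (@integrable_le_norm _ mR R lam _ _ _ (integrable_mulC B (integrable_gker e0)) (gB N)).
    exact: continuous_measurable_fun.
  rewrite -(EFin_Rintegral ig) integral_psum; congr EFin.
  transitivity (\sum_(1 <= m < N.+1 | m == n) b m *
    (expR ((2 * a + 1) * hln2) * gamN a m%:R * pi / sinh (2 * pi * m%:R) * (pi / 2))).
    rewrite [RHS]big_mkcond; apply: eq_big_nat => m /andP[m1 _].
    rewrite integral_wker_sinproj//; case: eqP => // _; by rewrite !mulr0.
  by rewrite big_nat1_eq n0 ltnS nN.
by rewrite -(cvg_lim _ C1)// (cvg_lim _ C2).
Unshelve. all: by end_near. Qed.

End Series.

(** * The Gamma function and the kernel of the inversion *)

Section SpecialValues.
Context {R : realType}.
Local Open Scope complex_scope.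
Local Notation lam := (@lebesgue_measure R).
Local Notation D := (`](0 : R)%R, +oo[%classic).
Implicit Types (mu a b m x z u : R).

Lemma Rintegral_expR (g h : R -> R) : (forall x : R, 0 < x -> {for x, continuous g}) ->
  (forall t, g (expR t) * expR t = h t) ->
  \int[lam]_(x in D) g x = \int[lam]_t h t.
Proof.
move=> cg gh; rewrite /Rintegral integral_expR//.
by congr fine; apply: eq_integral => t _; rewrite gh.
Qed.

Lemma GammaE b m : 0 < b -> Gamma (b +i* m) = gamC b m +i* gamS b m.
Proof.
move=> b0; rewrite /Gamma /cintegral.
have E t : cpow t (b +i* m - 1) * (expR (- t))%:C =
    (expR ((b - 1) * ln t) * cos (m * ln t) * expR (- t)) +i*
    (expR ((b - 1) * ln t) * sin (m * ln t) * expR (- t)).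
  rewrite /cpow /cexp /=; apply/eqP; rewrite eq_complex/=; apply/andP; split; apply/eqP.
    by rewrite !(mulr0, subr0, addr0, oppr0, add0r).
  by rewrite !(mulr0, subr0, addr0, oppr0, add0r).
have ce : forall x : R, 0 < x -> {for x, continuous (fun x => expR ((b - 1) * ln x))}.
  move=> x x0; apply: continuous_comp; last exact: continuous_expR.
  by apply: cvgM; [exact: cvg_cst|exact: continuous_ln].
have cn : continuous (fun x : R => expR (- x)).
  by move=> x; apply: continuous_comp; [exact: cvgN|exact: continuous_expR].
have cm (x : R) : 0 < x -> {for x, continuous (fun x => m * ln x)}.
  by move=> x0; apply: cvgM; [exact: cvg_cst|exact: continuous_ln].
congr (_ +i* _).
- under eq_Rintegral do rewrite E /=.
  apply: Rintegral_expR => [x x0|t].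
    apply: cvgM; last exact: cn.
    apply: cvgM; first exact: ce.
    by apply: continuous_comp; [exact: cm|exact: continuous_cos].
  rewrite expRK /gker mulrAC -mulrA mulrAC -mulrA.
  have -> : expR (b * t - expR t) = expR ((b - 1) * t) * (expR (- expR t) * expR t).
    by rewrite -!expRD; congr expR; move: (expR t) => *; ring.
  by move: (expR ((b - 1) * t)) (expR (- expR t)) (expR t) (cos _) => *; ring.
- under eq_Rintegral do rewrite E /=.
  apply: Rintegral_expR => [x x0|t].
    apply: cvgM; last exact: cn.
    apply: cvgM; first exact: ce.
    by apply: continuous_comp; [exact: cm|exact: continuous_sin].
  rewrite expRK /gker.
  have -> : expR (b * t - expR t) = expR ((b - 1) * t) * (expR (- expR t) * expR t).
    by rewrite -!expRD; congr expR; move: (expR t) => *; ring.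
  by move: (expR ((b - 1) * t)) (expR (- expR t)) (expR t) (sin _) => *; ring.
Qed.

Lemma Gamma_real b : 0 < b -> Gamma b%:C = (gam b)%:C.
Proof.
move=> b0; rewrite (GammaE 0 b0); congr (_ +i* _).
  by apply: eq_Rintegral => x _; rewrite mul0r cos0 mulr1.
rewrite /gamS /Rintegral -[RHS]/(fine 0%E) -(@integral0 _ _ R lam setT); congr fine.
by apply: eq_integral => x _; rewrite mul0r sin0 mulr0.
Qed.

Lemma normc_Gamma b m : 0 < b -> Normc.normc (Gamma (b +i* m)) ^+ 2 = gamN b m.
Proof. by move=> b0; rewrite GammaE//= sqr_sqrtr// addr_ge0 ?sqr_ge0. Qed.

Lemma cintegral_real (E : set R) (f : R -> R) :
  cintegral E (fun x => (f x)%:C) = (\int[lam]_(x in E) f x)%:C.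
Proof.
rewrite /cintegral /=; congr (_ +i* _).
rewrite /Rintegral -[RHS]/(fine 0%E) -(@integral0 _ _ R lam E); congr fine.
Qed.

(** The power of x in the defining integral is - 2 mu, that is 2 a at a = - mu, so the integral is
    [lap (- mu)]. *)
Lemma parabolic_cylinder_real mu z : mu < 1 / 2 -> 0 <= z ->
  parabolic_cylinder (2 * mu - 1)%:C z%:C =
    (expR (- (z ^+ 2 / 4)) / gam (1 - 2 * mu) * lap (- mu) z)%:C.
Proof.
move=> hmu z0; rewrite /parabolic_cylinder.
have -> : - (2 * mu - 1)%:C = (1 - 2 * mu)%:C :> R[i] by rewrite -rmorphN opprB.
rewrite Gamma_real; last by lra.
have -> : - (z%:C ^+ 2 / 4%:R) = (- (z ^+ 2 / 4))%:C :> R[i].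
  by rewrite rmorphN rmorphM rmorphXn fmorphV rmorph_nat.
rewrite cexp_real.
have E x : cpow x ((1 - 2 * mu)%:C - 1) * cexp (- (x ^+ 2 / 2)%:C - z%:C * x%:C) =
    (expR (- (2 * mu) * ln x) * expR (- (x ^+ 2 / 2) - z * x))%:C.
  have -> : (1 - 2 * mu)%:C - 1 = (- (2 * mu))%:C :> R[i].
    by rewrite -(rmorph1 (real_complex R)) -rmorphB; congr (_%:C); ring.
  have -> : - (x ^+ 2 / 2)%:C - z%:C * x%:C = (- (x ^+ 2 / 2) - z * x)%:C :> R[i].
    by rewrite rmorphB rmorphN [in RHS](rmorphM _ z x).
  by rewrite cpow_real cexp_real -rmorphM.
have -> : cintegral D (fun x => cpow x ((1 - 2 * mu)%:C - 1) *
    cexp (- (x ^+ 2 / 2)%:C - z%:C * x%:C)) = (lap (- mu) z)%:C.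
  under [X in cintegral D X]funext do rewrite E.
  rewrite cintegral_real; congr (_%:C); apply: Rintegral_expR => [x x0|k].
    apply: cvgM.
      apply: continuous_comp; last exact: continuous_expR.
      by apply: cvgM; [exact: cvg_cst|exact: continuous_ln].
    apply: continuous_comp; last exact: continuous_expR.
    apply: cvgB; last by apply: cvgM; [exact: cvg_cst|exact: cvg_id].
    apply: cvgN; apply: cvgM; last exact: cvg_cst.
    exact: (hasd_continuous (hasd_sqr (@hasd_id _ x))).
  rewrite expRK /lapk -!expRD; congr expR.
  have -> : expR (2 * k) = expR k ^+ 2 by rewrite expr2 -expRD; congr expR; ring.
  by move: (expR k) => *; ring.
by rewrite -fmorphV -!rmorphM.
Qed.

End SpecialValues.

Section PhiFormula.
Context {R : realType}.
Local Open Scope complex_scope.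
Local Notation lam := (@lebesgue_measure R).
Local Notation mR := (measurableTypeR R).
Local Notation I := (`[(0 : R)%R, pi]%classic).
Implicit Types (mu a s x z u : R) (n : nat).

Lemma continuous_lap a z : 0 < a -> 0 < z -> {for z, continuous (lap a)}.
Proof.
move=> a0 z0; have h0 : 0 < a + 1 / 2 by rewrite addr_gt0.
have dl := is_derive_lap h0 z0; rewrite (addrK (1 / 2) a) in dl.
exact: hasd_continuous dl.
Qed.

Lemma continuous_integrable_itv (f : R -> R) : continuous f -> lam.-integrable I (EFin \o f).
Proof.
move=> cf; apply: continuous_compact_integrable; first exact: segment_compact.
exact: continuous_subspaceT.
Qed.

Lemma is_derive_lap_cosh mu s u : mu < 1 / 2 -> 0 < s ->
  is_derive u 1 (fun u => lap (- mu) (s * cosh u)) (s * sinh u * - lap (1 / 2 - mu) (s * cosh u)).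
Proof.
move=> hmu s0; have a0 : 0 < 1 / 2 - mu by lra.
have E : 1 / 2 - mu - 1 / 2 = - mu by ring.
have dz : hasd (fun u => s * cosh u) u (s * sinh u).
  apply: (@hasd_eq _ _ _ (0 * cosh u + s * sinh u)); last by ring.
  by apply: hasd_mul; [exact: hasd_cst|exact: hasd_cosh].
have zp : 0 < s * cosh u by rewrite mulr_gt0 ?cosh_gt0.
have dl := is_derive_lap a0 zp; rewrite E in dl.
exact: (@is_derive_compf _ (fun u => s * cosh u) (lap (- mu)) u _ _ dl dz).
Qed.

Lemma continuous_cos_lap mu n s : mu < 1 / 2 -> 0 < s ->
  continuous (fun u => cos (2 * n%:R * u) * lap (- mu) (s * cosh u)).
Proof.
move=> hmu s0 u; apply: cvgM; last exact: hasd_continuous (is_derive_lap_cosh u hmu s0).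
apply: continuous_comp; last exact: continuous_cos.
by apply: cvgM; [exact: cvg_cst|exact: cvg_id].
Qed.

(** Integration by parts: sin (2 n u) vanishes at 0 and at pi, and the derivative of the Laplace
    factor raises its index from - mu to 1 / 2 - mu, the index paired with the Whittaker kernel. *)
Lemma integral_cos_lap mu n s : mu < 1 / 2 -> 0 < s -> (0 < n)%N ->
  \int[lam]_(u in I) (cos (2 * n%:R * u) * lap (- mu) (s * cosh u)) =
  s / (2 * n%:R) * \int[lam]_(u in I) (sin (2 * n%:R * u) * sinh u * lap (1 / 2 - mu) (s * cosh u)).
Proof.
move=> hmu s0 n0; pose a := 1 / 2 - mu; have a0 : 0 < a by rewrite /a; lra.
pose k : R := 2 * n%:R; have k0 : k != 0 by rewrite gt_eqF// mulr_gt0// ltr0n.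
have zp u : 0 < s * cosh u by rewrite mulr_gt0 ?cosh_gt0.
have dk (u : R) : hasd (fun u => k * u) u k.
  by apply: (@hasd_eq _ _ _ (0 * u + k * 1)); [apply: hasd_mul; [exact: hasd_cst|exact: hasd_id]|ring].
have dG (u : R) : hasd (fun u => lap (- mu) (s * cosh u)) u (s * sinh u * - lap a (s * cosh u)).
  exact: is_derive_lap_cosh.
pose f1 u : R := cos (k * u) * lap (- mu) (s * cosh u).
pose f2 u : R := sin (k * u) * sinh u * lap a (s * cosh u).
have c1 : continuous f1.
  exact: continuous_cos_lap.
have c2 : continuous f2.
  move=> u; apply: cvgM.
    exact: (hasd_continuous (hasd_mul (hasd_sin (dk u)) (hasd_sinh u))).
  apply: (@continuous_comp _ _ _ (fun u => s * cosh u) (lap a)).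
    by apply: cvgM; [exact: cvg_cst|exact: hasd_continuous (hasd_cosh u)].
  exact: continuous_lap.
have i1 := continuous_integrable_itv c1; have i2 := continuous_integrable_itv c2.
have i3 : lam.-integrable I (EFin \o (fun u => s / k * f2 u)).
  by apply: continuous_integrable_itv => u; apply: cvgM; [exact: cvg_cst|exact: c2].
pose F u : R := sin (k * u) * lap (- mu) (s * cosh u) / k.
have c3 : continuous (fun u => f1 u - s / k * f2 u).
  by move=> u; apply: cvgB; [exact: c1|apply: cvgM; [exact: cvg_cst|exact: c2]].
have dF (u : R) : is_derive u 1 F (f1 u - s / k * f2 u).
  apply: (@hasd_eq _ _ _ ((k * cos (k * u) * lap (- mu) (s * cosh u) +
     sin (k * u) * (s * sinh u * - lap a (s * cosh u))) * k^-1 +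
     sin (k * u) * lap (- mu) (s * cosh u) * 0)).
    apply: hasd_mul; last exact: hasd_cst.
    by apply: hasd_mul; [exact: hasd_sin (dk u)|exact: dG].
  rewrite /f1 /f2; move: (lap _ _) (lap a _) (sinh u) (cos _) (sin _) => *.
  by field.
have := integral_itv_derive (pi_ge0 R) dF c3.
rewrite /F mulr0 sin0 mul0r mul0r (_ : sin (k * pi) = 0); last exact: sin_2pin.
rewrite !mul0r subrr => H.
have mI : measurable I := measurable_itv _.
apply: etrans (@RintegralZl _ mR R lam I f2 (s / k) mI i2).
apply/eqP; rewrite -subr_eq0; apply/eqP.
by apply: etrans (esym (@RintegralB _ mR R lam I _ _ mI i1 i3)) _; rewrite /Rintegral H.
Qed.

Lemma sinprojE a n t : sinproj a n t =
  \int[lam]_(u in I) (sin (2 * n%:R * u) * sinh u * lap a (expR (hln2 + t / 2) * cosh u)).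
Proof.
rewrite [RHS]Rintegral_mkcond patch_indic; apply: eq_Rintegral => u _.
by rewrite /angk/= -[LHS]mulrA mulrC.
Qed.

Lemma PhiE mu n x : mu < 1 / 2 -> 0 < x -> (0 < n)%N ->
  Phi mu n x = (expR (hln2 + ln x / 2) / (2 * n%:R * gam (1 - 2 * mu)) *
    sinproj (1 / 2 - mu) n (ln x))%:C.
Proof.
move=> hmu x0 n0; pose s := expR (hln2 + ln x / 2).
have s2 : s ^+ 2 = 2 * x.
  rewrite /s expr2 -expRD -[in RHS]expR_2hln2 -[x in RHS]lnK ?posrE// -expRD.
  by congr expR; move: hln2 (ln x) => *; field.
have s0 : 0 < s by exact: expR_gt0.
have sE : Num.sqrt (2 * x) = s by rewrite -s2 sqrtr_sqr gtr0_norm.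
rewrite /Phi sE.
have g0 : 0 < gam (1 - 2 * mu) by apply: gam_gt0; lra.
have E u : (expR (x * cosh u ^+ 2 / 2))%:C *
    parabolic_cylinder (2 * mu - 1)%:C (s * cosh u)%:C * (cos (2 * n%:R * u))%:C =
    ((gam (1 - 2 * mu))^-1 * (cos (2 * n%:R * u) * lap (- mu) (s * cosh u)))%:C.
  have z0 : 0 <= s * cosh u by rewrite mulr_ge0// ltW// cosh_gt0.
  rewrite parabolic_cylinder_real// -!rmorphM; congr (_%:C).
  (* The growing exponential in Phi is chosen to cancel the Gaussian factor of D, since s ^ 2 = 2
     x. *)
  have h : expR (x * cosh u ^+ 2 / 2) * expR (- ((s * cosh u) ^+ 2 / 4)) = 1.
    rewrite -expRD [(s * _) ^+ 2]exprMn s2; have -> : x * cosh u ^+ 2 / 2 - 2 * x * cosh u ^+ 2 / 4 = 0 by field.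
    by rewrite expR0.
  move: h; move: (expR (x * _ / 2)) (expR (- _)) => e1 e2 h.
  rewrite -[RHS]mul1r -h.
  by move: (lap _ _) (cos _) (gam _)^-1 => *; ring.
under [X in cintegral _ X]funext do rewrite E.
rewrite cintegral_real; congr (_%:C).
have iI := continuous_integrable_itv (@continuous_cos_lap mu n s hmu s0).
apply: (etrans (@RintegralZl _ mR R lam I _ (gam (1 - 2 * mu))^-1 (measurable_itv _) iI)).
rewrite integral_cos_lap// sinprojE -/s mulrA; congr (_ * _).
have n1 : n%:R != 0 :> R by rewrite pnatr_eq0 -lt0n.
by field; rewrite n1 gt_eqF.
Qed.

End PhiFormula.

(** * The inversion formula *)

Section Inversion.
Context {R : realType}.
Local Open Scope complex_scope.
Implicit Types (mu x : R) (n m : nat).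

Lemma Re_le_normc (z : R[i]) : `|complex.Re z| <= Normc.normc z.
Proof. by case: z => x y /=; rewrite -sqrtr_sqr ler_wsqrtr// lerDl sqr_ge0. Qed.

Lemma Im_le_normc (z : R[i]) : `|complex.Im z| <= Normc.normc z.
Proof. by case: z => x y /=; rewrite -sqrtr_sqr ler_wsqrtr// lerDr sqr_ge0. Qed.

Lemma partial_sums_le (u : nat -> R) : (forall m, 0 <= u m) ->
  (\sum_(1 <= m <oo) (u m)%:E < +oo)%E -> exists S, forall N, \sum_(1 <= m < N.+1) u m <= S.
Proof.
move=> u0 us; have u0E m : (0 <= (u m)%:E)%E by rewrite lee_fin.
have fs : (\sum_(1 <= m <oo) (u m)%:E)%E \is a fin_num.
  by rewrite ge0_fin_numE// nneseries_ge0.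
exists (fine (\sum_(1 <= m <oo) (u m)%:E)%E) => N.
by rewrite -lee_fin fineK// -sumEFin; apply: nneseries_lim_ge.
Qed.

(** The map [p] will be the real or the imaginary part. *)
Lemma coef_sums_le mu (a : nat -> R[i]) (delta : R) (p : R[i] -> R) : mu < 1 / 2 ->
  (forall z, `|p z| <= Normc.normc z) ->
  (\sum_(1 <= m <oo)
     (Normc.normc (a m) * expR (- (2 * delta * m%:R)) /
      Normc.normc (Gamma ((1 / 2 - mu) +i* m%:R)) ^+ 2)%R%:E < +oo)%E ->
  exists S, forall N, \sum_(1 <= m < N.+1)
    `|p (a m) / gamN (1 / 2 - mu) m%:R| * expR (- (2 * delta * m%:R)) <= S.
Proof.
move=> hmu pn ha; have a0 : 0 < 1 / 2 - mu by lra.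
have [|S HS] := @partial_sums_le (fun m => Normc.normc (a m) * expR (- (2 * delta * m%:R)) /
      Normc.normc (Gamma ((1 / 2 - mu) +i* m%:R)) ^+ 2) _ ha.
  move=> m; rewrite divr_ge0 ?sqr_ge0// mulr_ge0 ?expR_ge0//.
  exact: le_trans (Re_le_normc (a m)).
exists S => N; apply: le_trans (HS N); apply: ler_sum => m _.
rewrite normc_Gamma// normrM normfV (gtr0_norm (gamN_gt0 _ a0)) mulrAC.
rewrite ler_pM2r ?invr_gt0 ?gamN_gt0//.
by apply: ler_wpM2r; [exact: expR_ge0|exact: pn].
Qed.

(** The prefactor e^(- x / 2) of the transform joins the one inside [whitt]; this is why [wker]
    carries e^(- x). *)
Lemma lim_whitt mu (delta S : R) (c : nat -> R) x : mu < 1 / 2 -> 0 <= delta < pi / 2 ->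
  (forall N, \sum_(1 <= m < N.+1)
     `|c m / gamN (1 / 2 - mu) m%:R| * expR (- (2 * delta * m%:R)) <= S) ->
  0 < x ->
  expR (- (x / 2)) * limn (fun N => \sum_(1 <= m < N.+1) c m * whitt mu m%:R x) =
  wseries (1 / 2 - mu) (fun m => c m / gamN (1 / 2 - mu) m%:R) (ln x).
Proof.
move=> hmu dI cS x0; have a0 : 0 < 1 / 2 - mu by lra.
have C := cvg_wseries a0 dI cS (t := ln x).
have E N : \sum_(1 <= m < N.+1) c m * whitt mu m%:R x = expR (x / 2) *
    \sum_(1 <= m < N.+1) c m / gamN (1 / 2 - mu) m%:R * wker (1 / 2 - mu) m (ln x).
  rewrite mulr_sumr; apply: eq_bigr => m _.
  rewrite /whitt /wker expRN lnK ?posrE//.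
  have -> : 1 / 2 - (1 / 2 - mu) = mu by ring.
  have -> : mu * ln x - x / 2 = x / 2 + (mu * ln x - x) by field.
  rewrite expRD; move: (expR (x / 2)) (expR _) (tric _ _ _) (gamN _ _)^-1 => *; ring.
under eq_fun do rewrite E.
have C2 : expR (x / 2) * \sum_(1 <= m < N.+1)
    c m / gamN (1 / 2 - mu) m%:R * wker (1 / 2 - mu) m (ln x) @[N --> \oo] -->
    expR (x / 2) * wseries (1 / 2 - mu) (fun m => c m / gamN (1 / 2 - mu) m%:R) (ln x).
  by apply: cvgM => //; exact: cvg_cst.
rewrite (cvg_lim _ C2)// mulrA -expRD addNr expR0 mul1r.
by [].
Qed.

Lemma index_whittakerE mu (a : nat -> R[i]) (delta S S' : R) x : mu < 1 / 2 ->
  0 <= delta < pi / 2 ->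
  (forall N, \sum_(1 <= m < N.+1)
     `|complex.Re (a m) / gamN (1 / 2 - mu) m%:R| * expR (- (2 * delta * m%:R)) <= S) ->
  (forall N, \sum_(1 <= m < N.+1)
     `|complex.Im (a m) / gamN (1 / 2 - mu) m%:R| * expR (- (2 * delta * m%:R)) <= S') ->
  0 < x ->
  index_whittaker mu a x =
    wseries (1 / 2 - mu) (fun m => complex.Re (a m) / gamN (1 / 2 - mu) m%:R) (ln x) +i*
    wseries (1 / 2 - mu) (fun m => complex.Im (a m) / gamN (1 / 2 - mu) m%:R) (ln x).
Proof.
move=> hmu dI aS aS' x0.
rewrite -(lim_whitt hmu dI aS x0) -(lim_whitt hmu dI aS' x0) /index_whittaker /csum1.
have W m : whittakerW mu%:C (0 +i* m%:R) x = (whitt mu m%:R x)%:C by exact: whittakerW_whitt.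
have ER N : \sum_(1 <= m < N.+1) complex.Re (a m * whittakerW mu%:C (0 +i* m%:R) x) =
    \sum_(1 <= m < N.+1) complex.Re (a m) * whitt mu m%:R x.
  by apply: eq_bigr => m _; rewrite W mulrC Re_mulr mulrC.
have EI N : \sum_(1 <= m < N.+1) complex.Im (a m * whittakerW mu%:C (0 +i* m%:R) x) =
    \sum_(1 <= m < N.+1) complex.Im (a m) * whitt mu m%:R x.
  by apply: eq_bigr => m _; rewrite W mulrC Im_mulr mulrC.
under eq_fun do rewrite ER.
under [X in _ +i* limn X]eq_fun do rewrite EI.
by apply/eqP; rewrite eq_complex Re_mulr Im_mulr/= !eqxx.
Qed.

(** The factor sqrt (2 x) from [PhiE] turns x ^ (- 3 / 2) dx into a multiple of dx / x, the measure
    dt for t = ln x. *)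
Lemma powR_half_shift x : 0 < x ->
  expR (hln2 + ln x / 2) * x `^ (- (3 / 2)) = expR hln2 / x.
Proof.
move=> x0; rewrite /powR gt_eqF// expRD -mulrA -expRD; congr (_ * _).
by rewrite -[in RHS](lnK (x := x)) ?posrE// -expRN; congr expR; field.
Qed.

(** As powers of sqrt 2 the exponents are 1 + 2 mu, 1 and 2 - 2 mu, with sum 4: the factor 2 ^ (1 /
    2 + mu) compensates the dependence on mu of the Laplace pairing. *)
Lemma inversion_const mu : 2 `^ (1 / 2 + mu) * expR hln2 * expR ((2 * (1 / 2 - mu) + 1) * hln2) = 4 :> R.
Proof.
have -> : 2 `^ (1 / 2 + mu) = expR ((1 + 2 * mu) * hln2) :> R.
  by rewrite /powR pnatr_eq0 /=; congr expR; rewrite /hln2; field.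
rewrite -!expRD; have -> : (1 + 2 * mu) * hln2 + hln2 + (2 * (1 / 2 - mu) + 1) * hln2 =
  2 * hln2 + 2 * hln2 :> R by move: hln2 => *; field.
by rewrite expRD expR_2hln2; ring.
Qed.

End Inversion.

Local Open Scope complex_scope.
Theorem theorem1 (R : realType) (mu : R) (hmu : mu < 1 / 2)
  (a : nat -> R[i]) (delta : R) (hdelta : 0 <= delta < pi / 2)
  (ha : (\sum_(1 <= m <oo)
           (Normc.normc (a m) * expR (- (2 * delta * m%:R)) /
            Normc.normc (Gamma ((1 / 2 - mu) +i* m%:R)) ^+ 2)%R%:E < +oo)%E) :
  forall n : nat, (1 <= n)%N ->
    let g := fun t : R =>
      Phi mu n t * index_whittaker mu a t * (t `^ (- (3 / 2)))%:C in
    cintegrable `]0, +oo[ g /\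
    a n = (2 `^ (1 / 2 + mu) / pi ^+ 2)%:C * Gamma (1 - 2 * mu)%:C *
          (n%:R * sinh (2 * pi * n%:R))%:C * cintegral `]0, +oo[ g.
Proof.
move=> n n1 g; have a0 : 0 < 1 / 2 - mu by lra.
have [S aS] := coef_sums_le hmu (@Re_le_normc R) ha.
have [S' aS'] := coef_sums_le hmu (@Im_le_normc R) ha.
have [iRe vRe] := wseries_sinproj a0 hdelta n1 aS.
have [iIm vIm] := wseries_sinproj a0 hdelta n1 aS'.
(* The constant of [PhiE] once [powR_half_shift] has absorbed the powers of x. *)
pose K := expR hln2 / (2 * n%:R * gam (1 - 2 * mu)).
pose fr x := wseries (1 / 2 - mu) (fun m => complex.Re (a m) / gamN (1 / 2 - mu) m%:R) (ln x) *
  sinproj (1 / 2 - mu) n (ln x) / x.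
pose fi x := wseries (1 / 2 - mu) (fun m => complex.Im (a m) / gamN (1 / 2 - mu) m%:R) (ln x) *
  sinproj (1 / 2 - mu) n (ln x) / x.
have gE x : 0 < x -> g x = (K * fr x) +i* (K * fi x).
  move=> x0; rewrite /g PhiE// (index_whittakerE hmu hdelta aS aS' x0).
  have h := powR_half_shift x0.
  have E (w : R) : expR (hln2 + ln x / 2) / (2 * n%:R * gam (1 - 2 * mu)) *
      sinproj (1 / 2 - mu) n (ln x) * w * x `^ (- (3 / 2)) =
      K * (w * sinproj (1 / 2 - mu) n (ln x) / x).
    transitivity (expR (hln2 + ln x / 2) * x `^ (- (3 / 2)) * (2 * n%:R * gam (1 - 2 * mu))^-1 *
      sinproj (1 / 2 - mu) n (ln x) * w).
      move: ((2 * n%:R * gam (1 - 2 * mu))^-1) => k; move: (expR _) (x `^ _) (sinproj _ _ _) => *.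
      by ring.
    rewrite h /K; move: ((2 * n%:R * gam (1 - 2 * mu))^-1) => k.
    by move: (expR _) (sinproj _ _ _) (x^-1) => *; ring.
  apply/eqP; rewrite mulrC eq_complex Re_mulr Im_mulr Re_mulr Im_mulr /=.
  by rewrite ![_ `^ _ * _]mulrC !E !eqxx.
have inD (x : R) : x \in `]0, +oo[%classic -> 0 < x by rewrite inE/= in_itv/= andbT.
have EK (f : R -> R) : lebesgue_measure.-integrable `]0, +oo[ (EFin \o f) ->
    lebesgue_measure.-integrable `]0, +oo[ (EFin \o (fun x => K * f x)).
  move=> If.
  have h := @integrableZl _ (measurableTypeR R) R lebesgue_measure _ (measurable_itv _) K (EFin \o f) If.
  exact: h.
split.
  split.
    apply: eq_integrable (EK _ iRe) => // x /inD x0.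
    by rewrite gE.
  apply: eq_integrable (EK _ iIm) => // x /inD x0.
  by rewrite gE.
have Er : \int[lebesgue_measure]_(x in `]0, +oo[) complex.Re (g x) =
   K * \int[lebesgue_measure]_(x in `]0, +oo[) fr x.
  rewrite -(@RintegralZl _ (measurableTypeR R) R lebesgue_measure _ fr K (measurable_itv _) iRe).
  by apply: eq_Rintegral => x /inD x0; rewrite gE.
have Ei : \int[lebesgue_measure]_(x in `]0, +oo[) complex.Im (g x) =
   K * \int[lebesgue_measure]_(x in `]0, +oo[) fi x.
  rewrite -(@RintegralZl _ (measurableTypeR R) R lebesgue_measure _ fi K (measurable_itv _) iIm).
  by apply: eq_Rintegral => x /inD x0; rewrite gE.
rewrite /cintegral Er Ei /Rintegral vRe vIm /=.
have b0 : 0 < 1 - 2 * mu by lra.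
rewrite (Gamma_real b0).
have gN : gamN (1 / 2 - mu) n%:R != 0 by rewrite gt_eqF// gamN_gt0.
have g0 : gam (1 - 2 * mu) != 0 by rewrite gt_eqF// gam_gt0.
have p0 : 0 < pi :> R := pi_gt0 R.
have n0 : 0 < n%:R :> R by rewrite ltr0n.
have s0 : sinh (2 * pi * n%:R) != 0 :> R.
  have p : 0 < 2 * pi * n%:R :> R by rewrite !mulr_gt0.
  have h := sinh_ge (ltW p); rewrite /sinh gt_eqF// divr_gt0//.
  by apply: lt_le_trans h; rewrite mulr_gt0.
have C := inversion_const mu.
(* The 4 of [inversion_const] cancels the 2 in the denominator 2 n of [K] and the 2 in pi / 2; the
   square of pi cancels one pi from the Laplace pairing and one from orthogonality. *)
have key (r : R) : 2 `^ (1 / 2 + mu) / pi ^+ 2 * gam (1 - 2 * mu) * (n%:R * sinh (2 * pi * n%:R)) *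
    (K * (r / gamN (1 / 2 - mu) n%:R * (expR ((2 * (1 / 2 - mu) + 1) * hln2) *
      gamN (1 / 2 - mu) n%:R * pi / sinh (2 * pi * n%:R) * (pi / 2)))) = r.
  transitivity (2 `^ (1 / 2 + mu) * expR hln2 * expR ((2 * (1 / 2 - mu) + 1) * hln2) / 4 * r).
    rewrite /K; move: (expR ((2 * (1 / 2 - mu) + 1) * hln2)) => E.
    move: (expR hln2) (2 `^ (1 / 2 + mu)) => B A.
    move: gN g0 s0 (lt0r_neq0 p0) (lt0r_neq0 n0).
    move: (sinh _) => s; move: (gamN _ _) => y; move: (gam _) => x.
    move: (n%:R : R) => w; move: (@pi R) => z *.
    by field; do ?[apply/andP; split].
  by rewrite C divff ?mul1r// pnatr_eq0.
rewrite -!rmorphM; apply/eqP; rewrite eq_complex Re_mulr Im_mulr /=.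
by rewrite !key !eqxx.
Qed.
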